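(* Let $N_1,\dots,N_s\ge2$ ($s\ge1$) be pairwise coprime integers generating the multiplicative monoid $\mathcal S$, and for an analytic zero-free function $\alpha$ on $D$ with $\alpha(0)=1$ let $\Psi_{\mathcal S}(\alpha)(z)=\prod_{N\in\mathcal S}\alpha(z^N)$. (a) For $\alpha\in\mathcal O^\times\cap H^\infty(D)$ with $\alpha(0)=1$ we have $\Psi_{\mathcal S}(\alpha)\in\mathcal A^1_s$. For $\alpha\in\mathcal N^1$ we have $\Psi_{\mathcal S}(\alpha)\in\mathcal N^1_s$, and $\alpha$ is atomless if and only if $\Psi_{\mathcal S}(\alpha)$ is atomless. (b) We have $$\Psi_{\mathcal S}\big(Z(\mathcal S,\mathcal N^1)\big)\subset H^0(\mathcal S,\mathcal N^1_s)=\Big\{f\in\mathcal N^1_s: f(z^N)^N=\prod_{\zeta^N=1}f(\zeta z)\text{ for all }N\in\mathcal S\Big\}.$$ A function $\alpha\in Z(\mathcal S,\mathcal N^1)$ is atomless if and only if $\Psi_{\mathcal S}(\alpha)$ is atomless.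
   Context: $D$ is the open unit disc, $\mathbb T$ the unit circle, $\mathcal O=\mathcal O(D)$ the analytic functions on $D$, $H^\infty(D)$ the bounded ones. $\mathcal S=\{N_1^{\nu_1}\cdots N_s^{\nu_s}:\nu_i\ge0\}$. For $\alpha\in\mathcal O^\times$ with $\alpha(0)=1$ the product defining $\Psi_{\mathcal S}(\alpha)$ converges locally uniformly on $D$ to an element of $\mathcal O^\times$. For real $\gamma\ge0$, $\mathcal A_\gamma$ is the algebra of $f\in\mathcal O$ for which there are constants $a_f,r_f\ge0$ with $|f(z)|\le a_f\exp\big(r_f|\log(1-|z|)|^\gamma\big)$ for all $z\in D$; $\mathcal A^1_\gamma=\{f\in\mathcal A_\gamma: f(0)=1,\ f(z)\ne0\ \forall z\in D\}$; $\mathcal N_\gamma$ is the algebra of functions $f=g_1/g_2$ with $g_1,g_2\in\mathcal A_\gamma$ and $g_2$ zero-free; $\mathcal N^1_\gamma=\{f\in\mathcal N_\gamma^\times: f(0)=1\}$. $\mathcal N=\mathcal N_0$ is the Nevanlinna class and $\mathcal N^1=\mathcal N^1_0$. $Z(\mathcal S,\mathcal N^1)=\{u\in\mathcal N^1:\prod_{\zeta^N=1}u(\zeta z)=1\text{ for all }N\in\mathcal S, N\ne1\}$. For $f\in\mathcal O^\times$ and $\eta\in\mathbb T$ put $A(f)(\eta)=-\tfrac12\lim_{r\to1-}(1-r)\log|f(r\eta)|$ if the limit exists; $f$ is called atomless if $A(f)(\eta)$ exists and equals $0$ for every $\eta\in\mathbb T$. *)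

(* Defs.v *)
(* Stdlib reals with Coquelicot's complex numbers.  A function on the open
   unit disc is a total function [C -> C] of which only the values on the disc
   matter. *)
From Stdlib Require Import Reals ZArith Lra Lia List ClassicalEpsilon.
From Coquelicot Require Import Coquelicot.

Open Scope R_scope.

Definition in_D (z : C) : Prop := Cmod z < 1.

(* Analytic on the disc: complex differentiable at each of its points. *)
Definition analytic (f : C -> C) : Prop :=
  forall z : C, in_D z -> @ex_derive C_AbsRing C_NormedModule f z.

Definition zero_free (f : C -> C) : Prop :=
  forall z : C, in_D z -> f z <> RtoC 0.

(* Group of units of an algebra [A] of functions on the disc. *)
Definition units (A : (C -> C) -> Prop) (f : C -> C) : Prop :=
  A f /\ exists g : C -> C, A g /\ forall z : C, in_D z -> (f z * g z)%C = RtoC 1.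

Definition Hinfty (f : C -> C) : Prop :=
  analytic f /\ exists M : R, forall z : C, in_D z -> Cmod (f z) <= M.

(* Real power [x ^ g] for [x >= 0], with [0 ^ 0 = 1] and [0 ^ g = 0] for
   [g <> 0]; Stdlib's [Rpower 0 g] is always 1. *)
Definition rpow (x g : R) : R :=
  if Req_EM_T x 0 then (if Req_EM_T g 0 then 1 else 0) else Rpower x g.

Definition A_ (gam : R) (f : C -> C) : Prop :=
  analytic f /\
  exists a r : R, 0 <= a /\ 0 <= r /\
    forall z : C, in_D z ->
      Cmod (f z) <= a * exp (r * rpow (Rabs (ln (1 - Cmod z))) gam).

Definition A1_ (gam : R) (f : C -> C) : Prop :=
  A_ gam f /\ f (RtoC 0) = RtoC 1 /\ zero_free f.

Definition N_ (gam : R) (f : C -> C) : Prop :=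
  exists g1 g2 : C -> C, A_ gam g1 /\ A_ gam g2 /\ zero_free g2 /\
    forall z : C, in_D z -> f z = (g1 z / g2 z)%C.

Definition N1_ (gam : R) (f : C -> C) : Prop :=
  units (N_ gam) f /\ f (RtoC 0) = RtoC 1.

Definition in_monoid (s : nat) (N : nat -> nat) (m : nat) : Prop :=
  exists nu : nat -> nat,
    m = fold_right Nat.mul 1%nat (map (fun i => (N i ^ nu i)%nat) (seq 1 s)).

Definition Cprod (l : list C) : C := fold_right Cmult (RtoC 1) l.

(* The product of [alpha (z ^ m)] over the [m <= n] in the monoid. *)
Definition Psi_partial (s : nat) (N : nat -> nat) (alpha : C -> C)
    (z : C) (n : nat) : C :=
  Cprod (map (fun m => if excluded_middle_informative (in_monoid s N m)
                       then alpha (Cpow z m) else RtoC 1) (seq 1 n)).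

Definition Psi (s : nat) (N : nat -> nat) (alpha : C -> C) (z : C) : C :=
  @lim C_CompleteNormedModule (filtermap (Psi_partial s N alpha z) eventually).

Definition unity_roots (n : nat) : list C :=
  map (fun k => (cos (2 * PI * INR k / INR n), sin (2 * PI * INR k / INR n)) : C)
      (seq 0 n).

(* The product of [f (zeta z)] over all [zeta] with [zeta ^ n = 1]; see
   [in_unity_roots] and [NoDup_unity_roots] below. *)
Definition norm_prod (n : nat) (f : C -> C) (z : C) : C :=
  Cprod (map (fun zeta => f (zeta * z)%C) (unity_roots n)).

Definition Z_ (s : nat) (N : nat -> nat) (u : C -> C) : Prop :=
  N1_ 0 u /\
  forall n : nat, in_monoid s N n -> n <> 1%nat ->
    forall z : C, in_D z -> norm_prod n u z = RtoC 1.

Definition H0_ (s : nat) (N : nat -> nat) (gam : R) (f : C -> C) : Prop :=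
  N1_ gam f /\
  forall n : nat, in_monoid s N n ->
    forall z : C, in_D z -> Cpow (f (Cpow z n)) n = norm_prod n f z.

Definition is_atom_mass (f : C -> C) (eta : C) (a : R) : Prop :=
  exists l : R,
    filterlim (fun r : R => (1 - r) * ln (Cmod (f (RtoC r * eta)%C)))
              (at_left 1) (locally l) /\
    a = - (1 / 2) * l.

Definition atomless (f : C -> C) : Prop :=
  forall eta : C, Cmod eta = 1 -> is_atom_mass f eta 0.

Lemma Cpow_cis (t : R) (n : nat) :
  Cpow (cos t, sin t) n = (cos (INR n * t), sin (INR n * t)).
Proof.
  induction n as [|n IH].
  - simpl. rewrite Rmult_0_l, cos_0, sin_0. reflexivity.
  - rewrite Cpow_S, IH, S_INR.
    replace ((INR n + 1) * t) with (t + INR n * t) by ring.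
    rewrite cos_plus, sin_plus. unfold Cmult; simpl. f_equal; ring.
Qed.

Lemma cis_eq (a b : R) :
  (cos a, sin a) = (cos b, sin b) -> exists k : Z, a - b = 2 * PI * IZR k.
Proof.
  intros H. injection H as Hc Hs.
  assert (H1 : cos (a - b) = 1).
  { rewrite cos_minus, Hc, Hs.
    generalize (sin2_cos2 b); unfold Rsqr; lra. }
  assert (H2 : sin ((a - b) / 2) = 0).
  { replace (a - b) with (2 * ((a - b) / 2)) in H1 by field.
    rewrite cos_2a_sin in H1. nra. }
  destruct (sin_eq_0_0 _ H2) as [k Hk]. exists k. lra.
Qed.

Lemma exists_angle (x y : R) :
  x * x + y * y = 1 -> exists t : R, x = cos t /\ y = sin t.
Proof.
  intros H.
  assert (Hx : -1 <= x <= 1) by (split; nra).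
  assert (Hs : sin (acos x) = sqrt (1 - x * x)).
  { rewrite sin_acos by exact Hx. unfold Rsqr. reflexivity. }
  replace (1 - x * x) with (Rsqr y) in Hs by (unfold Rsqr; lra).
  rewrite sqrt_Rsqr_abs in Hs.
  destruct (Rle_dec 0 y) as [Hy|Hy].
  - exists (acos x). rewrite cos_acos, Hs by exact Hx.
    rewrite Rabs_pos_eq by exact Hy. split; reflexivity.
  - exists (- acos x). rewrite cos_neg, sin_neg, cos_acos, Hs by exact Hx.
    rewrite Rabs_left by lra. split; lra.
Qed.

Lemma in_unity_roots (n : nat) (zeta : C) :
  (0 < n)%nat -> In zeta (unity_roots n) <-> Cpow zeta n = RtoC 1.
Proof.
  intros Hn. assert (Hn' : 0 < INR n) by (apply lt_0_INR; exact Hn).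
  assert (HPI := PI_RGT_0).
  unfold unity_roots. rewrite in_map_iff. split.
  - intros [k [<- _]]. rewrite Cpow_cis.
    replace (INR n * (2 * PI * INR k / INR n)) with (0 + 2 * INR k * PI)
      by (field; lra).
    rewrite cos_period, sin_period, cos_0, sin_0. reflexivity.
  - intros H.
    assert (Hm : Cmod zeta = 1).
    { assert (Hp : (Cmod zeta ^ n)%R = 1).
      { rewrite <- Cmod_pow, H. apply Cmod_1. }
      destruct (Rtotal_order (Cmod zeta) 1) as [Hl|[He|Hg]].
      - exfalso. assert (Cmod zeta ^ n < 1); [|lra].
        apply pow_lt_1_compat; [split; [apply Cmod_ge_0|exact Hl]|exact Hn].
      - exact He.
      - exfalso. assert (1 < Cmod zeta ^ n); [|lra].
        apply Rlt_pow_R1; assumption. }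
    destruct zeta as [x y].
    assert (Hxy : x * x + y * y = 1).
    { unfold Cmod in Hm; simpl in Hm.
      assert (E : sqrt (x * (x * 1) + y * (y * 1)) *
                  sqrt (x * (x * 1) + y * (y * 1)) = 1) by (rewrite Hm; ring).
      rewrite sqrt_sqrt in E by nra. lra. }
    destruct (exists_angle x y Hxy) as [t [-> ->]].
    rewrite Cpow_cis in H.
    destruct (cis_eq (INR n * t) 0) as [k Hk].
    { rewrite H, cos_0, sin_0. reflexivity. }
    set (n' := Z.of_nat n). assert (Hnz : (0 < n')%Z) by (unfold n'; lia).
    assert (Hmod := Z.mod_pos_bound k n' Hnz).
    assert (Hdiv := Z.div_mod k n' ltac:(lia)).
    set (q := (k / n')%Z) in *. set (m := (k mod n')%Z) in *.
    exists (Z.to_nat m). split.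
    + rewrite INR_IZR_INZ, Z2Nat.id by lia.
      assert (Ht : t = 2 * PI * IZR m / INR n + 2 * IZR q * PI).
      { apply (Rmult_eq_reg_l (INR n)); [|lra].
        rewrite Rminus_0_r in Hk. rewrite Hk, Hdiv, plus_IZR, mult_IZR.
        unfold n'. rewrite <- INR_IZR_INZ. field. lra. }
      rewrite Ht. clear Ht Hk Hdiv.
      assert (P : forall x : R, cos (x + 2 * IZR q * PI) = cos x /\
                                sin (x + 2 * IZR q * PI) = sin x).
      { intros x. destruct (Z_le_gt_dec 0 q) as [Hq|Hq].
        - rewrite <- (Z2Nat.id q Hq), <- INR_IZR_INZ.
          split; [apply cos_period|apply sin_period].
        - rewrite <- (cos_period (x + 2 * IZR q * PI) (Z.to_nat (- q))).
          rewrite <- (sin_period (x + 2 * IZR q * PI) (Z.to_nat (- q))).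
          rewrite INR_IZR_INZ, Z2Nat.id, opp_IZR by lia.
          split; f_equal; ring. }
      destruct (P (2 * PI * IZR m / INR n)) as [-> ->]. reflexivity.
    + apply in_seq. unfold n' in *. lia.
Qed.

Lemma NoDup_unity_roots (n : nat) : NoDup (unity_roots n).
Proof.
  unfold unity_roots.
  apply NoDup_map_NoDup_ForallPairs; [|apply seq_NoDup].
  intros i j Hi Hj H. apply in_seq in Hi. apply in_seq in Hj.
  assert (Hn' : 0 < INR n) by (apply lt_0_INR; lia).
  assert (HPI := PI_RGT_0).
  destruct (cis_eq _ _ H) as [k Hk].
  assert (E : INR i - INR j = INR n * IZR k).
  { apply (Rmult_eq_reg_l (2 * PI / INR n)).
    - transitivity (2 * PI * INR i / INR n - 2 * PI * INR j / INR n);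
        [field; lra|rewrite Hk; field; lra].
    - apply Rgt_not_eq, Rdiv_lt_0_compat; lra. }
  rewrite !INR_IZR_INZ, <- minus_IZR, <- mult_IZR in E. apply eq_IZR in E.
  assert (k = 0)%Z by nia. nia.
Qed.

(* Main.v *)
(** The idea is to take logarithms.  A zero-free analytic function on the disc
    with value 1 at 0 is [exp F], and then [Psi (exp F) = exp H] with [H z] the
    sum of [F (z ^ m)] over [m] in the monoid [S].  If [Re F] is bounded,
    Borel-Caratheodory gives [|F z| <= K |z| / (1 - |z|)], hence
    [Re (F z) <= K' |z|], and [Re H] is controlled by the sum of [|z| ^ m] over
    [S], which is [O((1 + |log (1 - |z|)|) ^ s)].  An element of the Nevanlinna
    class is a quotient of two such functions.

    By coprimality, [S_(s+1)] is the disjoint union of [S_s] and of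
    [N_(s+1) S_(s+1)], so [H_(s+1) z = H_s z + H_(s+1) (z ^ N_(s+1))].  This
    identity yields both the power sum estimate and the statement on atoms by
    induction on [s].  The cocycle identity is checked on the generators, where
    [zeta -> zeta ^ m] either permutes the roots of unity of order [N_i] or sends
    them all to 1, and it is multiplicative in [N].

    Goursat's theorem on rectangles, in the coordinate [log w], says that circle
    means do not depend on the radius; power series expansions, and with them
    logarithms, follow from this. *)

Require Import Defs.
From Stdlib Require Import Reals Lra Lia List ClassicalEpsilon Permutation.
From Coquelicot Require Import Coquelicot.

Open Scope R_scope.


(** * Complex derivatives and the exponential *)

(** The Nevanlinna class offers only one-sided control: the logarithms [F1] and [F2] of numerator
    and denominator have real parts bounded above, and their difference is in general bounded on
    neither side. Growth is therefore estimated for numerator and denominator separately. Atoms need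
    two-sided control; there the modulus bound [K |z| / (1 - |z|)] is used, which survives taking
    differences. The identity for [H_(s+1)] by itself does not exclude a large [H_(s+1)]: it only
    improves a bound already at hand. The starting bound [|H z| <= C / (1 - |z|)] comes from
    [r ^ m / (1 - r ^ m) <= 1 / (m (1 - r))] and from the sum of the [1 / m] over the monoid being
    at most [2 ^ s]. The passage from circle means to power series goes through the difference
    quotient of [f] at [z], which is at first known only to be continuous at [z]; hence the mean
    value property is proved for continuous functions that may fail to be differentiable on one
    circle. *)

Definition Ccont (f : C -> C) (z : C) : Prop :=
  forall eps, 0 < eps -> exists d, 0 < d /\
    forall w, Cmod (w - z) < d -> Cmod (f w - f z) < eps.

(* Caratheodory's form of complex differentiability: the calculus rules reduce
   to those of continuity. *)
Definition Cder (f : C -> C) (z c : C) : Prop :=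
  exists phi : C -> C, Ccont phi z /\ phi z = c /\
    forall w, f w = (f z + phi w * (w - z))%C.

Lemma Cmod_sum_abs (z : C) : Cmod z <= Rabs (Re z) + Rabs (Im z).
Proof.
  destruct z as [x y]. simpl.
  replace ((x, y) : C) with (RtoC x + RtoC y * Ci)%C
    by (unfold RtoC, Ci, Cmult, Cplus; simpl; f_equal; ring).
  eapply Rle_trans; [apply Cmod_triangle|].
  rewrite Cmod_mult, !Cmod_R, Cmod_Ci. lra.
Qed.

Lemma im_le_Cmod (z : C) : Rabs (Im z) <= Cmod z.
Proof.
  generalize (Rmax_Cmod z). intros H. eapply Rle_trans; [|exact H]. apply Rmax_r.
Qed.

Lemma Cmod_minus_sym (z w : C) : Cmod (z - w) = Cmod (w - z).
Proof. rewrite <- Cmod_opp. f_equal. ring. Qed.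

Lemma Cmod_le_add (z w : C) : Cmod z <= Cmod w + Cmod (z - w).
Proof.
  replace z with (w + (z - w))%C at 1 by ring. apply Cmod_triangle.
Qed.

Lemma Cmod_minus_le (z w : C) : Cmod (z - w) <= Cmod z + Cmod w.
Proof.
  replace (z - w)%C with (z + - w)%C by ring.
  rewrite <- (Cmod_opp w). apply Cmod_triangle.
Qed.

Lemma Cmod_lt_eq (z : C) : (forall eps, 0 < eps -> Cmod z <= eps) -> z = RtoC 0.
Proof.
  intros H. apply Cmod_eq_0. generalize (Cmod_ge_0 z); intros H0.
  destruct (Rle_lt_or_eq_dec _ _ H0) as [Hl|He]; [|auto].
  specialize (H (Cmod z / 2)). lra.
Qed.

Lemma Cmod_pos (z : C) : z <> RtoC 0 -> 0 < Cmod z.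
Proof. apply Cmod_gt_0. Qed.

Lemma Cminus_nz (z w : C) : z <> w -> (z - w)%C <> RtoC 0.
Proof. intros H E. apply H. replace z with (w + (z - w))%C by ring. rewrite E. ring. Qed.

Lemma Ccont_const (c z : C) : Ccont (fun _ => c) z.
Proof.
  intros e He. exists 1. split; [lra|]. intros w _.
  replace (c - c)%C with (RtoC 0) by ring. rewrite Cmod_0. exact He.
Qed.

Lemma Ccont_id (z : C) : Ccont (fun w => w) z.
Proof. intros e He. exists e. split; auto. Qed.

Lemma Ccont_plus (f g : C -> C) (z : C) :
  Ccont f z -> Ccont g z -> Ccont (fun w => f w + g w)%C z.
Proof.
  intros Hf Hg e He.
  destruct (Hf (e / 2) ltac:(lra)) as [d1 [Hd1 H1]].
  destruct (Hg (e / 2) ltac:(lra)) as [d2 [Hd2 H2]].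
  exists (Rmin d1 d2). split; [apply Rmin_pos; assumption|]. intros w Hw.
  specialize (H1 w (Rlt_le_trans _ _ _ Hw (Rmin_l _ _))).
  specialize (H2 w (Rlt_le_trans _ _ _ Hw (Rmin_r _ _))).
  replace (f w + g w - (f z + g z))%C with ((f w - f z) + (g w - g z))%C by ring.
  eapply Rle_lt_trans; [apply Cmod_triangle|]. lra.
Qed.

Lemma Ccont_mult (f g : C -> C) (z : C) :
  Ccont f z -> Ccont g z -> Ccont (fun w => f w * g w)%C z.
Proof.
  intros Hf Hg e He.
  generalize (Cmod_ge_0 (f z)) (Cmod_ge_0 (g z)). intros Pf Pg.
  set (M := Cmod (f z) + Cmod (g z) + 1).
  destruct (Hf (Rmin 1 (e / (2 * M)))) as [d1 [Hd1 H1]].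
  { apply Rmin_pos; [lra|]. apply Rdiv_lt_0_compat; unfold M; lra. }
  destruct (Hg (e / (2 * M))) as [d2 [Hd2 H2]].
  { apply Rdiv_lt_0_compat; unfold M; lra. }
  exists (Rmin d1 d2). split; [apply Rmin_pos; assumption|]. intros w Hw.
  specialize (H1 w (Rlt_le_trans _ _ _ Hw (Rmin_l _ _))).
  specialize (H2 w (Rlt_le_trans _ _ _ Hw (Rmin_r _ _))).
  assert (H1a := Rlt_le_trans _ _ _ H1 (Rmin_l _ _)).
  assert (H1b := Rlt_le_trans _ _ _ H1 (Rmin_r _ _)).
  replace (f w * g w - f z * g z)%C
    with (f w * (g w - g z) + (f w - f z) * g z)%C by ring.
  eapply Rle_lt_trans; [apply Cmod_triangle|]. rewrite !Cmod_mult.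
  assert (Hfw := Cmod_le_add (f w) (f z)).
  assert (E : e = M * (e / (2 * M)) + M * (e / (2 * M))) by (field; unfold M; lra).
  rewrite E.
  assert (0 < e / (2 * M)) by (apply Rdiv_lt_0_compat; unfold M; lra).
  assert (0 < M) by (unfold M; lra).
  apply Rplus_lt_le_compat.
  - apply Rle_lt_trans with (M * Cmod (g w - g z)).
    + apply Rmult_le_compat_r; [apply Cmod_ge_0|]. unfold M; lra.
    + apply Rmult_lt_compat_l; assumption.
  - rewrite Rmult_comm. apply Rmult_le_compat; try apply Cmod_ge_0; [unfold M|]; lra.
Qed.

Lemma Ccont_inv (f : C -> C) (z : C) :
  f z <> RtoC 0 -> Ccont f z -> Ccont (fun w => / f w)%C z.
Proof.
  intros Hz Hf e He. assert (P := Cmod_pos _ Hz). set (m := Cmod (f z)) in *.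
  destruct (Hf (Rmin (m / 2) (e * m * m / 2))) as [d [Hd H]].
  { apply Rmin_pos; [lra|]. repeat apply Rmult_lt_0_compat; lra. }
  exists d. split; [assumption|]. intros w Hw. specialize (H w Hw).
  assert (H1a := Rlt_le_trans _ _ _ H (Rmin_l _ _)).
  assert (H1b := Rlt_le_trans _ _ _ H (Rmin_r _ _)).
  assert (Hfw := Cmod_le_add (f z) (f w)). rewrite Cmod_minus_sym in Hfw. fold m in Hfw.
  assert (Hn : f w <> RtoC 0).
  { intros E. rewrite E, Cmod_0 in Hfw. rewrite E in H1a. lra. }
  replace (/ f w - / f z)%C with (- (f w - f z) * (/ f w * / f z))%C by (field; auto).
  rewrite !Cmod_mult, Cmod_opp, !Cmod_inv by assumption. fold m.
  apply Rle_lt_trans with (Cmod (f w - f z) * (/ (m / 2) * / m)).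
  - apply Rmult_le_compat_l; [apply Cmod_ge_0|].
    apply Rmult_le_compat_r; [left; apply Rinv_0_lt_compat; lra|].
    apply Rinv_le_contravar; lra.
  - replace e with ((e * m * m / 2) * (/ (m / 2) * / m)) by (field; lra).
    apply Rmult_lt_compat_r; [|assumption].
    apply Rmult_lt_0_compat; apply Rinv_0_lt_compat; lra.
Qed.

Lemma Ccont_comp (f g : C -> C) (z : C) :
  Ccont f (g z) -> Ccont g z -> Ccont (fun w => f (g w)) z.
Proof.
  intros Hf Hg e He. destruct (Hf e He) as [d [Hd H]].
  destruct (Hg d Hd) as [d' [Hd' H']]. exists d'. auto.
Qed.

Lemma Ccont_ext_loc (f g : C -> C) (z : C) :
  (exists d, 0 < d /\ forall w, Cmod (w - z) < d -> f w = g w) ->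
  Ccont f z -> Ccont g z.
Proof.
  intros [d [Hd H]] Hf e He. destruct (Hf e He) as [d' [Hd' H']].
  exists (Rmin d d'). split; [apply Rmin_pos; assumption|]. intros w Hw.
  rewrite <- !H.
  - apply H'. eapply Rlt_le_trans; [exact Hw|apply Rmin_r].
  - replace (z - z)%C with (RtoC 0) by ring. rewrite Cmod_0. exact Hd.
  - eapply Rlt_le_trans; [exact Hw|apply Rmin_l].
Qed.

Lemma Cder_Ccont (f : C -> C) (z c : C) : Cder f z c -> Ccont f z.
Proof.
  intros [phi [Hc [_ H]]].
  apply Ccont_ext_loc with (fun w => f z + phi w * (w - z))%C.
  - exists 1. split; [lra|]. intros w _. symmetry. apply H.
  - apply Ccont_plus; [apply Ccont_const|]. apply Ccont_mult; [exact Hc|].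
    apply (Ccont_plus (fun w => w) (fun _ => - z)%C); [apply Ccont_id|apply Ccont_const].
Qed.

Lemma Cder_of_eps (f : C -> C) (z c : C) :
  (forall eps, 0 < eps -> exists d, 0 < d /\ forall w, Cmod (w - z) < d ->
     Cmod (f w - f z - c * (w - z)) <= eps * Cmod (w - z)) ->
  Cder f z c.
Proof.
  intros H.
  exists (fun w => if excluded_middle_informative (w = z) then c
                   else (f w - f z) / (w - z))%C.
  destruct (excluded_middle_informative (z = z)) as [Ez|n]; [|congruence].
  split; [|split; [reflexivity|]].
  - intros e He. destruct (H (e / 2) ltac:(lra)) as [d [Hd Hw]].
    exists d. split; [exact Hd|]. intros w Hwd. specialize (Hw w Hwd).
    destruct (excluded_middle_informative (z = z)) as [_|n]; [|congruence].
    destruct (excluded_middle_informative (w = z)) as [E|n].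
    + replace (c - c)%C with (RtoC 0) by ring. rewrite Cmod_0. exact He.
    + assert (Hn := Cminus_nz _ _ n). assert (Hp := Cmod_pos _ Hn).
      replace ((f w - f z) / (w - z) - c)%C
        with ((f w - f z - c * (w - z)) / (w - z))%C by (field; exact Hn).
      rewrite Cmod_div by exact Hn. apply Rle_lt_trans with (e / 2); [|lra].
      apply Rle_div_l; [exact Hp|]. exact Hw.
  - intros w. destruct (excluded_middle_informative (w = z)) as [E|n].
    + rewrite E. ring.
    + field. apply Cminus_nz, n.
Qed.

Lemma Cder_eps (f : C -> C) (z c : C) : Cder f z c ->
  forall eps, 0 < eps -> exists d, 0 < d /\ forall w, Cmod (w - z) < d ->
     Cmod (f w - f z - c * (w - z)) <= eps * Cmod (w - z).
Proof.
  intros [phi [Hc [E H]]] e He. destruct (Hc e He) as [d [Hd Hw]].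
  exists d. split; [exact Hd|]. intros w Hwd. specialize (Hw w Hwd).
  rewrite (H w). rewrite E in Hw.
  replace (f z + phi w * (w - z) - f z - c * (w - z))%C
    with ((phi w - c) * (w - z))%C by ring.
  rewrite Cmod_mult. apply Rmult_le_compat_r; [apply Cmod_ge_0|lra].
Qed.

(** The factorization in [Cder] constrains [f] at every point of the plane, so locality is proved
    through the epsilon form. *)
Lemma Cder_ext_loc (f g : C -> C) (z c : C) :
  (exists d, 0 < d /\ forall w, Cmod (w - z) < d -> f w = g w) ->
  Cder f z c -> Cder g z c.
Proof.
  intros [d [Hd H]] Hf. apply Cder_of_eps. intros e He.
  destruct (Cder_eps _ _ _ Hf e He) as [d' [Hd' H']].
  exists (Rmin d d'). split; [apply Rmin_pos; assumption|]. intros w Hw.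
  rewrite <- !H.
  - apply H'. eapply Rlt_le_trans; [exact Hw|apply Rmin_r].
  - replace (z - z)%C with (RtoC 0) by ring. rewrite Cmod_0. exact Hd.
  - eapply Rlt_le_trans; [exact Hw|apply Rmin_l].
Qed.

Lemma Cder_eq (f : C -> C) (z c c' : C) : c = c' -> Cder f z c -> Cder f z c'.
Proof. intros ->. auto. Qed.

Lemma Cder_const (c z : C) : Cder (fun _ => c) z (RtoC 0).
Proof.
  exists (fun _ => RtoC 0). split; [apply Ccont_const|split; [reflexivity|]].
  intros; ring.
Qed.

Lemma Cder_id (z : C) : Cder (fun w => w) z (RtoC 1).
Proof.
  exists (fun _ => RtoC 1). split; [apply Ccont_const|split; [reflexivity|]].
  intros; ring.
Qed.

Lemma Cder_plus (f g : C -> C) (z a b : C) :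
  Cder f z a -> Cder g z b -> Cder (fun w => f w + g w)%C z (a + b)%C.
Proof.
  intros [p [Hp [Ep Hf]]] [q [Hq [Eq Hg]]].
  exists (fun w => p w + q w)%C. split; [apply Ccont_plus; assumption|].
  split; [congruence|]. intros w. rewrite (Hf w), (Hg w). ring.
Qed.

Lemma Cder_mult (f g : C -> C) (z a b : C) :
  Cder f z a -> Cder g z b -> Cder (fun w => f w * g w)%C z (a * g z + f z * b)%C.
Proof.
  intros Hf0 Hg0. assert (Cg := Cder_Ccont _ _ _ Hg0).
  destruct Hf0 as [p [Hp [Ep Hf]]]. destruct Hg0 as [q [Hq [Eq Hg]]].
  exists (fun w => p w * g w + f z * q w)%C. split.
  { apply Ccont_plus; apply Ccont_mult; try assumption. apply Ccont_const. }
  split; [congruence|]. intros w. rewrite (Hf w), (Hg w). ring.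
Qed.

Lemma Cder_scal (k : C) (f : C -> C) (z a : C) :
  Cder f z a -> Cder (fun w => k * f w)%C z (k * a)%C.
Proof.
  intros H. generalize (Cder_mult (fun _ => k) f z _ _ (Cder_const k z) H).
  apply Cder_eq. ring.
Qed.

Lemma Cder_minus (f g : C -> C) (z a b : C) :
  Cder f z a -> Cder g z b -> Cder (fun w => f w - g w)%C z (a - b)%C.
Proof.
  intros Hf Hg. generalize (Cder_plus _ _ _ _ _ Hf (Cder_scal (- (1))%C _ _ _ Hg)).
  intros H. apply Cder_eq with (a + - (1) * b)%C; [ring|].
  refine (Cder_ext_loc _ _ _ _ _ H).
  exists 1. split; [lra|]. intros; ring.
Qed.

Lemma Cder_inv (f : C -> C) (z a : C) :
  f z <> RtoC 0 -> Cder f z a -> Cder (fun w => / f w)%C z (- a / (f z * f z))%C.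
Proof.
  intros Hz Hf0. assert (Cf := Cder_Ccont _ _ _ Hf0).
  destruct Hf0 as [p [Hp [Ep Hf]]].
  destruct (Cf (Cmod (f z)) (Cmod_pos _ Hz)) as [d [Hd Hn]].
  (* The factored expression for [/ f w] is valid only where [f w] is nonzero, which [Hn] secures
     near [z]. *)
  apply Cder_ext_loc with
    (f := fun w => (/ f z + (- p w * (/ f w * / f z)) * (w - z))%C).
  - exists d. split; [exact Hd|]. intros w Hw. specialize (Hn w Hw).
    assert (f w <> RtoC 0).
    { intros E. rewrite E in Hn. replace (RtoC 0 - f z)%C with (- f z)%C in Hn by ring.
      rewrite Cmod_opp in Hn. lra. }
    assert (E : (p w * (w - z) = f w - f z)%C) by (rewrite (Hf w); ring).
    replace (- p w * (/ f w * / f z) * (w - z))%C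
      with (- (p w * (w - z)) * (/ f w * / f z))%C by ring.
    rewrite E. field. split; assumption.
  - exists (fun w => - p w * (/ f w * / f z))%C. split; [|split].
    + apply Ccont_mult.
      * apply (Ccont_ext_loc (fun w => - (1) * p w)%C).
        { exists 1. split; [lra|]. intros; ring. }
        apply Ccont_mult; [apply Ccont_const|assumption].
      * apply Ccont_mult; [|apply Ccont_const]. apply Ccont_inv; assumption.
    + rewrite Ep. field. exact Hz.
    + intros w. ring.
Qed.

Lemma Cder_div (f g : C -> C) (z a b : C) :
  g z <> RtoC 0 -> Cder f z a -> Cder g z b ->
  Cder (fun w => f w / g w)%C z ((a * g z - f z * b) / (g z * g z))%C.
Proof.
  intros Hz Hf Hg.
  generalize (Cder_mult _ _ _ _ _ Hf (Cder_inv _ _ _ Hz Hg)).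
  apply Cder_eq. field. exact Hz.
Qed.

Lemma Cder_comp (f g : C -> C) (z a b : C) :
  Cder f (g z) a -> Cder g z b -> Cder (fun w => f (g w)) z (a * b)%C.
Proof.
  intros [p [Hp [Ep Hf]]] Hg0. assert (Cg := Cder_Ccont _ _ _ Hg0).
  destruct Hg0 as [q [Hq [Eq Hg]]].
  exists (fun w => p (g w) * q w)%C. split.
  { apply Ccont_mult; [|assumption]. apply Ccont_comp; assumption. }
  split; [congruence|]. intros w. rewrite (Hf (g w)).
  replace (g w - g z)%C with (q w * (w - z))%C by (rewrite (Hg w); ring). ring.
Qed.

Lemma Cder_pow (z : C) (n : nat) :
  Cder (fun w => Cpow w n) z (RtoC (INR n) * Cpow z (pred n))%C.
Proof.
  induction n as [|n IH].
  - apply Cder_eq with (RtoC 0); [simpl; ring|]. apply (Cder_const (RtoC 1)).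
  - apply Cder_ext_loc with (fun w => (w * Cpow w n)%C).
    { exists 1. split; [lra|]. intros. rewrite Cpow_S. reflexivity. }
    generalize (Cder_mult _ _ _ _ _ (Cder_id z) IH). apply Cder_eq.
    simpl pred. rewrite S_INR, RtoC_plus. destruct n as [|n].
    + simpl. ring.
    + simpl pred. rewrite Cpow_S. ring.
Qed.

Lemma Cder_ex_derive (f : C -> C) (z : C) :
  (exists c, Cder f z c) <-> @ex_derive C_AbsRing C_NormedModule f z.
Proof.
  split.
  - intros [c Hc]. exists c. split; [apply is_linear_scal_l|].
    intros x Hx e. 
    assert (E := @is_filter_lim_locally_unique _ (AbsRing_NormedModule C_AbsRing) z x Hx).
    subst x.
    destruct (Cder_eps _ _ _ Hc e (cond_pos e)) as [d [Hd H]].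
    exists (mkposreal d Hd). intros w Hw.
    change (Cmod (w - z) < d) in Hw. specialize (H w Hw).
    change (Cmod (f w - f z - (w - z) * c) <= e * Cmod (w - z)).
    rewrite (Cmult_comm _ c). exact H.
  - intros [c [_ H]]. exists c. apply Cder_of_eps. intros e He.
    specialize (H z (fun P H => H) (mkposreal e He)).
    destruct H as [d H]. exists d. split; [apply cond_pos|].
    intros w Hw. specialize (H w Hw).
    change (Cmod (f w - f z - (w - z) * c) <= e * Cmod (w - z)) in H.
    rewrite (Cmult_comm _ c) in H. exact H.
Qed.

Lemma analytic_Cder (f : C -> C) :
  analytic f <-> forall z, in_D z -> exists c, Cder f z c.
Proof.
  split; intros H z Hz; apply Cder_ex_derive, H, Hz.
Qed.

(** * The complex exponential *)

Definition Cexp (z : C) : C := (exp (Re z) * cos (Im z), exp (Re z) * sin (Im z)).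

Lemma Cexp_plus (z w : C) : Cexp (z + w) = (Cexp z * Cexp w)%C.
Proof.
  destruct z as [a b], w as [c d]. unfold Cexp, Cmult, Cplus; simpl.
  rewrite exp_plus, cos_plus, sin_plus. f_equal; ring.
Qed.

Lemma Cexp_0 : Cexp 0 = RtoC 1.
Proof. unfold Cexp, RtoC; simpl. rewrite exp_0, cos_0, sin_0. f_equal; ring. Qed.

Lemma Cmod_Cexp (z : C) : Cmod (Cexp z) = exp (Re z).
Proof.
  unfold Cexp, Cmod; simpl.
  replace (_ + _) with (Rsqr (exp (Re z)) * (Rsqr (sin (Im z)) + Rsqr (cos (Im z))))
    by (unfold Rsqr; ring).
  rewrite sin2_cos2, Rmult_1_r. apply sqrt_Rsqr. left; apply exp_pos.
Qed.

Lemma Cexp_nz (z : C) : Cexp z <> RtoC 0.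
Proof.
  intros E. assert (H := Cmod_Cexp z). rewrite E, Cmod_0 in H.
  generalize (exp_pos (Re z)). lra.
Qed.

Lemma Cexp_opp (z : C) : Cexp (- z) = (/ Cexp z)%C.
Proof.
  assert (H := Cexp_plus z (- z)). replace (z + - z)%C with (RtoC 0) in H by ring.
  rewrite Cexp_0 in H. replace (/ Cexp z)%C with (/ Cexp z * RtoC 1)%C by ring.
  rewrite H. field. apply Cexp_nz.
Qed.

Lemma Cexp_minus (z w : C) : Cexp (z - w) = (Cexp z / Cexp w)%C.
Proof. unfold Cminus, Cdiv. rewrite Cexp_plus, Cexp_opp. reflexivity. Qed.

Lemma derivable_lim_le (f : R -> R) (l : R) : derivable_pt_lim f 0 l ->
  forall e, 0 < e -> exists d, 0 < d /\ forall h, Rabs h < d ->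
    Rabs (f h - f 0 - l * h) <= e * Rabs h.
Proof.
  intros H e He. destruct (H e He) as [d Hd]. exists d. split; [apply cond_pos|].
  intros h Hh. destruct (Req_dec h 0) as [->|n].
  - replace (_ - _ - _) with 0 by ring. rewrite Rabs_R0. lra.
  - specialize (Hd h n Hh). rewrite Rplus_0_l in Hd.
    replace (f h - f 0 - l * h) with (((f h - f 0) / h - l) * h) by (field; exact n).
    rewrite Rabs_mult. apply Rmult_le_compat_r; [apply Rabs_pos|lra].
Qed.

Lemma Cder_Cexp_0 : Cder Cexp 0 1.
Proof.
  (* The four error terms below are at most 1, 2, 2 and 1 times [e' * m], so [e / 8] leaves room;
     [e' <= 1] bounds [1 + x] by 2 and [A + x] by [2 * m]. *)
  apply Cder_of_eps. intros e He. set (e' := Rmin 1 (e / 8)).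
  assert (He' : 0 < e') by (apply Rmin_pos; lra).
  assert (He1 : e' <= 1) by apply Rmin_l. assert (He2 : e' <= e / 8) by apply Rmin_r.
  destruct (derivable_lim_le exp 1 (eq_ind _ _ (derivable_pt_lim_exp 0) _ exp_0) e' He')
    as [d1 [P1 H1]].
  destruct (derivable_lim_le cos 0 (eq_ind _ _ (derivable_pt_lim_cos 0) _
     (eq_trans (f_equal Ropp sin_0) Ropp_0)) e' He') as [d2 [P2 H2]].
  destruct (derivable_lim_le sin 1 (eq_ind _ _ (derivable_pt_lim_sin 0) _ cos_0) e' He')
    as [d3 [P3 H3]].
  exists (Rmin (Rmin d1 d2) (Rmin d3 e')).
  clearbody e'.
  split; [apply Rmin_pos; apply Rmin_pos; assumption|].
  intros [x y] Hw.
  assert (E : ((x, y) - 0)%C = (x, y))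
    by (unfold Cminus, Cplus, Copp, RtoC; simpl; f_equal; ring).
  rewrite E in *.
  assert (Hx := re_le_Cmod (x, y)). assert (Hy := im_le_Cmod (x, y)). simpl in Hx, Hy.
  assert (Cmod (x, y) < d1 /\ Cmod (x, y) < d2 /\ Cmod (x, y) < d3 /\ Cmod (x, y) < e')
    as (L1 & L2 & L3 & L4).
  { repeat split; (eapply Rlt_le_trans; [exact Hw|]).
    - eapply Rle_trans; [apply Rmin_l|apply Rmin_l].
    - eapply Rle_trans; [apply Rmin_l|apply Rmin_r].
    - eapply Rle_trans; [apply Rmin_r|apply Rmin_l].
    - eapply Rle_trans; [apply Rmin_r|apply Rmin_r]. }
  set (m := Cmod (x, y)) in *.
  specialize (H1 x ltac:(lra)). specialize (H2 y ltac:(lra)). specialize (H3 y ltac:(lra)).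
  rewrite exp_0 in H1. rewrite cos_0 in H2. rewrite sin_0 in H3.
  eapply Rle_trans; [apply Cmod_sum_abs|].
  rewrite Cexp_0. unfold Cexp; simpl.
  set (A := exp x - 1 - 1 * x) in *. set (B := cos y - 1 - 0 * y) in *.
  set (D := sin y - 0 - 1 * y) in *.
  replace (exp x * cos y + - (1) + - (1 * x - 0 * y))
    with (A * cos y + (1 + x) * B) by (unfold A, B; ring).
  replace (exp x * sin y + - 0 + - (1 * y + 0 * x))
    with ((A + x) * sin y + D) by (unfold A, D; ring).
  assert (Rabs (A * cos y) <= e' * m).
  { rewrite Rabs_mult. rewrite <- (Rmult_1_r (e' * m)).
    apply Rmult_le_compat; try apply Rabs_pos.
    - eapply Rle_trans; [exact H1|]. apply Rmult_le_compat_l; lra.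
    - apply Rabs_le. apply COS_bound. }
  assert (Rabs ((1 + x) * B) <= 2 * (e' * m)).
  { rewrite Rabs_mult. apply Rmult_le_compat; try apply Rabs_pos.
    - eapply Rle_trans; [apply Rabs_triang|]. rewrite Rabs_R1. lra.
    - eapply Rle_trans; [exact H2|]. apply Rmult_le_compat_l; lra. }
  assert (Rabs ((A + x) * sin y) <= 2 * e' * m).
  { assert (Rabs (A + x) <= 2 * m).
    { eapply Rle_trans; [apply Rabs_triang|].
      assert (e' * Rabs x <= 1 * m) by (apply Rmult_le_compat; try apply Rabs_pos; lra).
      lra. }
    rewrite Rabs_mult.
    assert (HD : Rabs (sin y) <= e').
    { eapply Rle_trans; [|left; exact L4].
      eapply Rle_trans; [|exact Hy]. apply Rabs_le.
      assert (Q : forall t, 0 <= t -> - t <= sin t <= t).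
      { intros t Ht. destruct (Rle_lt_or_eq_dec _ _ Ht) as [Hp|<-].
        - split; [|left; apply sin_lt_x; exact Hp].
          destruct (Rle_dec t 1) as [h|h].
          + assert (0 <= sin t); [|lra]. apply sin_ge_0; [lra|].
            generalize PI_RGT_0 PI2_1. lra.
          + generalize (SIN_bound t). lra.
        - rewrite sin_0. lra. }
      unfold Rabs. destruct (Rcase_abs y).
      - generalize (Q (- y) ltac:(lra)). rewrite sin_neg. lra.
      - generalize (Q y ltac:(lra)). lra. }
    apply Rle_trans with ((2 * m) * e'); [|lra].
    apply Rmult_le_compat; try apply Rabs_pos; lra. }
  assert (Rabs D <= e' * m).
  { eapply Rle_trans; [exact H3|]. apply Rmult_le_compat_l; lra. }
  assert (T1 := Rabs_triang (A * cos y) ((1 + x) * B)).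
  assert (T2 := Rabs_triang ((A + x) * sin y) D).
  assert (0 <= m) by apply Cmod_ge_0.
  assert (e' * m <= e / 8 * m) by (apply Rmult_le_compat_r; lra).
  assert (0 <= e * m) by (apply Rmult_le_pos; lra). lra.
Qed.

Lemma Cder_Cexp (z : C) : Cder Cexp z (Cexp z).
Proof.
  apply Cder_ext_loc with (fun w => Cexp z * Cexp (w - z))%C.
  { exists 1. split; [lra|]. intros w _. rewrite <- Cexp_plus. f_equal. ring. }
  apply Cder_eq with (Cexp z * (1 * (1 - 0)))%C; [ring|]. apply Cder_scal.
  apply (Cder_comp Cexp (fun w => w - z)%C).
  - replace (z - z)%C with (RtoC 0) by ring. apply Cder_Cexp_0.
  - apply Cder_minus; [apply Cder_id|apply Cder_const].
Qed.


(** * Goursat's theorem on rectangles *)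

Definition Rcont (f : R -> C) (t : R) : Prop :=
  forall eps, 0 < eps -> exists d, 0 < d /\
    forall u, Rabs (u - t) < d -> Cmod (f u - f t) < eps.

Definition Cint (f : R -> C) (a b : R) : C := @RInt C_R_CompleteNormedModule f a b.

Definition Cex (f : R -> C) (a b : R) : Prop := @ex_RInt C_R_NormedModule f a b.

Lemma norm_Cmod (z : C) : @norm R_AbsRing C_R_NormedModule z = Cmod z.
Proof.
  destruct z as [x y]. unfold norm; simpl. unfold prod_norm, norm; simpl.
  unfold abs; simpl. unfold Cmod; simpl. f_equal.
  generalize (Rsqr_abs x) (Rsqr_abs y). unfold Rsqr. intros. lra.
Qed.

Lemma Rcont_Cex (f : R -> C) (a b : R) :
  a <= b -> (forall t, a <= t <= b -> Rcont f t) -> Cex f a b.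
Proof.
  intros Hab H. apply (@ex_RInt_continuous C_R_CompleteNormedModule).
  rewrite Rmin_left, Rmax_right by exact Hab. intros t Ht.
  apply filterlim_locally. intros e.
  destruct (H t Ht e (cond_pos e)) as [d [Hd Hu]].
  exists (mkposreal d Hd). intros u Hut. change (Rabs (u - t) < d) in Hut.
  apply C_NormedModule_mixin_compat1. exact (Hu u Hut).
Qed.

Lemma Cint_correct (f : R -> C) (a b : R) :
  Cex f a b -> @is_RInt C_R_NormedModule f a b (Cint f a b).
Proof. apply (@RInt_correct C_R_CompleteNormedModule). Qed.

Lemma Cint_unique (f : R -> C) (a b : R) (l : C) :
  @is_RInt C_R_NormedModule f a b l -> Cint f a b = l.
Proof. apply (@is_RInt_unique C_R_CompleteNormedModule). Qed.

(** Integration takes place in [C] as a real vector space, where a complex factor is not a scalar;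
    hence the argument by components. *)
Lemma is_Cint_scal (k : C) (f : R -> C) (a b : R) (l : C) :
  @is_RInt C_R_NormedModule f a b l ->
  @is_RInt C_R_NormedModule (fun t => k * f t)%C a b (k * l)%C.
Proof.
  intros H.
  assert (H1 := @is_RInt_fct_extend_fst R_NormedModule R_NormedModule f a b l H).
  assert (H2 := @is_RInt_fct_extend_snd R_NormedModule R_NormedModule f a b l H).
  apply (@is_RInt_fct_extend_pair R_NormedModule R_NormedModule); simpl.
  - apply (@is_RInt_minus R_NormedModule); apply (@is_RInt_scal R_NormedModule); assumption.
  - apply (@is_RInt_plus R_NormedModule); apply (@is_RInt_scal R_NormedModule); assumption.
Qed.

Lemma is_Cint_conj (f : R -> C) (a b : R) (l : C) :
  @is_RInt C_R_NormedModule f a b l ->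
  @is_RInt C_R_NormedModule (fun t => Cconj (f t)) a b (Cconj l).
Proof.
  intros H.
  assert (H1 := @is_RInt_fct_extend_fst R_NormedModule R_NormedModule f a b l H).
  assert (H2 := @is_RInt_fct_extend_snd R_NormedModule R_NormedModule f a b l H).
  apply (@is_RInt_fct_extend_pair R_NormedModule R_NormedModule); simpl; [exact H1|].
  apply (@is_RInt_opp R_NormedModule). exact H2.
Qed.

Lemma Cex_scal (k : C) (f : R -> C) (a b : R) : Cex f a b -> Cex (fun t => k * f t)%C a b.
Proof. intros [l H]. exists (k * l)%C. apply is_Cint_scal, H. Qed.

Lemma Cex_conj (f : R -> C) (a b : R) : Cex f a b -> Cex (fun t => Cconj (f t)) a b.
Proof. intros [l H]. exists (Cconj l). apply is_Cint_conj, H. Qed.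

Lemma Cex_plus (f g : R -> C) (a b : R) :
  Cex f a b -> Cex g a b -> Cex (fun t => f t + g t)%C a b.
Proof. apply (@ex_RInt_plus C_R_NormedModule). Qed.

Lemma Cex_minus (f g : R -> C) (a b : R) :
  Cex f a b -> Cex g a b -> Cex (fun t => f t - g t)%C a b.
Proof. apply (@ex_RInt_minus C_R_NormedModule). Qed.

Lemma Cex_const (k : C) (a b : R) : Cex (fun _ => k) a b.
Proof. apply (@ex_RInt_const C_R_NormedModule). Qed.

Lemma Cint_scal (k : C) (f : R -> C) (a b : R) :
  Cex f a b -> Cint (fun t => k * f t)%C a b = (k * Cint f a b)%C.
Proof. intros H. apply Cint_unique, is_Cint_scal, Cint_correct, H. Qed.

Lemma Cint_conj (f : R -> C) (a b : R) :
  Cex f a b -> Cint (fun t => Cconj (f t)) a b = Cconj (Cint f a b).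
Proof. intros H. apply Cint_unique, is_Cint_conj, Cint_correct, H. Qed.

Lemma Cint_plus (f g : R -> C) (a b : R) : Cex f a b -> Cex g a b ->
  Cint (fun t => f t + g t)%C a b = (Cint f a b + Cint g a b)%C.
Proof. apply (@RInt_plus C_R_CompleteNormedModule). Qed.

Lemma Cint_minus (f g : R -> C) (a b : R) : Cex f a b -> Cex g a b ->
  Cint (fun t => f t - g t)%C a b = (Cint f a b - Cint g a b)%C.
Proof. apply (@RInt_minus C_R_CompleteNormedModule). Qed.

Lemma Cint_const (k : C) (a b : R) : Cint (fun _ => k) a b = (RtoC (b - a) * k)%C.
Proof.
  unfold Cint. rewrite (@RInt_const C_R_CompleteNormedModule).
  destruct k as [x y]. unfold scal; simpl. unfold prod_scal, scal; simpl.
  unfold mult; simpl. unfold Cmult, RtoC; simpl. f_equal; ring.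
Qed.

Lemma Cint_Chasles (f : R -> C) (a b c : R) : Cex f a b -> Cex f b c ->
  (Cint f a b + Cint f b c)%C = Cint f a c.
Proof. apply (@RInt_Chasles C_R_CompleteNormedModule). Qed.

Lemma Cint_ext (f g : R -> C) (a b : R) : a <= b ->
  (forall t, a <= t <= b -> f t = g t) -> Cint f a b = Cint g a b.
Proof.
  intros Hab H. apply (@RInt_ext C_R_CompleteNormedModule).
  rewrite Rmin_left, Rmax_right by exact Hab. intros t Ht. apply H; lra.
Qed.

Lemma Cint_bound (f : R -> C) (a b M : R) : a <= b -> Cex f a b ->
  (forall t, a <= t <= b -> Cmod (f t) <= M) -> Cmod (Cint f a b) <= (b - a) * M.
Proof.
  intros Hab Hf H. rewrite <- norm_Cmod.
  apply (norm_RInt_le_const (V := C_R_NormedModule) f a b); auto.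
  - intros t Ht. rewrite norm_Cmod. auto.
  - apply Cint_correct, Hf.
Qed.

Lemma Cint_Re (f : R -> C) (a b : R) : Cex f a b ->
  is_RInt (fun t => Re (f t)) a b (Re (Cint f a b)).
Proof.
  intros H.
  exact (@is_RInt_fct_extend_fst R_NormedModule R_NormedModule f a b _ (Cint_correct _ _ _ H)).
Qed.

Lemma Cint_bound_R (f : R -> C) (g : R -> R) (a b l : R) : a <= b -> Cex f a b ->
  (forall t, a <= t <= b -> Cmod (f t) <= g t) -> is_RInt g a b l ->
  Cmod (Cint f a b) <= l.
Proof.
  intros Hab Hf H Hg. rewrite <- norm_Cmod.
  apply (norm_RInt_le (V := C_R_NormedModule) f g a b); auto.
  - intros t Ht. rewrite norm_Cmod. auto.
  - apply Cint_correct, Hf.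
Qed.

(** * Bisection of rectangles *)

Lemma nested_intervals (a b : nat -> R) :
  (forall n, a n <= a (S n)) -> (forall n, b (S n) <= b n) -> (forall n, a n <= b n) ->
  exists p, forall n, a n <= p <= b n.
Proof.
  intros Ha Hb Hab.
  assert (Ha' : forall n m, (n <= m)%nat -> a n <= a m).
  { intros n m H. induction H; [lra|]. generalize (Ha m). lra. }
  assert (Hb' : forall n m, (n <= m)%nat -> b m <= b n).
  { intros n m H. induction H; [lra|]. generalize (Hb m). lra. }
  assert (Hu : forall n m, a n <= b m).
  { intros n m. apply Rle_trans with (a (max n m)); [apply Ha'; lia|].
    apply Rle_trans with (b (max n m)); [apply Hab|apply Hb'; lia]. }
  destruct (completeness (fun x => exists n, x = a n)) as [p [H1 H2]].
  - exists (b 0%nat). intros x [n ->]. apply Hu.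
  - exists (a 0%nat). exists 0%nat. reflexivity.
  - exists p. intros n. split.
    + apply H1. exists n. reflexivity.
    + apply H2. intros x [m ->]. apply Hu.
Qed.

Definition pt (x y : R) : C := (x, y).

Lemma Cmod_pt_minus (x y u v : R) :
  Cmod (pt x y - pt u v) <= Rabs (x - u) + Rabs (y - v).
Proof. apply (Cmod_sum_abs (pt x y - pt u v)). Qed.

Lemma Ccont_horizontal (G : C -> C) (x y : R) :
  Ccont G (pt x y) -> Rcont (fun t => G (pt t y)) x.
Proof.
  intros H e He. destruct (H e He) as [d [Hd Hw]]. exists d. split; [exact Hd|].
  intros u Hu. apply Hw. eapply Rle_lt_trans; [apply Cmod_pt_minus|].
  replace (y - y) with 0 by ring. rewrite Rabs_R0. lra.
Qed.

Lemma Ccont_vertical (G : C -> C) (x y : R) :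
  Ccont G (pt x y) -> Rcont (fun t => G (pt x t)) y.
Proof.
  intros H e He. destruct (H e He) as [d [Hd Hw]]. exists d. split; [exact Hd|].
  intros u Hu. apply Hw. eapply Rle_lt_trans; [apply Cmod_pt_minus|].
  replace (x - x) with 0 by ring. rewrite Rabs_R0. lra.
Qed.

(** The contour integral of [G] along the boundary, counterclockwise: bottom minus top, plus [Ci]
    times right minus left. *)
Definition rect_int (G : C -> C) (a b c d : R) : C :=
  (Cint (fun x => G (pt x c) - G (pt x d)) a b
   + Ci * Cint (fun y => G (pt b y) - G (pt a y)) c d)%C.

Section Goursat.

Variable G : C -> C.
Variables a0 b0 c0 d0 : R.
Hypothesis HG : forall x y, a0 <= x <= b0 -> c0 <= y <= d0 ->
  exists k, Cder G (pt x y) k.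

Let inside a b c d := a0 <= a /\ a <= b /\ b <= b0 /\ c0 <= c /\ c <= d /\ d <= d0.

Lemma Cex_hor (a b y : R) :
  a0 <= a -> a <= b -> b <= b0 -> c0 <= y <= d0 -> Cex (fun x => G (pt x y)) a b.
Proof.
  intros. apply Rcont_Cex; [assumption|]. intros t Ht. apply Ccont_horizontal.
  destruct (HG t y) as [k Hk]; [lra|lra|]. eapply Cder_Ccont, Hk.
Qed.

Lemma Cex_ver (c d x : R) :
  c0 <= c -> c <= d -> d <= d0 -> a0 <= x <= b0 -> Cex (fun y => G (pt x y)) c d.
Proof.
  intros. apply Rcont_Cex; [assumption|]. intros t Ht. apply Ccont_vertical.
  destruct (HG x t) as [k Hk]; [lra|lra|]. eapply Cder_Ccont, Hk.
Qed.

Lemma rect_split_x (a m b c d : R) : inside a b c d -> a <= m <= b ->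
  rect_int G a b c d = (rect_int G a m c d + rect_int G m b c d)%C.
Proof.
  intros (? & ? & ? & ? & ? & ?) Hm. unfold rect_int.
  rewrite <- (Cint_Chasles _ a m b)
    by (apply Cex_minus; apply Cex_hor; lra).
  replace (Cint (fun y => G (pt b y) - G (pt a y))%C c d)
    with (Cint (fun y => G (pt m y) - G (pt a y))%C c d
          + Cint (fun y => G (pt b y) - G (pt m y))%C c d)%C; [ring|].
  rewrite !Cint_minus by (apply Cex_ver; lra). ring.
Qed.

Lemma rect_split_y (a b c m d : R) : inside a b c d -> c <= m <= d ->
  rect_int G a b c d = (rect_int G a b c m + rect_int G a b m d)%C.
Proof.
  intros (? & ? & ? & ? & ? & ?) Hm. unfold rect_int.
  rewrite <- (Cint_Chasles _ c m d)
    by (apply Cex_minus; apply Cex_ver; lra).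
  replace (Cint (fun x => G (pt x c) - G (pt x d))%C a b)
    with (Cint (fun x => G (pt x c) - G (pt x m))%C a b
          + Cint (fun x => G (pt x m) - G (pt x d))%C a b)%C; [ring|].
  rewrite !Cint_minus by (apply Cex_hor; lra). ring.
Qed.

(** Subtracting the affine approximation of [G] at the point leaves the contour integral unchanged.
    The remainder is at most [eps / 2 * s] on the rectangle, where [s] is half the perimeter, and
    the sides have total length [2 * s]. *)
Lemma rect_local (p q eps : R) : a0 <= p <= b0 -> c0 <= q <= d0 -> 0 < eps ->
  exists delta, 0 < delta /\ forall a b c d, inside a b c d ->
    a <= p <= b -> c <= q <= d -> (b - a) + (d - c) < delta ->
    Cmod (rect_int G a b c d) <= eps * ((b - a) + (d - c)) ^ 2.
Proof.
  intros Hp Hq He. destruct (HG p q Hp Hq) as [k Hk].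
  destruct (Cder_eps _ _ _ Hk (eps / 2) ltac:(lra)) as [delta [Hd H]].
  exists delta. split; [exact Hd|].
  intros a b c d Hin Hpa Hqc Hs. destruct Hin as (? & ? & ? & ? & ? & ?).
  set (s := (b - a) + (d - c)) in *.
  set (E := fun w => (G w - G (pt p q) - k * (w - pt p q))%C).
  assert (HE : forall x y, a <= x <= b -> c <= y <= d -> Cmod (E (pt x y)) <= eps / 2 * s).
  { intros x y Hx Hy.
    assert (Hm : Cmod (pt x y - pt p q) <= s).
    { eapply Rle_trans; [apply Cmod_pt_minus|].
      unfold s. apply Rplus_le_compat; apply Rabs_le; lra. }
    eapply Rle_trans; [apply H; lra|]. apply Rmult_le_compat_l; lra. }
  assert (Hhor : forall y, c <= y <= d -> Cex (fun x => E (pt x y)) a b).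
  { intros y Hy.
    assert (Cex (fun x => RtoC x) a b).
    { apply Rcont_Cex; [lra|]. intros t _ e He'. exists e. split; [exact He'|].
      intros u Hu. rewrite <- RtoC_minus, Cmod_R. exact Hu. }
    unfold E. apply Cex_minus.
    - apply Cex_minus; [apply Cex_hor; lra|apply Cex_const].
    - apply Cex_scal. apply Cex_minus; [|apply Cex_const].
      apply (@ex_RInt_ext C_R_NormedModule) with (fun x => (RtoC x + pt 0 y)%C).
      + intros x _. unfold pt, RtoC, Cplus; simpl. f_equal; ring.
      + apply Cex_plus; [assumption|apply Cex_const]. }
  assert (Hver : forall x, a <= x <= b -> Cex (fun y => E (pt x y)) c d).
  { intros x Hx.
    assert (Cex (fun x => RtoC x) c d).
    { apply Rcont_Cex; [lra|]. intros t _ e He'. exists e. split; [exact He'|].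
      intros u Hu. rewrite <- RtoC_minus, Cmod_R. exact Hu. }
    unfold E. apply Cex_minus.
    - apply Cex_minus; [apply Cex_ver; lra|apply Cex_const].
    - apply Cex_scal. apply Cex_minus; [|apply Cex_const].
      apply (@ex_RInt_ext C_R_NormedModule) with (fun y => (Ci * RtoC y + pt x 0)%C).
      + intros y _. unfold pt, RtoC, Ci, Cplus, Cmult; simpl. f_equal; ring.
      + apply Cex_plus; [apply Cex_scal; assumption|apply Cex_const]. }
  (* The affine part contributes [k * Ci * (c - d)] times [b - a] from the horizontal sides and
     [Ci * k * (b - a)] times [d - c] from the vertical ones; these cancel. *)
  assert (Ereq : rect_int G a b c d = rect_int E a b c d).
  { unfold rect_int.
    rewrite (Cint_ext (fun x => G (pt x c) - G (pt x d))%C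
      (fun x => (E (pt x c) - E (pt x d)) + k * (Ci * RtoC (c - d)))%C a b).
    2: lra.
    2:{ intros t _. unfold E.
        replace (pt t c - pt p q)%C with (pt t d - pt p q + Ci * RtoC (c - d))%C.
        - ring.
        - apply injective_projections; simpl; ring. }
    rewrite (Cint_ext (fun y => G (pt b y) - G (pt a y))%C
      (fun y => (E (pt b y) - E (pt a y)) + k * RtoC (b - a))%C c d).
    2: lra.
    2:{ intros t _. unfold E.
        replace (pt b t - pt p q)%C with (pt a t - pt p q + RtoC (b - a))%C.
        - ring.
        - apply injective_projections; simpl; ring. }
    rewrite !(Cint_plus _ (fun _ => _)).
    - rewrite !Cint_const, !RtoC_minus. ring.
    - apply Cex_minus; apply Hver; lra.
    - apply Cex_const.
    - apply Cex_minus; apply Hhor; lra.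
    - apply Cex_const. }
  rewrite Ereq. unfold rect_int.
  eapply Rle_trans; [apply Cmod_triangle|].
  rewrite Cmod_mult, Cmod_Ci, Rmult_1_l.
  apply Rle_trans with ((b - a) * (eps * s) + (d - c) * (eps * s)).
  - apply Rplus_le_compat; apply Cint_bound; try lra;
      try (apply Cex_minus; first [apply Hver|apply Hhor]; lra).
    + intros t Ht. eapply Rle_trans; [apply Cmod_minus_le|].
      generalize (HE t c Ht ltac:(lra)) (HE t d Ht ltac:(lra)). lra.
    + intros t Ht. eapply Rle_trans; [apply Cmod_minus_le|].
      generalize (HE a t ltac:(lra) Ht) (HE b t ltac:(lra) Ht). lra.
  - right. unfold s. ring.
Qed.

Let bad eps (r : R * R * R * R) :=
  let '(a, b, c, d) := r in
  inside a b c d /\ eps * ((b - a) + (d - c)) ^ 2 < Cmod (rect_int G a b c d).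

Let quarter (r r' : R * R * R * R) :=
  let '(a, b, c, d) := r in
  let '(a', b', c', d') := r' in
  a <= a' /\ b' <= b /\ c <= c' /\ d' <= d /\ b' - a' = (b - a) / 2 /\ d' - c' = (d - c) / 2.

(** The threshold is quadratic in the half perimeter, so each quarter has exactly a quarter of it;
    if no quarter exceeded its threshold, the sum of the four integrals would not exceed the
    original one. *)
Lemma bad_quarter (eps : R) (r : R * R * R * R) :
  bad eps r -> exists r', bad eps r' /\ quarter r r'.
Proof.
  destruct r as [[[a b] c] d]. intros [Hin Hb].
  assert (Hin' := Hin). destruct Hin' as (? & ? & ? & ? & ? & ?).
  set (m := (a + b) / 2). set (n := (c + d) / 2).
  assert (Hm : a <= m <= b) by (unfold m; lra).
  assert (Hn : c <= n <= d) by (unfold n; lra).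
  destruct (Classical_Prop.classic (exists r', bad eps r' /\ quarter (a, b, c, d) r'))
    as [Hex|Hno]; [exact Hex|exfalso].
  assert (K : forall a' b' c' d', quarter (a, b, c, d) (a', b', c', d') -> a' <= b' -> c' <= d' ->
    Cmod (rect_int G a' b' c' d') <= eps * ((b - a) / 2 + (d - c) / 2) ^ 2).
  { intros a' b' c' d' Hq ? ?. apply Rnot_lt_le. intros Hlt. apply Hno.
    exists (a', b', c', d'). split; [|exact Hq].
    destruct Hq as (? & ? & ? & ? & E1 & E2).
    split; [unfold inside; lra|]. rewrite E1, E2. exact Hlt. }
  rewrite (rect_split_x a m b c d Hin Hm) in Hb.
  rewrite (rect_split_y a m c n d), (rect_split_y m b c n d) in Hb
    by (unfold inside; lra).
  assert (K1 : Cmod (rect_int G a m c n) <= _)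
    by (apply K; [unfold quarter, m, n; lra|lra|lra]).
  assert (K2 : Cmod (rect_int G a m n d) <= _)
    by (apply K; [unfold quarter, m, n; lra|lra|lra]).
  assert (K3 : Cmod (rect_int G m b c n) <= _)
    by (apply K; [unfold quarter, m, n; lra|lra|lra]).
  assert (K4 : Cmod (rect_int G m b n d) <= _)
    by (apply K; [unfold quarter, m, n; lra|lra|lra]).
  assert (T1 := Cmod_triangle (rect_int G a m c n + rect_int G a m n d)
                              (rect_int G m b c n + rect_int G m b n d)).
  assert (T2 := Cmod_triangle (rect_int G a m c n) (rect_int G a m n d)).
  assert (T3 := Cmod_triangle (rect_int G m b c n) (rect_int G m b n d)).
  replace (((b - a) / 2 + (d - c) / 2) ^ 2) with (((b - a) + (d - c)) ^ 2 / 4) in * by field.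
  lra.
Qed.

Lemma Goursat : a0 <= b0 -> c0 <= d0 -> rect_int G a0 b0 c0 d0 = RtoC 0.
Proof.
  intros Hab Hcd.
  assert (HH : forall eps, 0 < eps -> ~ bad eps (a0, b0, c0, d0)).
  { intros eps He Hbad.
    (* The proof of badness travels with the rectangle, so that the choice of a bad quarter can be
       iterated. *)
    set (step := fun r : {r | bad eps r} =>
      let H := constructive_indefinite_description _ (bad_quarter eps _ (proj2_sig r)) in
      exist (bad eps) (proj1_sig H) (proj1 (proj2_sig H))).
    assert (Hstep : forall r, quarter (proj1_sig r) (proj1_sig (step r))).
    { intros r. unfold step. simpl.
      destruct (constructive_indefinite_description _ _) as [r' [Hr1 Hr2]]. exact Hr2. }
    set (sq := fix sq (n : nat) : {r | bad eps r} :=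
      match n with O => exist (bad eps) _ Hbad | S n => step (sq n) end).
    set (A := fun n => fst (fst (fst (proj1_sig (sq n))))).
    set (B := fun n => snd (fst (fst (proj1_sig (sq n))))).
    set (C' := fun n => snd (fst (proj1_sig (sq n)))).
    set (D := fun n => snd (proj1_sig (sq n))).
    assert (Hb : forall n, bad eps (A n, B n, C' n, D n)).
    { intros n. unfold A, B, C', D. destruct (sq n) as [[[[a b] c] d] Hr]. exact Hr. }
    assert (Hq : forall n, quarter (A n, B n, C' n, D n) (A (S n), B (S n), C' (S n), D (S n))).
    { intros n. generalize (Hstep (sq n)). change (step (sq n)) with (sq (S n)).
      unfold A, B, C', D.
      destruct (proj1_sig (sq n)) as [[[a b] c] d].
      destruct (proj1_sig (sq (S n))) as [[[a' b'] c'] d']. auto. }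
    assert (Hs : forall n, (B n - A n) + (D n - C' n) = ((b0 - a0) + (d0 - c0)) * (/ 2) ^ n).
    { induction n as [|n IH]; [simpl; unfold A, B, C', D; simpl; ring|].
      generalize (Hq n). intros (_ & _ & _ & _ & E1 & E2). rewrite E1, E2.
      simpl pow. lra. }
    destruct (nested_intervals A B) as [p Hp].
    { intros n. apply (Hq n). } { intros n. apply (Hq n). } { intros n. apply (Hb n). }
    destruct (nested_intervals C' D) as [q Hq'].
    { intros n. apply (Hq n). } { intros n. apply (Hq n). } { intros n. apply (Hb n). }
    destruct (rect_local p q eps) as [delta [Hd Hl]].
    { exact (Hp 0%nat). } { exact (Hq' 0%nat). } { exact He. }
    (* Adding 1 keeps the divisor positive when the rectangle degenerates to a point. *)
    destruct (pow_lt_1_zero (/ 2) ltac:(rewrite Rabs_pos_eq; lra)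
      (delta / ((b0 - a0) + (d0 - c0) + 1))) as [n Hn].
    { apply Rdiv_lt_0_compat; lra. }
    specialize (Hn n (le_n n)). rewrite Rabs_pos_eq in Hn by (apply pow_le; lra).
    destruct (Hb n) as [Hin Hlt].
    specialize (Hl (A n) (B n) (C' n) (D n) Hin (Hp n) (Hq' n)).
    apply (Rlt_irrefl (Cmod (rect_int G (A n) (B n) (C' n) (D n)))).
    eapply Rle_lt_trans; [apply Hl|exact Hlt].
    rewrite Hs. apply Rlt_div_r in Hn; [|lra].
    assert (0 <= (/ 2) ^ n) by (apply pow_le; lra). lra. }
  apply Cmod_lt_eq. intros eps He.
  set (s := ((b0 - a0) + (d0 - c0)) ^ 2 + 1).
  assert (Hs : 0 < s) by (unfold s; generalize (pow2_ge_0 ((b0 - a0) + (d0 - c0))); lra).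
  apply Rnot_lt_le. intros Hlt.
  apply (HH (eps / s)); [apply Rdiv_lt_0_compat; assumption|].
  split; [unfold inside; lra|]. eapply Rle_lt_trans; [|exact Hlt].
  apply Rle_trans with (eps / s * s); [|right; field; lra].
  apply Rmult_le_compat_l; [left; apply Rdiv_lt_0_compat; assumption|unfold s; lra].
Qed.

End Goursat.


(** * Circle means *)

Definition circ (r t : R) : C := (r * cos t, r * sin t).

(** Not divided by [2 * PI]: the mean value property then carries this factor. *)
Definition mean (g : C -> C) (r : R) : C := Cint (fun t => g (circ r t)) 0 (2 * PI).

Lemma Cmod_circ (r t : R) : 0 <= r -> Cmod (circ r t) = r.
Proof.
  intros Hr. unfold circ, Cmod; simpl.
  replace (_ + _) with (Rsqr r * (Rsqr (sin t) + Rsqr (cos t))) by (unfold Rsqr; ring).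
  rewrite sin2_cos2, Rmult_1_r. apply sqrt_Rsqr, Hr.
Qed.

Lemma circ_nz (r t : R) : 0 < r -> circ r t <> RtoC 0.
Proof. intros Hr E. assert (H := Cmod_circ r t). rewrite E, Cmod_0 in H. lra. Qed.

Lemma circ_dist (r s t u : R) :
  0 <= s -> Cmod (circ r t - circ s u) <= 2 * Rabs (r - s) + 2 * s * Rabs (t - u).
Proof.
  intros Hs. unfold circ. eapply Rle_trans; [apply Cmod_sum_abs|]. simpl.
  assert (Hc : Rabs (cos t - cos u) <= Rabs (t - u)).
  { destruct (MVT_abs cos (fun x => - sin x) u t (fun c _ => derivable_pt_lim_cos c))
      as [c [-> _]].
    rewrite Rabs_Ropp. apply Rle_trans with (1 * Rabs (t - u)); [|lra].
    apply Rmult_le_compat_r; [apply Rabs_pos|]. apply Rabs_le, SIN_bound. }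
  assert (Hn : Rabs (sin t - sin u) <= Rabs (t - u)).
  { destruct (MVT_abs sin cos u t (fun c _ => derivable_pt_lim_sin c))
      as [c [-> _]].
    apply Rle_trans with (1 * Rabs (t - u)); [|lra].
    apply Rmult_le_compat_r; [apply Rabs_pos|]. apply Rabs_le, COS_bound. }
  replace (r * cos t + - (s * cos u)) with ((r - s) * cos t + s * (cos t - cos u)) by ring.
  replace (r * sin t + - (s * sin u)) with ((r - s) * sin t + s * (sin t - sin u)) by ring.
  assert (T1 := Rabs_triang ((r - s) * cos t) (s * (cos t - cos u))).
  assert (T2 := Rabs_triang ((r - s) * sin t) (s * (sin t - sin u))).
  rewrite !Rabs_mult, (Rabs_pos_eq s) in * by exact Hs.
  assert (Rabs (cos t) <= 1) by (apply Rabs_le, COS_bound).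
  assert (Rabs (sin t) <= 1) by (apply Rabs_le, SIN_bound).
  assert (P := Rabs_pos (r - s)).
  assert (Rabs (r - s) * Rabs (cos t) <= Rabs (r - s) * 1) by (apply Rmult_le_compat_l; lra).
  assert (Rabs (r - s) * Rabs (sin t) <= Rabs (r - s) * 1) by (apply Rmult_le_compat_l; lra).
  assert (s * Rabs (cos t - cos u) <= s * Rabs (t - u)) by (apply Rmult_le_compat_l; lra).
  assert (s * Rabs (sin t - sin u) <= s * Rabs (t - u)) by (apply Rmult_le_compat_l; lra).
  lra.
Qed.

Lemma PI2_pos : 0 < 2 * PI.
Proof. generalize PI_RGT_0. lra. Qed.

Lemma Ccont_circ (g : C -> C) (r t : R) :
  0 <= r -> Ccont g (circ r t) -> Rcont (fun t => g (circ r t)) t.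
Proof.
  intros Hr H e He. destruct (H e He) as [d [Hd Hw]].
  exists (d / (2 * r + 1)). split; [apply Rdiv_lt_0_compat; lra|].
  intros u Hu. apply Hw. eapply Rle_lt_trans; [apply circ_dist, Hr|].
  replace (r - r) with 0 by ring. rewrite Rabs_R0.
  apply Rlt_div_r in Hu; [|lra]. generalize (Rabs_pos (u - t)). lra.
Qed.

Lemma Cex_circ (g : C -> C) (r : R) : 0 <= r ->
  (forall w, Cmod w = r -> Ccont g w) -> Cex (fun t => g (circ r t)) 0 (2 * PI).
Proof.
  intros Hr H. apply Rcont_Cex; [generalize PI2_pos; lra|].
  intros t _. apply Ccont_circ; [exact Hr|]. apply H, Cmod_circ, Hr.
Qed.

(* In the coordinate log w the annulus becomes a rectangle whose two
   horizontal sides cancel by periodicity. *)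
Lemma mean_annulus (g : C -> C) (r1 r2 : R) : 0 < r1 -> r1 <= r2 ->
  (forall w, r1 <= Cmod w <= r2 -> exists c, Cder g w c) ->
  mean g r1 = mean g r2.
Proof.
  intros Hr1 Hr H. set (G := fun z => g (Cexp z)).
  assert (Hpol : forall r y, 0 < r -> Cexp (pt (ln r) y) = circ r y).
  { intros r y Hp. unfold Cexp, circ; simpl. rewrite exp_ln by exact Hp. reflexivity. }
  assert (Hle : ln r1 <= ln r2).
  { destruct Hr as [Hr| ->]; [left; apply ln_increasing; assumption|lra]. }
  assert (HG : forall x y, ln r1 <= x <= ln r2 -> 0 <= y <= 2 * PI ->
    exists k, Cder G (pt x y) k).
  { intros x y Hx _. destruct (H (Cexp (pt x y))) as [c Hc].
    - rewrite Cmod_Cexp. simpl. split.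
      + rewrite <- (exp_ln r1) by exact Hr1. destruct (proj1 Hx) as [h|h];
          [left; apply exp_increasing, h|right; congruence].
      + rewrite <- (exp_ln r2) by lra. destruct (proj2 Hx) as [h|h];
          [left; apply exp_increasing, h|right; congruence].
    - eexists. apply (Cder_comp g Cexp); [exact Hc|apply Cder_Cexp]. }
  assert (P := PI2_pos).
  assert (E := Goursat G _ _ _ _ HG Hle ltac:(lra)).
  unfold rect_int in E.
  rewrite (Cint_ext (fun x => G (pt x 0) - G (pt x (2 * PI)))%C (fun _ => RtoC 0)) in E.
  2: exact Hle.
  2:{ intros t _. unfold G.
      replace (Cexp (pt t (2 * PI))) with (Cexp (pt t 0)); [ring|].
      unfold Cexp; simpl. rewrite cos_0, sin_0, cos_2PI, sin_2PI. reflexivity. }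
  rewrite Cint_const in E.
  rewrite Cint_minus in E.
  2: apply (Cex_ver G (ln r1) (ln r2) 0 (2 * PI)); auto; lra.
  2: apply (Cex_ver G (ln r1) (ln r2) 0 (2 * PI)); auto; lra.
  assert (E1 : Cint (fun y => G (pt (ln r2) y)) 0 (2 * PI) = mean g r2).
  { apply Cint_ext; [lra|]. intros t _. unfold G. rewrite Hpol by lra. reflexivity. }
  assert (E2 : Cint (fun y => G (pt (ln r1) y)) 0 (2 * PI) = mean g r1).
  { apply Cint_ext; [lra|]. intros t _. unfold G. rewrite Hpol by lra. reflexivity. }
  rewrite E1, E2 in E.
  (* Goursat's equation [E] reads [... + Ci * (difference of means) = 0]; multiplying it by [- Ci]
     isolates the difference. *)
  assert (E3 : (mean g r2 - mean g r1 = - Ci *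
    (RtoC (ln r2 - ln r1) * 0 + Ci * (mean g r2 - mean g r1)))%C).
  { replace (mean g r2 - mean g r1)%C with (- (Ci * Ci) * (mean g r2 - mean g r1))%C at 1.
    - ring.
    - replace (- (Ci * Ci))%C with (RtoC 1) by (apply injective_projections; simpl; ring).
      ring. }
  rewrite E in E3.
  replace (mean g r1) with (mean g r2 - (mean g r2 - mean g r1))%C by ring.
  rewrite E3. ring.
Qed.

(** Continuity at the points of the circle gives a modulus that depends on the point; compactness of
    the interval of angles makes it uniform. *)
Lemma mean_cont (g : C -> C) (r0 : R) : 0 <= r0 ->
  (forall w, Cmod w = r0 -> Ccont g w) ->
  forall eps, 0 < eps -> exists d, 0 < d /\ forall r, 0 <= r -> Rabs (r - r0) < d ->
    (forall w, Cmod w = r -> Ccont g w) -> Cmod (mean g r - mean g r0) <= eps.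
Proof.
  intros Hr0 Hc eps He. assert (P := PI2_pos).
  (* Both circles are compared with one value at a covering point, at a cost of [2 * e], and the
     interval of integration has length [2 * PI]. *)
  set (e := eps / (2 * (2 * PI))).
  assert (Hpe : 0 < e) by (unfold e; apply Rdiv_lt_0_compat; lra).
  assert (Hloc : forall t, exists d : posreal, forall r x, Rabs (r - r0) < d -> Rabs (x - t) < d ->
    Cmod (g (circ r x) - g (circ r0 t)) < e).
  { intros t. destruct (Hc (circ r0 t) (Cmod_circ _ _ Hr0) e Hpe) as [d [Hd H]].
    assert (Hq : 0 < d / (2 * (1 + r0))) by (apply Rdiv_lt_0_compat; lra).
    exists (mkposreal _ Hq). simpl. intros r x H1 H2. apply H.
    eapply Rle_lt_trans; [apply circ_dist, Hr0|].
    replace d with (2 * (d / (2 * (1 + r0))) + 2 * r0 * (d / (2 * (1 + r0)))) by (field; lra).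
    apply Rplus_lt_le_compat; [lra|]. apply Rmult_le_compat_l; lra. }
  set (delta := fun t => proj1_sig (constructive_indefinite_description _ (Hloc t))).
  assert (Hdelta : forall t r x, Rabs (r - r0) < delta t -> Rabs (x - t) < delta t ->
    Cmod (g (circ r x) - g (circ r0 t)) < e).
  { intros t. unfold delta. destruct (constructive_indefinite_description _ _) as [d Hd].
    exact Hd. }
  destruct (compactness_value_1d 0 (2 * PI) delta) as [d Hd].
  exists d. split; [apply cond_pos|]. intros r Hr Hrd Hcr.
  unfold mean. rewrite <- Cint_minus by (apply Cex_circ; assumption).
  replace eps with ((2 * PI - 0) * (2 * e)) by (unfold e; field; lra).
  apply Cint_bound; [lra|apply Cex_minus; apply Cex_circ; assumption|].
  (* [compactness_value_1d] gives the covering point only under a double negation, so the estimate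
     is obtained by contradiction. *)
  intros x Hx. apply Rnot_lt_le. intros Hlt. apply (Hd x Hx). intros [t [_ [H1 H2]]].
  assert (K1 := Hdelta t r x ltac:(lra) H1).
  assert (K2 := Hdelta t r0 x ltac:(rewrite Rminus_diag, Rabs_R0; apply cond_pos) H1).
  replace (g (circ r x) - g (circ r0 x))%C with
    ((g (circ r x) - g (circ r0 t)) - (g (circ r0 x) - g (circ r0 t)))%C in Hlt by ring.
  generalize (Cmod_minus_le (g (circ r x) - g (circ r0 t)) (g (circ r0 x) - g (circ r0 t))).
  lra.
Qed.

(* Means are constant on each side of the exceptional circle, and continuous
   across it. *)
Lemma mean_value (g : C -> C) (rho r : R) : 0 <= r < 1 ->
  (forall w, in_D w -> Ccont g w) ->
  (forall w, in_D w -> w <> RtoC 0 -> Cmod w <> rho -> exists c, Cder g w c) ->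
  mean g r = (RtoC (2 * PI) * g (RtoC 0))%C.
Proof.
  intros Hr Hc Hd.
  assert (Hc' : forall s, s < 1 -> forall w, Cmod w = s -> Ccont g w).
  { intros s Hs w Hw. apply Hc. unfold in_D. lra. }
  assert (Hd' : forall s1 s2, 0 < s1 -> s1 <= s2 -> s2 < 1 -> (s2 < rho \/ rho < s1) ->
    mean g s1 = mean g s2).
  { intros s1 s2 H1 H2 H3 H4. apply mean_annulus; auto. intros w Hw. apply Hd.
    - unfold in_D; lra.
    - intros E. rewrite E, Cmod_0 in Hw. lra.
    - lra. }
  (* By continuity a mean is determined by those at nearby radii; this covers the centre and the
     circle of radius [rho], where differentiability is not assumed. *)
  assert (Hlim : forall s k, 0 <= s < 1 ->
    (forall d, 0 < d -> exists s', 0 <= s' < 1 /\ Rabs (s' - s) < d /\ mean g s' = k) ->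
    mean g s = k).
  { intros s k Hs H. replace (mean g s) with (k + (mean g s - k))%C by ring.
    rewrite (Cmod_lt_eq (mean g s - k)); [ring|]. intros e He.
    destruct (mean_cont g s (proj1 Hs) (Hc' s (proj2 Hs)) e He) as [d [Hdp H']].
    destruct (H d Hdp) as [s' [Hs' [Hs'' <-]]]. rewrite Cmod_minus_sym.
    apply H'; [apply Hs'|exact Hs''|apply Hc', Hs']. }
  assert (H0 : mean g 0 = (RtoC (2 * PI) * g (RtoC 0))%C).
  { unfold mean. rewrite (Cint_ext _ (fun _ => g (RtoC 0))).
    - rewrite Cint_const. f_equal. f_equal. ring.
    - generalize PI2_pos; lra.
    - intros t _. f_equal. unfold circ, RtoC. f_equal; ring. }
  rewrite <- H0. clear H0.
  assert (Hlow : forall s, 0 <= s < 1 -> s < rho -> mean g s = mean g 0).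
  { intros s Hs Hsr. symmetry. apply Hlim; [lra|]. intros d Hdp.
    destruct (Req_dec s 0) as [->|Hn].
    - exists 0. rewrite Rminus_diag, Rabs_R0. repeat split; lra.
    - assert (Q : 0 < Rmin d s) by (apply Rmin_pos; lra).
      assert (Q1 := Rmin_l d s). assert (Q2 := Rmin_r d s).
      exists (Rmin d s / 2). split; [lra|]. split.
      + rewrite Rabs_pos_eq; lra.
      + apply Hd'; try lra. }
  assert (Hmid : forall s, 0 <= s < 1 -> s = rho -> mean g s = mean g 0).
  { intros s Hs ->. apply Hlim; [exact Hs|]. intros d Hdp.
    destruct (Req_dec rho 0) as [->|Hn].
    - exists 0. rewrite Rminus_diag, Rabs_R0. repeat split; lra.
    - assert (Q : 0 < Rmin d rho) by (apply Rmin_pos; lra).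
      assert (Q1 := Rmin_l d rho). assert (Q2 := Rmin_r d rho).
      exists (rho - Rmin d rho / 2). split; [lra|]. split.
      + rewrite Rabs_left; lra.
      + apply Hlow; lra. }
  destruct (Rtotal_order r rho) as [h|[h|h]]; [apply Hlow; auto|apply Hmid; auto|].
  (* Beyond [rho] the means are compared with the one on the exceptional circle. For negative [rho]
     there is no such circle, and the radii shrink to the centre instead. *)
  symmetry. destruct (Rle_dec 0 rho) as [Hp|Hp].
  - rewrite <- (Hmid rho); [|lra|reflexivity]. apply Hlim; [lra|]. intros d Hdp.
    assert (Q : 0 < Rmin d (r - rho)) by (apply Rmin_pos; lra).
    assert (Q1 := Rmin_l d (r - rho)). assert (Q2 := Rmin_r d (r - rho)).
    exists (rho + Rmin d (r - rho) / 2). split; [lra|]. split.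
    + rewrite Rabs_pos_eq; lra.
    + apply Hd'; try lra.
  - destruct (Req_dec r 0) as [->|Hn]; [reflexivity|].
    apply Hlim; [lra|]. intros d Hdp.
    assert (Q : 0 < Rmin d r) by (apply Rmin_pos; lra).
    assert (Q1 := Rmin_l d r). assert (Q2 := Rmin_r d r).
    exists (Rmin d r / 2). split; [lra|]. split.
    + rewrite Rabs_pos_eq; lra.
    + apply Hd'; try lra.
Qed.

Lemma mean_value_analytic (g : C -> C) (r : R) : 0 <= r < 1 ->
  analytic g -> mean g r = (RtoC (2 * PI) * g (RtoC 0))%C.
Proof.
  intros Hr Hg. rewrite analytic_Cder in Hg.
  apply mean_value with 0; [exact Hr| |auto].
  intros w Hw. destruct (Hg w Hw) as [c Hc]. eapply Cder_Ccont, Hc.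
Qed.

Lemma circ_conj (r t : R) : 0 < r ->
  (/ circ r t = RtoC (/ (r * r)) * Cconj (circ r t))%C.
Proof.
  intros Hr. assert (H := circ_nz r t Hr).
  assert (E : (circ r t * Cconj (circ r t) = RtoC (r * r))%C).
  { apply injective_projections; simpl; [|ring].
    generalize (sin2_cos2 t). unfold Rsqr. intros E.
    replace (r * cos t * (r * cos t) - r * sin t * - (r * sin t))
      with (r * r * (sin t * sin t + cos t * cos t)) by ring. rewrite E. ring. }
  assert (Hrr : 0 < r * r) by (apply Rmult_lt_0_compat; exact Hr).
  rewrite RtoC_inv by lra. rewrite <- E.
  assert (Cconj (circ r t) <> RtoC 0).
  { intros E0. rewrite E0 in E. replace (circ r t * 0)%C with (RtoC 0) in E by ring.
    apply RtoC_inj in E. lra. }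
  field. split; assumption.
Qed.

(** On the circle [/ w] is [Cconj w] divided by [r * r], so up to a constant the integrand is the
    conjugate of [g w * w ^ n], an analytic function vanishing at 0. *)
Lemma mean_conj_mono (g : C -> C) (n : nat) (r : R) : 0 < r < 1 -> analytic g -> (1 <= n)%nat ->
  mean (fun w => Cconj (g w) * Cpow (/ w) n)%C r = RtoC 0.
Proof.
  intros Hr Hg Hn. assert (P := PI2_pos).
  assert (Ha : analytic (fun w => g w * Cpow w n)%C).
  { rewrite analytic_Cder in *. intros z Hz. destruct (Hg z Hz) as [c Hc].
    eexists. apply Cder_mult; [exact Hc|apply Cder_pow]. }
  assert (Hm := mean_value_analytic _ r ltac:(lra) Ha). simpl in Hm.
  replace (Cpow 0 n) with (RtoC 0) in Hm.
  2:{ destruct n; [lia|]. rewrite Cpow_S. ring. }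
  replace (RtoC (2 * PI) * (g (RtoC 0) * RtoC 0))%C with (RtoC 0) in Hm by ring.
  assert (Hex : Cex (fun t => g (circ r t) * Cpow (circ r t) n)%C 0 (2 * PI)).
  { apply (Cex_circ (fun w => g w * Cpow w n)%C); [lra|]. intros w Hw.
    destruct (proj1 (analytic_Cder _) Ha w) as [c Hc]; [unfold in_D; lra|].
    eapply Cder_Ccont, Hc. }
  unfold mean in *.
  rewrite (Cint_ext _ (fun t => Cpow (RtoC (/ (r * r))) n *
    Cconj (g (circ r t) * Cpow (circ r t) n))%C).
  - rewrite Cint_scal by (apply Cex_conj, Hex). rewrite Cint_conj by exact Hex.
    rewrite Hm. apply injective_projections; simpl; ring.
  - lra.
  - intros t _. rewrite circ_conj by lra.
    rewrite Cpow_mult_l, Cmult_conj, Cpow_conj. ring.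
Qed.

Lemma analytic_const (c : C) : analytic (fun _ => c).
Proof. apply analytic_Cder. intros z _. eexists. apply Cder_const. Qed.

Lemma mean_inv_pow (n : nat) (r : R) : 0 < r < 1 -> (1 <= n)%nat ->
  mean (fun w => Cpow (/ w) n) r = RtoC 0.
Proof.
  intros Hr Hn. rewrite <- (mean_conj_mono (fun _ => RtoC 1) n r Hr (analytic_const _) Hn).
  apply Cint_ext; [generalize PI2_pos; lra|]. intros t _.
  replace (Cconj 1) with (RtoC 1) by (apply injective_projections; simpl; ring). ring.
Qed.


(** * Power series *)

Definition Cconv (s : nat -> C) (l : C) : Prop :=
  forall eps, 0 < eps -> exists n0, forall n, (n0 <= n)%nat -> Cmod (s n - l) < eps.

Fixpoint csum (u : nat -> C) (n : nat) : C :=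
  match n with O => RtoC 0 | S n => (csum u n + u n)%C end.

Fixpoint rsum (u : nat -> R) (n : nat) : R :=
  match n with O => 0 | S n => rsum u n + u n end.

Lemma Cconv_unique (s : nat -> C) (l l' : C) : Cconv s l -> Cconv s l' -> l = l'.
Proof.
  intros H H'. replace l with (l' + (l - l'))%C by ring.
  rewrite (Cmod_lt_eq (l - l')); [ring|]. intros e He.
  destruct (H (e / 2) ltac:(lra)) as [n Hn]. destruct (H' (e / 2) ltac:(lra)) as [n' Hn'].
  specialize (Hn (max n n') ltac:(lia)). specialize (Hn' (max n n') ltac:(lia)).
  replace (l - l')%C with ((s (max n n') - l') - (s (max n n') - l))%C by ring.
  eapply Rle_trans; [apply Cmod_minus_le|]. lra.
Qed.

Lemma Cconv_ext (s s' : nat -> C) (l : C) :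
  (forall n, s n = s' n) -> Cconv s l -> Cconv s' l.
Proof.
  intros E H e He. destruct (H e He) as [n Hn]. exists n. intros m Hm.
  rewrite <- E. auto.
Qed.

Lemma Cconv_const (l : C) : Cconv (fun _ => l) l.
Proof.
  intros e He. exists 0%nat. intros n _. replace (l - l)%C with (RtoC 0) by ring.
  rewrite Cmod_0. exact He.
Qed.

Lemma Cconv_plus (s s' : nat -> C) (l l' : C) :
  Cconv s l -> Cconv s' l' -> Cconv (fun n => s n + s' n)%C (l + l')%C.
Proof.
  intros H H' e He.
  destruct (H (e / 2) ltac:(lra)) as [n Hn]. destruct (H' (e / 2) ltac:(lra)) as [n' Hn'].
  exists (max n n'). intros m Hm. specialize (Hn m ltac:(lia)). specialize (Hn' m ltac:(lia)).
  replace (s m + s' m - (l + l'))%C with ((s m - l) + (s' m - l'))%C by ring.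
  eapply Rle_lt_trans; [apply Cmod_triangle|]. lra.
Qed.

Lemma Cconv_cont (f : C -> C) (s : nat -> C) (l : C) :
  Ccont f l -> Cconv s l -> Cconv (fun n => f (s n)) (f l).
Proof.
  intros Hf H e He. destruct (Hf e He) as [d [Hd Hw]]. destruct (H d Hd) as [n Hn].
  exists n. auto.
Qed.

Lemma Cconv_subseq (s : nat -> C) (l : C) (phi : nat -> nat) :
  (forall n0, exists n1, forall n, (n1 <= n)%nat -> (n0 <= phi n)%nat) ->
  Cconv s l -> Cconv (fun n => s (phi n)) l.
Proof.
  intros Hphi H e He. destruct (H e He) as [n Hn]. destruct (Hphi n) as [n1 H1].
  exists n1. auto.
Qed.

Lemma Cconv_mult (s s' : nat -> C) (l l' : C) :
  Cconv s l -> Cconv s' l' -> Cconv (fun n => s n * s' n)%C (l * l')%C.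
Proof.
  intros H H'.
  assert (Hc : Cconv (fun n => (s n - l) * (s' n - l'))%C (RtoC 0)).
  { intros e He. destruct (H (Rmin 1 e)) as [n Hn]; [apply Rmin_pos; lra|].
    destruct (H' 1 ltac:(lra)) as [n' Hn'].
    exists (max n n'). intros m Hm. specialize (Hn m ltac:(lia)). specialize (Hn' m ltac:(lia)).
    replace ((s m - l) * (s' m - l') - RtoC 0)%C with ((s m - l) * (s' m - l'))%C by ring.
    rewrite Cmod_mult. apply Rle_lt_trans with (Cmod (s m - l) * 1).
    - apply Rmult_le_compat_l; [apply Cmod_ge_0|lra].
    - rewrite Rmult_1_r. eapply Rlt_le_trans; [exact Hn|apply Rmin_r]. }
  assert (K : forall k, Ccont (fun w => k * w)%C l /\ Ccont (fun w => k * w)%C l').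
  { intros k. split; apply Ccont_mult; try apply Ccont_const; apply Ccont_id. }
  assert (H1 := Cconv_cont _ _ _ (proj1 (K l')) H).
  assert (H2 := Cconv_cont _ _ _ (proj2 (K l)) H').
  assert (H3 := Cconv_plus _ _ _ _ (Cconv_plus _ _ _ _ Hc H1)
                 (Cconv_plus _ _ _ _ H2 (Cconv_const (- (l * l'))%C))).
  replace (l * l')%C with (0 + l' * l + (l * l' + - (l * l')))%C by ring.
  refine (Cconv_ext _ _ _ _ H3). intros n. ring.
Qed.

Lemma Cconv_le (s : nat -> C) (l k : C) (M : R) (n0 : nat) :
  Cconv s l -> (forall n, (n0 <= n)%nat -> Cmod (s n - k) <= M) -> Cmod (l - k) <= M.
Proof.
  intros H HM. apply Rnot_lt_le. intros Hlt.
  destruct (H (Cmod (l - k) - M) ltac:(lra)) as [n Hn].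
  specialize (Hn (max n n0) ltac:(lia)). specialize (HM (max n n0) ltac:(lia)).
  assert (T := Cmod_le_add (l - k) (s (max n n0) - k)).
  replace (l - k - (s (max n n0) - k))%C with (- (s (max n n0) - l))%C in T by ring.
  rewrite Cmod_opp in T. lra.
Qed.

Lemma Cconv_cauchy (s : nat -> C) :
  (forall eps, 0 < eps -> exists n0, forall n, (n0 <= n)%nat -> Cmod (s n - s n0) < eps) ->
  exists l, Cconv s l.
Proof.
  intros H.
  assert (Hr : forall p : C -> R, (forall z w, Rabs (p z - p w) <= Cmod (z - w)) ->
    {x | Un_cv (fun n => p (s n)) x}).
  { intros p Hp. apply Rcomplete.R_complete. intros e He. destruct (H (e / 2) ltac:(lra)) as [n0 Hn].
    exists n0. intros n m Hn1 Hm1. unfold Rdist.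
    assert (A := Hn n ltac:(lia)). assert (B := Hn m ltac:(lia)).
    eapply Rle_lt_trans; [apply Hp|].
    replace (s n - s m)%C with ((s n - s n0) - (s m - s n0))%C by ring.
    eapply Rle_lt_trans; [apply Cmod_minus_le|]. lra. }
  destruct (Hr Re) as [x Hx].
  { intros z w. change (Re z - Re w) with (Re (z - w)). apply re_le_Cmod. }
  destruct (Hr Im) as [y Hy].
  { intros z w. change (Im z - Im w) with (Im (z - w)). apply im_le_Cmod. }
  exists (x, y). intros e He.
  destruct (Hx (e / 2) ltac:(lra)) as [n1 H1]. destruct (Hy (e / 2) ltac:(lra)) as [n2 H2].
  exists (max n1 n2). intros n Hn.
  specialize (H1 n ltac:(lia)). specialize (H2 n ltac:(lia)).
  eapply Rle_lt_trans; [apply Cmod_sum_abs|]. unfold Rdist in *.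
  change (Re (s n - (x, y))) with (Re (s n) - x).
  change (Im (s n - (x, y))) with (Im (s n) - y). lra.
Qed.

Lemma rsum_le (u v : nat -> R) (n : nat) :
  (forall k, u k <= v k) -> rsum u n <= rsum v n.
Proof.
  intros H. induction n as [|n IH]; simpl; [lra|]. generalize (H n). lra.
Qed.

Lemma rsum_scal (c : R) (u : nat -> R) (n : nat) :
  rsum (fun k => c * u k) n = c * rsum u n.
Proof. induction n as [|n IH]; simpl; [ring|]. rewrite IH. ring. Qed.

Lemma rsum_shift (u : nat -> R) (n : nat) :
  rsum u (S n) = u 0%nat + rsum (fun k => u (S k)) n.
Proof.
  induction n as [|n IH]; [simpl; ring|].
  change (rsum u (S n) + u (S n) = u 0%nat + rsum (fun k => u (S k)) (S n)).
  rewrite IH. simpl. ring.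
Qed.

Lemma csum_shift (u : nat -> C) (n : nat) :
  csum u (S n) = (u 0%nat + csum (fun k => u (S k)) n)%C.
Proof.
  induction n as [|n IH]; [simpl; ring|].
  change (csum u (S n) + u (S n) = u 0%nat + csum (fun k => u (S k)) (S n))%C.
  rewrite IH. simpl. ring.
Qed.

Lemma csum_ext (u v : nat -> C) (n : nat) :
  (forall k, u k = v k) -> csum u n = csum v n.
Proof. intros H. induction n as [|n IH]; simpl; [reflexivity|]. rewrite IH, H. reflexivity. Qed.

Lemma csum_scal (c : C) (u : nat -> C) (n : nat) :
  csum (fun k => c * u k)%C n = (c * csum u n)%C.
Proof. induction n as [|n IH]; simpl; [ring|]. rewrite IH. ring. Qed.

Lemma csum_minus (u v : nat -> C) (n : nat) :
  csum (fun k => u k - v k)%C n = (csum u n - csum v n)%C.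
Proof. induction n as [|n IH]; simpl; [ring|]. rewrite IH. ring. Qed.

Lemma csum_diff_le (u : nat -> C) (b : nat -> R) (n m : nat) :
  (forall k, Cmod (u k) <= b k) -> (n <= m)%nat ->
  Cmod (csum u m - csum u n) <= rsum b m - rsum b n.
Proof.
  intros H Hnm. induction Hnm as [|m Hnm IH].
  - replace (csum u n - csum u n)%C with (RtoC 0) by ring. rewrite Cmod_0. lra.
  - simpl. replace (csum u m + u m - csum u n)%C with (csum u m - csum u n + u m)%C by ring.
    eapply Rle_trans; [apply Cmod_triangle|]. generalize (H m). lra.
Qed.

Lemma csum_le (u : nat -> C) (b : nat -> R) (n : nat) :
  (forall k, Cmod (u k) <= b k) -> Cmod (csum u n) <= rsum b n.
Proof.
  intros H. generalize (csum_diff_le u b 0 n H ltac:(lia)). simpl.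
  replace (csum u n - 0)%C with (csum u n) by ring. lra.
Qed.

Lemma rsum_tail (b : nat -> R) (B : R) :
  (forall k, 0 <= b k) -> (forall n, rsum b n <= B) ->
  forall eps, 0 < eps -> exists n0, forall n, (n0 <= n)%nat -> rsum b n - rsum b n0 < eps.
Proof.
  intros Hb HB e He.
  destruct (completeness (fun x => exists n, x = rsum b n)) as [p [H1 H2]].
  - exists B. intros x [n ->]. apply HB.
  - exists (rsum b 0), 0%nat. reflexivity.
  - destruct (Classical_Prop.classic (exists n0, p - e < rsum b n0)) as [[n0 Hn]|Hno].
    + exists n0. intros n _. assert (rsum b n <= p) by (apply H1; exists n; reflexivity). lra.
    + exfalso. assert (p <= p - e); [|lra]. apply H2. intros x [n ->].
      apply Rnot_lt_le. intros Hlt. apply Hno. exists n. exact Hlt.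
Qed.

Lemma dominated_conv (u : nat -> C) (b : nat -> R) (B : R) :
  (forall k, Cmod (u k) <= b k) -> (forall n, rsum b n <= B) -> exists l, Cconv (csum u) l.
Proof.
  intros Hu HB. apply Cconv_cauchy. intros e He.
  destruct (rsum_tail b B) with (eps := e) as [n0 Hn]; auto.
  { intros k. eapply Rle_trans; [apply Cmod_ge_0|apply Hu]. }
  exists n0. intros n Hle. eapply Rle_lt_trans; [apply csum_diff_le; eauto|]. auto.
Qed.

Lemma dominated_tail (u : nat -> C) (b : nat -> R) (l : C) (eps : R) (n0 : nat) :
  (forall k, Cmod (u k) <= b k) -> Cconv (csum u) l ->
  (forall n, (n0 <= n)%nat -> rsum b n - rsum b n0 < eps) ->
  Cmod (l - csum u n0) <= eps.
Proof.
  intros Hu Hl H. apply Cconv_le with (csum u) n0; [exact Hl|].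
  intros n Hn. eapply Rle_trans; [apply csum_diff_le; eauto|]. left. auto.
Qed.

Lemma dominated_bound (u : nat -> C) (b : nat -> R) (l : C) (B : R) :
  (forall k, Cmod (u k) <= b k) -> (forall n, rsum b n <= B) -> Cconv (csum u) l ->
  Cmod l <= B.
Proof.
  intros Hu HB Hl. replace l with (l - 0)%C by ring. apply Cconv_le with (csum u) 0%nat; [exact Hl|].
  intros n _. replace (csum u n - 0)%C with (csum u n) by ring.
  eapply Rle_trans; [apply csum_le; eauto|apply HB].
Qed.

Lemma Cder_csum (f : nat -> C -> C) (d : nat -> C) (z : C) (n : nat) :
  (forall k, Cder (f k) z (d k)) -> Cder (fun w => csum (fun k => f k w) n) z (csum d n).
Proof.
  intros H. induction n as [|n IH]; simpl; [apply Cder_const|]. apply Cder_plus; auto.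
Qed.

(** Turns the Lipschitz constants of the terms of a series into a dominating series for their
    derivatives. *)
Lemma Cder_le_lipschitz (f : C -> C) (z d : C) (L rho : R) :
  Cmod z < rho -> Cder f z d ->
  (forall w, Cmod w < rho -> Cmod (f w - f z) <= L * Cmod (w - z)) -> Cmod d <= L.
Proof.
  intros Hz Hd HL. apply Rnot_lt_le. intros Hlt.
  destruct (Cder_eps _ _ _ Hd ((Cmod d - L) / 2) ltac:(lra)) as [dl [Hdl H]].
  set (h := Rmin dl (rho - Cmod z) / 2).
  assert (Q1 := Rmin_l dl (rho - Cmod z)). assert (Q2 := Rmin_r dl (rho - Cmod z)).
  assert (Q : 0 < Rmin dl (rho - Cmod z)) by (apply Rmin_pos; lra).
  assert (Hh : 0 < h) by (unfold h; lra).
  assert (Em : Cmod (z + RtoC h - z) = h).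
  { replace (z + RtoC h - z)%C with (RtoC h) by ring. rewrite Cmod_R. apply Rabs_pos_eq; lra. }
  specialize (H (z + RtoC h)%C). rewrite Em in H.
  specialize (H ltac:(unfold h; lra)).
  specialize (HL (z + RtoC h)%C). rewrite Em in HL.
  assert (Cmod (z + RtoC h) < rho).
  { eapply Rle_lt_trans; [apply Cmod_triangle|]. rewrite Cmod_R, Rabs_pos_eq by lra.
    unfold h; lra. }
  specialize (HL ltac:(assumption)).
  assert (T := Cmod_le_add (d * (z + RtoC h - z)) (f (z + RtoC h)%C - f z)).
  rewrite (Cmod_minus_sym (d * _)), Cmod_mult, Em in T.
  assert (Cmod d * h <= L * h + (Cmod d - L) / 2 * h) by lra.
  assert ((Cmod d - L) * h <= (Cmod d - L) / 2 * h) by lra.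
  assert (0 < (Cmod d - L) * h) by (apply Rmult_lt_0_compat; lra). lra.
Qed.

(* Uniform summability of the Lipschitz constants replaces the Weierstrass
   theorem on locally uniform limits. *)
Lemma series_Cder (f : nat -> C -> C) (L : nat -> R) (S : C -> C) (rho B : R) :
  (forall k w w', Cmod w < rho -> Cmod w' < rho ->
     Cmod (f k w - f k w') <= L k * Cmod (w - w')) ->
  (forall k, 0 <= L k) -> (forall n, rsum L n <= B) ->
  (forall w, Cmod w < rho -> Cconv (csum (fun k => f k w)) (S w)) ->
  (forall w w', Cmod w < rho -> Cmod w' < rho -> Cmod (S w - S w') <= B * Cmod (w - w')) /\
  forall z d, Cmod z < rho -> (forall k, Cder (f k) z (d k)) ->
    exists l, Cconv (csum d) l /\ Cder S z l.
Proof.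
  intros HL L0 HB HS.
  assert (Hdiff : forall w w', Cmod w < rho -> Cmod w' < rho ->
    Cconv (csum (fun k => f k w - f k w')%C) (S w - S w')%C).
  { intros w w' Hw Hw'.
    assert (K := Cconv_plus _ _ _ _ (HS w Hw)
      (Cconv_mult _ _ _ _ (Cconv_const (- (1))%C) (HS w' Hw'))).
    replace (S w - S w')%C with (S w + - (1) * S w')%C by ring.
    refine (Cconv_ext _ _ _ _ K). intros n. rewrite csum_minus. ring. }
  split.
  { intros w w' Hw Hw'.
    apply (dominated_bound (fun k => f k w - f k w')%C (fun k => L k * Cmod (w - w'))); auto.
    intros n. rewrite <- (Rmult_comm (Cmod (w - w'))).
    replace (rsum (fun k => L k * Cmod (w - w')) n) with (Cmod (w - w') * rsum L n).
    - apply Rmult_le_compat_l; [apply Cmod_ge_0|apply HB].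
    - rewrite <- rsum_scal. clear. induction n; simpl; [reflexivity|]. rewrite IHn. ring. }
  intros z d Hz Hd.
  assert (Hdk : forall k, Cmod (d k) <= L k).
  { intros k. apply Cder_le_lipschitz with (f k) z rho; auto. }
  destruct (dominated_conv d L B Hdk HB) as [l Hl].
  exists l. split; [exact Hl|]. apply Cder_of_eps. intros e He.
  destruct (rsum_tail L B L0 HB (e / 3) ltac:(lra)) as [n0 Hn].
  destruct (Cder_eps _ _ _ (Cder_csum f d z n0 Hd) (e / 3) ltac:(lra)) as [dl [Hdl Hf]].
  exists (Rmin dl (rho - Cmod z)). split; [apply Rmin_pos; lra|]. intros w Hw.
  assert (Q1 := Rmin_l dl (rho - Cmod z)). assert (Q2 := Rmin_r dl (rho - Cmod z)).
  assert (Hwr : Cmod w < rho) by (generalize (Cmod_le_add w z); lra).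
  specialize (Hf w ltac:(lra)). simpl in Hf.
  assert (T1 : Cmod ((S w - S z) - csum (fun k => f k w - f k z)%C n0) <= e / 3 * Cmod (w - z)).
  (* [dominated_tail] asks for a strict inequality between tails, which is lost when [w = z]. *)
  { destruct (Req_dec (Cmod (w - z)) 0) as [E0|Hne].
    - rewrite E0. apply Cmod_eq_0 in E0. replace w with (z + (w - z))%C by ring.
      rewrite E0. replace (z + 0)%C with z by ring.
      rewrite csum_minus. replace (_ - _ - _)%C with (RtoC 0) by ring. rewrite Cmod_0. lra.
    - apply dominated_tail with (b := fun k => L k * Cmod (w - z)); auto.
      intros n Hle.
      assert (E : forall m, rsum (fun k => L k * Cmod (w - z)) m = rsum L m * Cmod (w - z)).
      { clear. induction m; simpl; [ring|]. rewrite IHm. ring. }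
      rewrite !E. assert (0 < Cmod (w - z)) by (generalize (Cmod_ge_0 (w - z)); lra).
      rewrite <- Rmult_minus_distr_r. apply Rmult_lt_compat_r; auto. }
  assert (T2 : Cmod (l - csum d n0) <= e / 3) by (apply dominated_tail with L; auto).
  rewrite csum_minus in T1.
  replace (S w - S z - l * (w - z))%C with
    ((S w - S z - (csum (fun k => f k w) n0 - csum (fun k => f k z) n0)) +
     ((csum (fun k => f k w) n0 - csum (fun k => f k z) n0 - csum d n0 * (w - z)) -
      (l - csum d n0) * (w - z)))%C by ring.
  eapply Rle_trans; [apply Cmod_triangle|].
  assert (T3 := Cmod_minus_le (csum (fun k => f k w) n0 - csum (fun k => f k z) n0 - csum d n0 * (w - z))
      ((l - csum d n0) * (w - z))). rewrite (Cmod_mult (l - csum d n0)) in T3.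
  assert (Cmod (l - csum d n0) * Cmod (w - z) <= e / 3 * Cmod (w - z))
    by (apply Rmult_le_compat_r; [apply Cmod_ge_0|exact T2]).
  lra.
Qed.

Definition PS (a : nat -> C) (f : C -> C) : Prop :=
  forall z, in_D z -> Cconv (csum (fun k => a k * Cpow z k)%C) (f z).

(** Radius of convergence at least 1, in the form used by Abel's lemma: bounded terms at every
    radius below 1. *)
Definition PSb (a : nat -> C) : Prop :=
  forall r, 0 < r < 1 -> exists M, forall k, Cmod (a k) * r ^ k <= M.

Lemma geom_deriv_sum (q : R) (n : nat) : 0 <= q < 1 ->
  rsum (fun k => INR (S k) * q ^ k) n <= / ((1 - q) * (1 - q)).
Proof.
  intros Hq.
  assert (E : rsum (fun k => INR (S k) * q ^ k) n * ((1 - q) * (1 - q))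
    = 1 - (INR n + 1) * q ^ n + INR n * (q * q ^ n)).
  { induction n as [|n IH]; [simpl; ring|].
    cbn [rsum]. rewrite Rmult_plus_distr_r, IH, S_INR. simpl pow. ring. }
  assert (P : 0 < (1 - q) * (1 - q)) by (apply Rmult_lt_0_compat; lra).
  apply Rmult_le_reg_r with ((1 - q) * (1 - q)); [exact P|].
  rewrite E, Rinv_l by lra.
  assert (0 <= q ^ n) by (apply pow_le; lra).
  assert (0 <= INR n * ((1 - q) * q ^ n)).
  { apply Rmult_le_pos; [apply pos_INR|]. apply Rmult_le_pos; lra. }
  lra.
Qed.

Lemma geom_sum (q : R) (n : nat) : 0 <= q < 1 -> rsum (fun k => q ^ k) n <= / (1 - q).
Proof.
  intros Hq. assert (E : rsum (fun k => q ^ k) n * (1 - q) = 1 - q ^ n).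
  { induction n as [|n IH]; [simpl; ring|]. cbn [rsum].
    rewrite Rmult_plus_distr_r, IH. simpl. ring. }
  apply Rmult_le_reg_r with (1 - q); [lra|]. rewrite E, Rinv_l by lra.
  assert (0 <= q ^ n) by (apply pow_le; lra). lra.
Qed.

Lemma rsum_ge_term (u : nat -> R) (k : nat) : (forall i, 0 <= u i) -> u k <= rsum u (S k).
Proof.
  intros H. simpl. assert (0 <= rsum u k); [|lra].
  induction k; simpl; [lra|]. generalize (H k). lra.
Qed.

(** The terms are bounded at a radius [r] strictly between [rho] and 1, so the differentiated series
    at [rho] is dominated by the derivative of the geometric series at [q = rho / r]. *)
Lemma PSb_deriv_sum (a : nat -> C) (rho : R) : PSb a -> 0 < rho < 1 ->
  exists B, forall n, rsum (fun k => Cmod (a k) * (INR k * rho ^ pred k)) n <= B.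
Proof.
  intros Ha Hr. set (r := (1 + rho) / 2).
  destruct (Ha r ltac:(unfold r; lra)) as [M HM].
  assert (HM0 : 0 <= M).
  { eapply Rle_trans; [|apply (HM 0%nat)]. apply Rmult_le_pos; [apply Cmod_ge_0|simpl; lra]. }
  set (q := rho / r).
  assert (Hq : 0 <= q < 1).
  { unfold q, r. split; [apply Rle_div_r; lra|]. apply Rlt_div_l; lra. }
  exists (M / r * / ((1 - q) * (1 - q))).
  assert (K : forall n, rsum (fun k => Cmod (a (S k)) * (INR (S k) * rho ^ k)) n
    <= M / r * / ((1 - q) * (1 - q))).
  { intros n. eapply Rle_trans.
    2:{ apply Rmult_le_compat_l; [|apply (geom_deriv_sum q n Hq)].
        apply Rle_div_r; unfold r; lra. }
    rewrite <- rsum_scal. apply rsum_le. intros k.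
    assert (Eq : rho ^ k = q ^ k * r ^ k).
    { rewrite <- Rpow_mult_distr. f_equal. unfold q. field. unfold r; lra. }
    rewrite Eq. specialize (HM (S k)). simpl pow in HM.
    assert (Hr0 : 0 < r) by (unfold r; lra).
    apply Rle_trans with ((Cmod (a (S k)) * (r * r ^ k)) * / r * (INR (S k) * q ^ k)).
    - right. field. lra.
    - apply Rmult_le_compat_r.
      + apply Rmult_le_pos; [apply pos_INR|apply pow_le; lra].
      + apply Rmult_le_compat_r; [|exact HM]. left. apply Rinv_0_lt_compat, Hr0. }
  intros [|n].
  - simpl. eapply Rle_trans; [|apply (K 0%nat)]. simpl. lra.
  - rewrite rsum_shift. simpl pred. change (INR 0) with 0.
    specialize (K n). lra.
Qed.

Lemma pow_lipschitz (k : nat) (rho : R) (w w' : C) : 0 < rho -> Cmod w <= rho -> Cmod w' <= rho ->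
  Cmod (Cpow w k - Cpow w' k) <= INR k * rho ^ pred k * Cmod (w - w').
Proof.
  intros Hr Hw Hw'. induction k as [|k IH].
  - simpl. replace (RtoC 1 - RtoC 1)%C with (RtoC 0) by ring. rewrite Cmod_0. lra.
  - rewrite !Cpow_S.
    replace (w * Cpow w k - w' * Cpow w' k)%C
      with (w * (Cpow w k - Cpow w' k) + (w - w') * Cpow w' k)%C by ring.
    eapply Rle_trans; [apply Cmod_triangle|]. rewrite !Cmod_mult, Cmod_pow.
    assert (Cmod w' ^ k <= rho ^ k) by (apply pow_incr; split; [apply Cmod_ge_0|exact Hw']).
    assert (P := Cmod_ge_0 (w - w')).
    assert (Cmod (w - w') * Cmod w' ^ k <= Cmod (w - w') * rho ^ k)
      by (apply Rmult_le_compat_l; assumption).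
    assert (Cmod w * Cmod (Cpow w k - Cpow w' k) <= rho * (INR k * rho ^ pred k * Cmod (w - w')))
      by (apply Rmult_le_compat; try apply Cmod_ge_0; assumption).
    assert (E : rho * (INR k * rho ^ pred k * Cmod (w - w')) = INR k * rho ^ k * Cmod (w - w')).
    { destruct k; simpl pred; [simpl; ring|]. simpl pow. ring. }
    rewrite S_INR. simpl pred. lra.
Qed.

Lemma PSb_conv (a : nat -> C) : PSb a -> exists f, PS a f.
Proof.
  intros Ha.
  assert (H : forall z, exists l, in_D z -> Cconv (csum (fun k => a k * Cpow z k)%C) l).
  { intros z. destruct (Classical_Prop.classic (in_D z)) as [Hz|Hz].
    2: exists (RtoC 0); tauto.
    unfold in_D in Hz. assert (P := Cmod_ge_0 z).
    set (r := (1 + Cmod z) / 2). destruct (Ha r ltac:(unfold r; lra)) as [M HM].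
    set (q := Cmod z / r).
    assert (Hq : 0 <= q < 1).
    { unfold q, r. split; [apply Rle_div_r; lra|]. apply Rlt_div_l; lra. }
    destruct (dominated_conv (fun k => a k * Cpow z k)%C (fun k => M * q ^ k) (M * / (1 - q)))
      as [l Hl].
    - intros k. rewrite Cmod_mult, Cmod_pow.
      assert (Eq : Cmod z ^ k = q ^ k * r ^ k).
      { rewrite <- Rpow_mult_distr. f_equal. unfold q. field. unfold r; lra. }
      rewrite Eq, (Rmult_comm (q ^ k)), <- Rmult_assoc.
      apply Rmult_le_compat_r; [apply pow_le; lra|apply HM].
    - intros n. rewrite rsum_scal. apply Rmult_le_compat_l; [|apply geom_sum, Hq].
      eapply Rle_trans; [|apply (HM 0%nat)]. apply Rmult_le_pos; [apply Cmod_ge_0|simpl; lra].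
    - exists l. auto. }
  exists (fun z => proj1_sig (constructive_indefinite_description _ (H z))).
  intros z Hz. destruct (constructive_indefinite_description _ (H z)) as [l Hl]. auto.
Qed.

Definition dcoef (a : nat -> C) (k : nat) : C := (RtoC (INR (S k)) * a (S k))%C.

Lemma PSb_dcoef (a : nat -> C) : PSb a -> PSb (dcoef a).
Proof.
  intros Ha r Hr. destruct (PSb_deriv_sum a r Ha Hr) as [B HB]. exists B.
  intros k. eapply Rle_trans; [|apply (HB (S (S k)))].
  eapply Rle_trans; [|apply rsum_ge_term].
  - unfold dcoef. rewrite Cmod_mult, Cmod_R, Rabs_pos_eq by apply pos_INR. simpl pred. lra.
  - intros i. apply Rmult_le_pos; [apply Cmod_ge_0|].
    apply Rmult_le_pos; [apply pos_INR|apply pow_le; lra].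
Qed.

Lemma PS_calculus (a : nat -> C) (f : C -> C) : PSb a -> PS a f ->
  (forall rho, 0 < rho < 1 -> exists L, forall w w', Cmod w < rho -> Cmod w' < rho ->
     Cmod (f w - f w') <= L * Cmod (w - w')) /\
  exists g, PS (dcoef a) g /\ forall z, in_D z -> Cder f z (g z).
Proof.
  intros Ha Hf.
  assert (Hmain : forall rho, 0 < rho < 1 -> exists B,
    (forall w w', Cmod w < rho -> Cmod w' < rho -> Cmod (f w - f w') <= B * Cmod (w - w')) /\
    forall z d, Cmod z < rho -> (forall k, Cder (fun w => a k * Cpow w k)%C z (d k)) ->
      exists l, Cconv (csum d) l /\ Cder f z l).
  { intros rho Hr. destruct (PSb_deriv_sum a rho Ha Hr) as [B HB]. exists B.
    apply (series_Cder (fun k w => a k * Cpow w k)%C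
            (fun k => Cmod (a k) * (INR k * rho ^ pred k)) f rho B); auto.
    - intros k w w' Hw Hw'.
      replace (a k * Cpow w k - a k * Cpow w' k)%C with (a k * (Cpow w k - Cpow w' k))%C by ring.
      rewrite Cmod_mult, Rmult_assoc. apply Rmult_le_compat_l; [apply Cmod_ge_0|].
      apply pow_lipschitz; lra.
    - intros k. apply Rmult_le_pos; [apply Cmod_ge_0|].
      apply Rmult_le_pos; [apply pos_INR|apply pow_le; lra].
    - intros w Hw. apply Hf. unfold in_D. lra. }
  split.
  { intros rho Hr. destruct (Hmain rho Hr) as [B [HB _]]. exists B. exact HB. }
  destruct (PSb_conv _ (PSb_dcoef _ Ha)) as [g Hg]. exists g. split; [exact Hg|].
  intros z Hz. unfold in_D in Hz. assert (P := Cmod_ge_0 z).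
  destruct (Hmain ((1 + Cmod z) / 2) ltac:(lra)) as [B [_ H]].
  destruct (H z (fun k => a k * (RtoC (INR k) * Cpow z (pred k)))%C ltac:(lra)) as [l [Hl Hd]].
  { intros k. apply Cder_scal, Cder_pow. }
  replace (g z) with l; [exact Hd|]. apply Cconv_unique with (2 := Hg z Hz).
  (* The derivative of the constant term vanishes, so the series for [dcoef] is the differentiated
     series with its first term dropped. *)
  apply Cconv_ext with
    (fun n => csum (fun k => a k * (RtoC (INR k) * Cpow z (pred k)))%C (S n)).
  - intros n. rewrite csum_shift. simpl pred. change (INR 0) with 0.
    replace (a 0%nat * (0 * Cpow z 0))%C with (RtoC 0) by ring.
    rewrite Cplus_0_l. apply csum_ext. intros k. unfold dcoef. ring.
  - apply (Cconv_subseq _ _ S); [|exact Hl]. intros n0. exists n0. lia.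
Qed.


(** * Taylor coefficients of analytic functions *)

Lemma Rcont_bounded (f : R -> C) (a b : R) : a <= b ->
  (forall t, a <= t <= b -> Rcont f t) -> exists M, forall t, a <= t <= b -> Cmod (f t) <= M.
Proof.
  intros Hab H.
  destruct (continuity_ab_maj (fun t => Cmod (f t)) a b Hab) as [m [Hm _]].
  - intros t Ht e He. destruct (H t Ht e He) as [d [Hd Hu]].
    exists d. split; [exact Hd|]. intros u [_ Hut]. simpl in *. unfold Rdist in *.
    eapply Rle_lt_trans; [|apply (Hu u Hut)].
    assert (T1 := Cmod_le_add (f u) (f t)). assert (T2 := Cmod_le_add (f t) (f u)).
    rewrite Cmod_minus_sym in T2. apply Rabs_le. lra.
  - exists (Cmod (f m)). exact Hm.
Qed.

(** Cauchy's integral for the Taylor coefficient, with [dw / (Ci * w)] replaced by [dt] on the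
    circle. *)
Definition coef (f : C -> C) (r : R) (n : nat) : C :=
  (/ RtoC (2 * PI) * mean (fun w => f w * Cpow (/ w) n) r)%C.

Lemma RtoC_2PI_nz : RtoC (2 * PI) <> RtoC 0.
Proof. intros E. apply RtoC_inj in E. generalize PI2_pos. lra. Qed.

Lemma mean_ext (f g : C -> C) (r : R) : 0 <= r ->
  (forall w, Cmod w = r -> f w = g w) -> mean f r = mean g r.
Proof.
  intros Hr H. apply Cint_ext; [generalize PI2_pos; lra|]. intros t _.
  apply H, Cmod_circ, Hr.
Qed.

Lemma analytic_cont (f : C -> C) (w : C) : analytic f -> in_D w -> Ccont f w.
Proof.
  intros H Hw. destruct (proj1 (analytic_Cder f) H w Hw) as [c Hc]. eapply Cder_Ccont, Hc.
Qed.

Lemma Ccont_pow_inv (w : C) (n : nat) : w <> RtoC 0 -> Ccont (fun w => Cpow (/ w) n) w.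
Proof.
  intros Hw. apply (Ccont_comp (fun w => Cpow w n) (fun w => / w)%C).
  - eapply Cder_Ccont, Cder_pow.
  - apply Ccont_inv; [exact Hw|apply Ccont_id].
Qed.

Lemma coef_indep (f : C -> C) (r s : R) (n : nat) : analytic f ->
  0 < r < 1 -> 0 < s < 1 -> coef f r n = coef f s n.
Proof.
  intros Hf.
  assert (K : forall r s, 0 < r < 1 -> 0 < s < 1 -> r <= s -> coef f r n = coef f s n).
  { intros r' s' Hr Hs Hrs. unfold coef. f_equal. apply mean_annulus; [lra|exact Hrs|].
    intros w Hw. assert (Hw0 : w <> RtoC 0) by (intros E; rewrite E, Cmod_0 in Hw; lra).
    destruct (proj1 (analytic_Cder f) Hf w) as [c Hc]; [unfold in_D; lra|].
    eexists. apply Cder_mult; [exact Hc|].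
    apply (Cder_comp (fun w => Cpow w n) (fun w => / w)%C); [apply Cder_pow|].
    apply Cder_inv; [exact Hw0|apply Cder_id]. }
  intros Hr Hs. destruct (Rle_dec r s) as [h|h]; [apply K; assumption|].
  symmetry. apply K; auto; lra.
Qed.

Lemma analytic_circ_bounded (f : C -> C) (r : R) : analytic f -> 0 <= r < 1 ->
  exists M, forall w, Cmod w = r -> Cmod (f w) <= M.
Proof.
  intros Hf Hr.
  assert (Hc : forall w, Cmod w = r -> Ccont f w)
    by (intros w Hw; apply analytic_cont; [exact Hf|unfold in_D; lra]).
  (* Negative angles are included because the lower half circle is reached below by the opposite of
     [acos]. *)
  destruct (Rcont_bounded (fun t => f (circ r t)) (- (2 * PI)) (2 * PI)) as [M HM].
  { generalize PI2_pos; lra. }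
  { intros t _. apply Ccont_circ; [lra|]. apply Hc, Cmod_circ; lra. }
  exists M. intros w Hw. destruct (Req_dec r 0) as [E|n].
  - specialize (HM 0 ltac:(generalize PI2_pos; lra)).
    rewrite E in *. apply Cmod_eq_0 in Hw. rewrite Hw.
    replace (RtoC 0) with (circ 0 0); [exact HM|]. unfold circ, RtoC. f_equal; ring.
  - assert (Hxy : Re w / r * (Re w / r) + Im w / r * (Im w / r) = 1).
    { assert (E := Cmod2_alt w). rewrite Hw in E.
      replace (Re w / r * (Re w / r) + Im w / r * (Im w / r))
        with ((Re w ^ 2 + Im w ^ 2) / r ^ 2) by (field; lra).
      rewrite <- E. field. lra. }
    assert (Hx : -1 <= Re w / r <= 1) by nra.
    assert (P1 := acos_bound (Re w / r)).
    assert (Hs : sin (acos (Re w / r)) = sqrt (1 - (Re w / r)²)) by (apply sin_acos; exact Hx).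
    replace (1 - (Re w / r)²) with (Rsqr (Im w / r)) in Hs by (unfold Rsqr; lra).
    rewrite sqrt_Rsqr_abs in Hs.
    assert (Hcs := cos_acos _ Hx).
    destruct (Rle_dec 0 (Im w / r)) as [h|h].
    + rewrite Rabs_pos_eq in Hs by exact h.
      replace w with (circ r (acos (Re w / r))); [apply HM; generalize PI2_pos; lra|].
      unfold circ. rewrite Hcs, Hs. destruct w as [x y]; simpl. f_equal; field; lra.
    + rewrite Rabs_left in Hs by lra.
      replace w with (circ r (- acos (Re w / r))); [apply HM; generalize PI2_pos; lra|].
      unfold circ. rewrite cos_neg, sin_neg, Hcs, Hs.
      destruct w as [x y]; simpl. f_equal; field; lra.
Qed.

Lemma mean_bound (g : C -> C) (r M : R) : 0 <= r ->
  (forall w, Cmod w = r -> Ccont g w) -> (forall w, Cmod w = r -> Cmod (g w) <= M) ->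
  Cmod (mean g r) <= 2 * PI * M.
Proof.
  intros Hr Hc HM. replace (2 * PI * M) with ((2 * PI - 0) * M) by ring.
  apply Cint_bound; [generalize PI2_pos; lra|apply Cex_circ; assumption|].
  intros t _. apply HM, Cmod_circ, Hr.
Qed.

Lemma coef_bound (f : C -> C) (r M : R) (n : nat) : analytic f -> 0 < r < 1 ->
  (forall w, Cmod w = r -> Cmod (f w) <= M) -> Cmod (coef f r n) * r ^ n <= M.
Proof.
  intros Hf Hr HM. unfold coef. assert (P := PI2_pos).
  assert (Hrn : 0 < r ^ n) by (apply pow_lt; lra).
  rewrite Cmod_mult, Cmod_inv, Cmod_R, Rabs_pos_eq; [|lra|apply RtoC_2PI_nz].
  assert (K : Cmod (mean (fun w => f w * Cpow (/ w) n)%C r) <= 2 * PI * (M / r ^ n)).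
  { apply mean_bound; [lra| |].
    - intros w Hw. apply Ccont_mult.
      + apply analytic_cont; [exact Hf|unfold in_D; lra].
      + apply Ccont_pow_inv. intros E; rewrite E, Cmod_0 in Hw; lra.
    - intros w Hw. rewrite Cmod_mult, Cmod_pow, Cmod_inv, Hw, pow_inv.
      + apply Rmult_le_compat_r; [left; apply Rinv_0_lt_compat, Hrn|]. apply HM, Hw.
      + intros E; rewrite E, Cmod_0 in Hw; lra. }
  apply Rle_trans with (/ (2 * PI) * (2 * PI * (M / r ^ n)) * r ^ n).
  - apply Rmult_le_compat_r; [lra|]. apply Rmult_le_compat_l; [|exact K].
    left. apply Rinv_0_lt_compat. lra.
  - right. field. lra.
Qed.

Lemma mean_csum (h : C -> C) (z : C) (r : R) (n : nat) : 0 < r ->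
  (forall w, Cmod w = r -> Ccont h w) ->
  mean (fun w => csum (fun k => Cpow z k * (h w * Cpow (/ w) k))%C n) r
  = csum (fun k => Cpow z k * mean (fun w => h w * Cpow (/ w) k) r)%C n
  /\ Cex (fun t => csum (fun k => Cpow z k * (h (circ r t) * Cpow (/ circ r t) k))%C n) 0 (2 * PI).
Proof.
  intros Hr Hh.
  assert (Hc : forall k, Cex (fun t => h (circ r t) * Cpow (/ circ r t) k)%C 0 (2 * PI)).
  { intros k. apply (Cex_circ (fun w => h w * Cpow (/ w) k)%C); [lra|].
    intros w Hw. apply Ccont_mult; [auto|]. apply Ccont_pow_inv.
    intros E; rewrite E, Cmod_0 in Hw; lra. }
  induction n as [|n [IH1 IH2]].
  - simpl. split; [|apply Cex_const]. unfold mean. rewrite Cint_const. ring.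
  - simpl csum. split.
    + rewrite <- IH1. unfold mean. rewrite Cint_plus; [|exact IH2|apply Cex_scal, Hc].
      f_equal. apply Cint_scal, Hc.
    + apply (Cex_plus _ _ _ _ IH2). apply Cex_scal, Hc.
Qed.

Lemma geom_kernel (z w : C) (n : nat) : w <> RtoC 0 -> w <> z ->
  (csum (fun k => Cpow z k * ((w - z) * Cpow (/ w) k)) n = w * (1 - Cpow (z / w) n))%C.
Proof.
  intros H0 Hz. induction n as [|n IH]; simpl csum.
  - simpl. ring.
  - rewrite IH. unfold Cdiv. rewrite !Cpow_mult_l, !Cpow_S. field. exact H0.
Qed.

(* The kernel w (f w - f z) / (w - z) has vanishing mean; expand it in
   powers of z / w. *)
Lemma Cauchy_coef (f : C -> C) (z : C) (r : R) : analytic f ->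
  Cmod z < r -> r < 1 ->
  exists K, 0 <= K /\ forall n, (1 <= n)%nat ->
    Cmod (csum (fun k => coef f r k * Cpow z k)%C n - f z) <= K * (Cmod z / r) ^ n.
Proof.
  intros Hf Hz Hr. assert (P := Cmod_ge_0 z). assert (P2 := PI2_pos).
  assert (HzD : in_D z) by (unfold in_D; lra).
  destruct (proj1 (analytic_Cder f) Hf z HzD) as [c [phi [Hphi [_ Hfz]]]].
  assert (Hw0 : forall w, Cmod w = r -> w <> RtoC 0)
    by (intros w Hw E; rewrite E, Cmod_0 in Hw; lra).
  assert (Hwz : forall w, Cmod w = r -> w <> z) by (intros w Hw E; rewrite E in Hw; lra).
  (* [phi] is the difference quotient of [f] at [z], completed continuously at [z]. *)
  assert (Hpc : forall w, in_D w -> w <> z -> exists c, Cder phi w c).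
  { intros w Hw Hn. destruct (proj1 (analytic_Cder f) Hf w Hw) as [c' Hc'].
    eexists. apply Cder_ext_loc with (fun v => (f v - f z) / (v - z))%C.
    - exists (Cmod (w - z)). split; [apply Cmod_pos, Cminus_nz, Hn|].
      intros v Hv. assert (v <> z).
      { intros ->. rewrite (Cmod_minus_sym z w) in Hv. lra. }
      rewrite (Hfz v). field. apply Cminus_nz; assumption.
    - apply Cder_div; [apply Cminus_nz, Hn| |].
      + apply Cder_minus; [exact Hc'|apply Cder_const].
      + apply Cder_minus; [apply Cder_id|apply Cder_const]. }
  assert (Hpcont : forall w, in_D w -> Ccont phi w).
  { intros w Hw. destruct (Classical_Prop.classic (w = z)) as [->|Hn]; [exact Hphi|].
    destruct (Hpc w Hw Hn) as [c' Hc']. eapply Cder_Ccont, Hc'. }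
  (* The exceptional circle is the one through [z]; the factor [w] makes the value at the centre
     vanish. *)
  assert (Hm : mean (fun w => w * phi w)%C r = RtoC 0).
  { rewrite (mean_value _ (Cmod z)); [ring|lra| |].
    - intros w Hw. apply Ccont_mult; [apply Ccont_id|auto].
    - intros w Hw _ Hn. destruct (Hpc w Hw) as [c' Hc']; [congruence|].
      eexists. apply Cder_mult; [apply Cder_id|exact Hc']. }
  assert (Hcr : forall w, Cmod w = r -> Ccont phi w)
    by (intros w Hw; apply Hpcont; unfold in_D; lra).
  destruct (Rcont_bounded (fun t => phi (circ r t)) 0 (2 * PI)) as [M HM]; [lra| |].
  { intros t _. apply Ccont_circ; [lra|]. apply Hcr, Cmod_circ; lra. }
  assert (HM0 : 0 <= M) by (eapply Rle_trans; [apply Cmod_ge_0|apply (HM 0); lra]).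
  exists (r * M). split; [apply Rmult_le_pos; lra|].
  intros n Hn.
  set (h := fun w => (f w - f z)%C).
  assert (Hh : forall w, Cmod w = r -> Ccont h w).
  { intros w Hw. assert (Hwd : in_D w) by (unfold in_D; lra).
    apply (Ccont_ext_loc (fun w => f w + - f z)%C).
    { exists 1. split; [lra|]. reflexivity. }
    apply Ccont_plus; [apply analytic_cont; assumption|apply Ccont_const]. }
  destruct (mean_csum h z r n ltac:(lra) Hh) as [E _].
  assert (E1 : mean (fun w => csum (fun k => Cpow z k * (h w * Cpow (/ w) k))%C n) r
    = (- mean (fun w => w * phi w * Cpow (z / w) n) r)%C).
  { rewrite (mean_ext _ (fun w => w * phi w - w * phi w * Cpow (z / w) n)%C).
    - unfold mean at 1. rewrite Cint_minus.
      + change (Cint (fun t => circ r t * phi (circ r t))%C 0 (2 * PI)) with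
          (mean (fun w => w * phi w)%C r).
        rewrite Hm. unfold mean. ring.
      + apply (Cex_circ (fun w => w * phi w)%C); [lra|]. intros w Hw.
        apply Ccont_mult; [apply Ccont_id|auto].
      + apply (Cex_circ (fun w => w * phi w * Cpow (z / w) n)%C); [lra|]. intros w Hw.
        apply Ccont_mult; [apply Ccont_mult; [apply Ccont_id|auto]|].
        apply (Ccont_comp (fun w => Cpow w n) (fun w => z / w)%C).
        * eapply Cder_Ccont, Cder_pow.
        * apply Ccont_mult; [apply Ccont_const|].
          apply Ccont_inv; [apply Hw0, Hw|apply Ccont_id].
    - lra.
    - intros w Hw.
      rewrite (csum_ext _ (fun k => phi w * (Cpow z k * ((w - z) * Cpow (/ w) k)))%C).
      + rewrite csum_scal, geom_kernel; auto. ring.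
      + intros k. unfold h. rewrite (Hfz w). ring. }
  rewrite E1 in E. clear E1.
  assert (E2 : csum (fun k => Cpow z k * mean (fun w => h w * Cpow (/ w) k) r)%C n
    = (RtoC (2 * PI) * (csum (fun k => coef f r k * Cpow z k) n - f z))%C).
  { assert (E3 : forall k, (mean (fun w => h w * Cpow (/ w) k) r
      = RtoC (2 * PI) * coef f r k - f z * mean (fun w => Cpow (/ w) k) r)%C).
    { intros k. unfold coef.
      replace (RtoC (2 * PI) * (/ RtoC (2 * PI) * mean (fun w => f w * Cpow (/ w) k) r))%C
        with (mean (fun w => f w * Cpow (/ w) k)%C r) by (field; apply RtoC_2PI_nz).
      assert (X1 : Cex (fun t => f (circ r t) * Cpow (/ circ r t) k)%C 0 (2 * PI)).
      { apply (Cex_circ (fun w => f w * Cpow (/ w) k)%C); [lra|]. intros w Hw.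
        apply Ccont_mult; [apply analytic_cont; [exact Hf|unfold in_D; lra]|].
        apply Ccont_pow_inv; auto. }
      assert (X2 : Cex (fun t => Cpow (/ circ r t) k)%C 0 (2 * PI)).
      { apply (Cex_circ (fun w => Cpow (/ w) k)%C); [lra|]. intros w Hw.
        apply Ccont_pow_inv; auto. }
      unfold mean. rewrite <- Cint_scal by exact X2.
      rewrite <- Cint_minus; [|exact X1|apply Cex_scal, X2].
      apply Cint_ext; [lra|]. intros t _. unfold h. ring. }
    assert (E0 : mean (fun w => Cpow (/ w) 0) r = RtoC (2 * PI)).
    { unfold mean. simpl. rewrite Cint_const.
      replace (2 * PI - 0) with (2 * PI) by ring. ring. }
    (* The mean of [(/ w) ^ k] vanishes except at [k = 0]; that term yields [- f z], so at least one
       term must be present. *)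
    destruct n as [|n]; [lia|]. rewrite !csum_shift, E3, E0.
    rewrite (csum_ext _ (fun k => RtoC (2 * PI) * (coef f r (S k) * Cpow z (S k)))%C).
    - rewrite csum_scal. simpl Cpow. ring.
    - intros k. rewrite E3, mean_inv_pow by (lra || lia). ring. }
  rewrite E2 in E. clear E2.
  assert (Hb : Cmod (mean (fun w => w * phi w * Cpow (z / w) n)%C r)
    <= 2 * PI * (r * M * (Cmod z / r) ^ n)).
  { replace (2 * PI * (r * M * (Cmod z / r) ^ n))
      with ((2 * PI - 0) * (r * M * (Cmod z / r) ^ n)) by ring.
    apply Cint_bound; [lra| |].
    - apply (Cex_circ (fun w => w * phi w * Cpow (z / w) n)%C); [lra|]. intros w Hw.
      apply Ccont_mult; [apply Ccont_mult; [apply Ccont_id|auto]|].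
      apply (Ccont_comp (fun w => Cpow w n) (fun w => z / w)%C).
      + eapply Cder_Ccont, Cder_pow.
      + apply Ccont_mult; [apply Ccont_const|].
        apply Ccont_inv; [apply Hw0, Hw|apply Ccont_id].
    - intros t Ht. assert (Hcm : Cmod (circ r t) = r) by (apply Cmod_circ; lra).
      rewrite !Cmod_mult, Cmod_pow, Cmod_div, Hcm by (apply Hw0, Hcm).
      apply Rmult_le_compat_r; [apply pow_le, Rle_div_r; lra|].
      apply Rmult_le_compat_l; [lra|]. apply HM, Ht. }
  rewrite <- Cmod_opp, E, Cmod_mult, Cmod_R, Rabs_pos_eq in Hb by lra.
  apply Rmult_le_reg_l with (2 * PI); [exact P2|exact Hb].
Qed.

(** The radius 1/2 is arbitrary: by [coef_indep] the coefficients are moved to whichever radius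
    suits, [r] for the bound and one beyond [Cmod z] for the convergence. *)
Lemma analytic_PS (f : C -> C) : analytic f -> PSb (coef f (1 / 2)) /\ PS (coef f (1 / 2)) f.
Proof.
  intros Hf. split.
  - intros r Hr. destruct (analytic_circ_bounded f r Hf ltac:(lra)) as [M HM].
    exists M. intros k. rewrite (coef_indep f (1 / 2) r) by (assumption || lra).
    apply coef_bound; assumption.
  - intros z Hz. unfold in_D in Hz. assert (P := Cmod_ge_0 z).
    set (r := (1 + Cmod z) / 2).
    destruct (Cauchy_coef f z r Hf ltac:(unfold r; lra) ltac:(unfold r; lra))
      as [K [HK H]].
    assert (Hq : 0 <= Cmod z / r < 1).
    { unfold r. split; [apply Rle_div_r; lra|]. apply Rlt_div_l; lra. }
    intros e He.
    destruct (pow_lt_1_zero (Cmod z / r) ltac:(rewrite Rabs_pos_eq; lra) (e / (K + 1)))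
      as [n0 Hn0]; [apply Rdiv_lt_0_compat; lra|].
    exists (S n0). intros n Hn. specialize (Hn0 n ltac:(lia)).
    rewrite Rabs_pos_eq in Hn0 by (apply pow_le; lra).
    rewrite (csum_ext _ (fun k => coef f r k * Cpow z k)%C).
    2:{ intros k. f_equal. apply coef_indep; [exact Hf|lra|unfold r; lra]. }
    eapply Rle_lt_trans; [apply H; lia|].
    apply Rlt_div_r in Hn0; [|lra].
    assert (0 <= (Cmod z / r) ^ n) by (apply pow_le; lra). lra.
Qed.


(** * Logarithms and the Borel-Caratheodory estimate *)

Lemma in_D_0 : in_D (RtoC 0).
Proof. unfold in_D. rewrite Cmod_0. lra. Qed.

Lemma PS_analytic (a : nat -> C) (f : C -> C) : PSb a -> PS a f -> analytic f.
Proof.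
  intros Ha Hf. destruct (PS_calculus a f Ha Hf) as [_ [g [_ Hg]]].
  apply analytic_Cder. intros z Hz. exists (g z). auto.
Qed.

Lemma analytic_derivative (f : C -> C) : analytic f ->
  exists g, analytic g /\ forall z, in_D z -> Cder f z (g z).
Proof.
  intros Hf. destruct (analytic_PS f Hf) as [Ha Hs].
  destruct (PS_calculus _ f Ha Hs) as [_ [g [Hg Hd]]]. exists g. split; [|exact Hd].
  apply PS_analytic with (2 := Hg). apply PSb_dcoef, Ha.
Qed.

Lemma analytic_lipschitz (f : C -> C) (rho : R) : analytic f -> 0 < rho < 1 ->
  exists L, forall w w', Cmod w < rho -> Cmod w' < rho -> Cmod (f w - f w') <= L * Cmod (w - w').
Proof.
  intros Hf. destruct (analytic_PS f Hf) as [Ha Hs].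
  apply (PS_calculus _ f Ha Hs).
Qed.

Lemma PS_0 (a : nat -> C) (f : C -> C) : PS a f -> f (RtoC 0) = a 0%nat.
Proof.
  intros Hf. apply Cconv_unique with (1 := Hf _ in_D_0). intros e He. exists 1%nat.
  intros [|n] Hn; [lia|]. rewrite csum_shift.
  replace (csum (fun k => a (S k) * Cpow 0 (S k))%C n) with (RtoC 0).
  - simpl. replace (_ - _)%C with (RtoC 0) by ring. rewrite Cmod_0. exact He.
  - clear. induction n as [|n IH]; cbn [csum]; [reflexivity|]. rewrite <- IH, Cpow_S. ring.
Qed.

Lemma analytic_primitive (h : C -> C) : analytic h ->
  exists F, F (RtoC 0) = RtoC 0 /\ forall z, in_D z -> Cder F z (h z).
Proof.
  intros Hh. destruct (analytic_PS h Hh) as [Hb Hs]. set (b := coef h (1 / 2)) in *.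
  set (c := fun k => match k with O => RtoC 0 | S k => (/ RtoC (INR (S k)) * b k)%C end).
  assert (Hn : forall k, RtoC (INR (S k)) <> RtoC 0).
  { intros k E. apply RtoC_inj in E. generalize (pos_INR k). rewrite S_INR in E. lra. }
  assert (Hc : PSb c).
  { intros r Hr. destruct (Hb r Hr) as [M HM]. exists M.
    assert (HM0 : 0 <= M).
    { eapply Rle_trans; [|apply (HM 0%nat)]. apply Rmult_le_pos; [apply Cmod_ge_0|simpl; lra]. }
    intros [|k]; unfold c; [rewrite Cmod_0, Rmult_0_l; exact HM0|].
    eapply Rle_trans; [|apply (HM k)].
    rewrite Cmod_mult, Cmod_inv, Cmod_R by apply Hn.
    rewrite Rabs_pos_eq by apply pos_INR.
    apply Rmult_le_compat.
    - apply Rmult_le_pos; [|apply Cmod_ge_0]. left. apply Rinv_0_lt_compat, lt_0_INR. lia.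
    - apply pow_le; lra.
    - rewrite <- (Rmult_1_l (Cmod (b k))) at 2. apply Rmult_le_compat_r; [apply Cmod_ge_0|].
      rewrite <- Rinv_1. apply Rinv_le_contravar; [lra|]. rewrite S_INR.
      generalize (pos_INR k). lra.
    - simpl. rewrite <- (Rmult_1_l (r ^ k)) at 2. apply Rmult_le_compat_r; [apply pow_le|]; lra. }
  destruct (PSb_conv c Hc) as [F HF].
  destruct (PS_calculus c F Hc HF) as [_ [g [Hg Hd]]].
  exists F. split; [apply (PS_0 c F HF)|].
  intros z Hz. replace (h z) with (g z); [auto|].
  apply Cconv_unique with (1 := Hg z Hz).
  apply Cconv_ext with (2 := Hs z Hz). intros n. apply csum_ext. intros k.
  unfold dcoef, c. field. apply Hn.
Qed.

(** On the segment from 0 to [z], which stays in the disc, [f] is a function of one real variable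
    with zero derivative. *)
Lemma Cder_zero_const (f : C -> C) :
  (forall z, in_D z -> Cder f z (RtoC 0)) -> forall z, in_D z -> f z = f (RtoC 0).
Proof.
  intros H z Hz.
  assert (E : f (RtoC 1 * z)%C = f (RtoC 0 * z)%C).
  { symmetry. apply (@eq_is_derive C_R_NormedModule (fun t => f (RtoC t * z)%C) 0 1); [|lra].
    intros t Ht. split; [apply is_linear_scal_l|].
    intros x Hx e.
    assert (E := @is_filter_lim_locally_unique _ (AbsRing_NormedModule R_AbsRing) t x Hx).
    subst x.
    assert (Htz : in_D (RtoC t * z)%C).
    { unfold in_D in *. rewrite Cmod_mult, Cmod_R, Rabs_pos_eq by lra.
      apply Rle_lt_trans with (1 * Cmod z); [|lra].
      apply Rmult_le_compat_r; [apply Cmod_ge_0|lra]. }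
    destruct (Cder_eps _ _ _ (H _ Htz) e (cond_pos e)) as [d [Hd Hw]].
    exists (mkposreal d Hd). intros u Hu. change (Rabs (u - t) < d) in Hu.
    assert (Es : Cmod (RtoC u * z - RtoC t * z) <= Rabs (u - t)).
    { replace (RtoC u * z - RtoC t * z)%C with (RtoC (u - t) * z)%C
        by (rewrite RtoC_minus; ring).
      rewrite Cmod_mult, Cmod_R. rewrite <- (Rmult_1_r (Rabs (u - t))) at 2.
      apply Rmult_le_compat_l; [apply Rabs_pos|unfold in_D in Hz; lra]. }
    specialize (Hw (RtoC u * z)%C ltac:(lra)).
    rewrite norm_Cmod.
    assert (Ez := @scal_zero_r R_AbsRing C_R_NormedModule (u - t)).
    change (Cmod (f (RtoC u * z)%C - f (RtoC t * z)%C -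
      (@scal R_AbsRing C_R_NormedModule (u - t) zero : C)) <= e * Rabs (u - t)).
    rewrite Ez.
    change (Cmod (f (RtoC u * z)%C - f (RtoC t * z)%C - RtoC 0) <= e * Rabs (u - t)).
    replace (f (RtoC u * z) - f (RtoC t * z) - RtoC 0)%C with
      (f (RtoC u * z) - f (RtoC t * z) - 0 * (RtoC u * z - RtoC t * z))%C by ring.
    eapply Rle_trans; [exact Hw|]. apply Rmult_le_compat_l; [left; apply cond_pos|exact Es]. }
  rewrite Cmult_1_l, Cmult_0_l in E. exact E.
Qed.

(** [F] is the primitive of the logarithmic derivative that vanishes at 0; then [f] times the
    exponential of [- F] has zero derivative. *)
Lemma analytic_log (f : C -> C) : analytic f -> zero_free f -> f (RtoC 0) = RtoC 1 ->
  exists F, analytic F /\ F (RtoC 0) = RtoC 0 /\ forall z, in_D z -> f z = Cexp (F z).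
Proof.
  intros Hf Hz H1. destruct (analytic_derivative f Hf) as [g [Hg Hd]].
  assert (Hh : analytic (fun z => g z / f z)%C).
  { apply analytic_Cder. intros z HzD.
    destruct (proj1 (analytic_Cder g) Hg z HzD) as [c Hc].
    eexists. apply Cder_div; [apply Hz, HzD|exact Hc|apply Hd, HzD]. }
  destruct (analytic_primitive _ Hh) as [F [HF0 HF]]. exists F.
  split; [|split; [exact HF0|]].
  { apply analytic_Cder. intros z HzD. eexists. apply HF, HzD. }
  assert (K : forall z, in_D z -> (f z * Cexp (- (1) * F z))%C = RtoC 1).
  { intros z HzD. rewrite (Cder_zero_const (fun z => f z * Cexp (- (1) * F z))%C); auto.
    - rewrite H1, HF0. replace (- (1) * 0)%C with (RtoC 0) by ring. rewrite Cexp_0. ring.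
    - intros w Hw.
      assert (K := Cder_mult _ _ _ _ _ (Hd w Hw)
        (Cder_comp Cexp (fun z => - (1) * F z)%C w _ _ (Cder_Cexp _)
          (Cder_scal (- (1))%C _ _ _ (HF w Hw)))).
      refine (Cder_eq _ _ _ _ _ K). field. apply Hz, Hw. }
  intros z HzD. specialize (K z HzD).
  replace (- (1) * F z)%C with (- F z)%C in K by ring. rewrite Cexp_opp in K.
  replace (f z) with ((f z * / Cexp (F z)) * Cexp (F z))%C
    by (field; apply Cexp_nz).
  rewrite K. ring.
Qed.

Lemma pow_to_1_le (x y : R) (n : nat) :
  0 <= x -> (forall r, 0 < r < 1 -> x * r ^ n <= y) -> x <= y.
Proof.
  intros Hx H. apply Rnot_lt_le. intros Hlt.
  set (N := INR n + 1). assert (HN : 1 <= N) by (unfold N; generalize (pos_INR n); lra).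
  (* By Bernoulli's inequality [x * (1 - u) ^ n] is at least [x - x * n * u], and this [u] makes the
     loss at most half of [x - y]. *)
  set (u := (x - y) / (2 * (x + 1) * N)).
  assert (Hy : 0 <= y).
  { eapply Rle_trans; [|apply (H (1 / 2)); lra]. apply Rmult_le_pos; [lra|apply pow_le; lra]. }
  assert (Hp : 0 < 2 * (x + 1) * N) by (repeat apply Rmult_lt_0_compat; lra).
  assert (Hu : 0 < u) by (apply Rdiv_lt_0_compat; lra).
  assert (Hu1 : u < 1).
  { apply Rlt_div_l; [exact Hp|]. rewrite Rmult_1_l.
    apply Rlt_le_trans with (2 * (x + 1) * 1); [lra|]. apply Rmult_le_compat_l; lra. }
  assert (Hb : 1 - INR n * u <= (1 - u) ^ n).
  { clearbody u. clear - Hu Hu1. induction n as [|n IH]; [simpl; lra|]. rewrite S_INR. simpl.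
    apply Rle_trans with ((1 - u) * (1 - INR n * u)); [|apply Rmult_le_compat_l; lra].
    assert (0 <= INR n * u * u); [|lra].
    repeat apply Rmult_le_pos; try lra. apply pos_INR. }
  specialize (H (1 - u) ltac:(lra)).
  assert (Hm : x * (1 - INR n * u) <= x * (1 - u) ^ n) by (apply Rmult_le_compat_l; lra).
  assert (E : (x + 1) * N * u = (x - y) / 2) by (unfold u; field; split; lra).
  assert (x * INR n * u <= (x + 1) * N * u).
  { apply Rmult_le_compat_r; [lra|]. apply Rmult_le_compat; try lra; [apply pos_INR|].
    unfold N; lra. }
  lra.
Qed.

(* The n-th coefficient also represents [2 Re F], since the conjugate of F has
   no coefficient there; and [A - Re F] is nonnegative with mean A. *)
Lemma coef_Re_bound (F : C -> C) (A r : R) (n : nat) : analytic F -> F (RtoC 0) = RtoC 0 ->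
  (forall z, in_D z -> Re (F z) <= A) -> 0 < r < 1 -> (1 <= n)%nat ->
  Cmod (coef F r n) * r ^ n <= 2 * A.
Proof.
  intros HF HF0 HA Hr Hn. assert (P := PI2_pos).
  assert (Hw0 : forall w, Cmod w = r -> w <> RtoC 0)
    by (intros w Hw E; rewrite E, Cmod_0 in Hw; lra).
  assert (HFc : forall w, Cmod w = r -> Ccont F w)
    by (intros w Hw; apply analytic_cont; [exact HF|unfold in_D; lra]).
  assert (X0 : Cex (fun t => F (circ r t)) 0 (2 * PI)) by (apply Cex_circ; auto; lra).
  assert (X1 : Cex (fun t => F (circ r t) * Cpow (/ circ r t) n)%C 0 (2 * PI)).
  { apply (Cex_circ (fun w => F w * Cpow (/ w) n)%C); [lra|]. intros w Hw.
    apply Ccont_mult; [auto|]. apply Ccont_pow_inv; auto. }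
  assert (X2 : Cex (fun t => Cpow (/ circ r t) n)%C 0 (2 * PI)).
  { apply (Cex_circ (fun w => Cpow (/ w) n)%C); [lra|]. intros w Hw.
    apply Ccont_pow_inv; auto. }
  assert (X3 : Cex (fun t => Cconj (F (circ r t)) * Cpow (/ circ r t) n)%C 0 (2 * PI)).
  { apply (Cex_circ (fun w => Cconj (F w) * Cpow (/ w) n)%C); [lra|]. intros w Hw.
    apply Ccont_mult; [|apply Ccont_pow_inv; auto].
    intros e He. destruct (HFc w Hw e He) as [d [Hd H]]. exists d. split; [exact Hd|].
    intros v Hv. rewrite <- Cminus_conj, Cmod_conj. auto. }
  set (g := fun w => (RtoC (2 * (Re (F w) - A)) * Cpow (/ w) n)%C).
  assert (Eg : forall t, g (circ r t) = (F (circ r t) * Cpow (/ circ r t) n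
     + Cconj (F (circ r t)) * Cpow (/ circ r t) n - RtoC (2 * A) * Cpow (/ circ r t) n)%C).
  { intros t. unfold g.
    replace (RtoC (2 * (Re (F (circ r t)) - A)))
      with (F (circ r t) + Cconj (F (circ r t)) - RtoC (2 * A))%C; [ring|].
    apply injective_projections; simpl; unfold Re; ring. }
  assert (Xg : Cex (fun t => g (circ r t)) 0 (2 * PI)).
  { apply (@ex_RInt_ext C_R_NormedModule) with (2 := Cex_minus _ _ _ _
      (Cex_plus _ _ _ _ X1 X3) (Cex_scal (RtoC (2 * A)) _ _ _ X2)).
    intros t _. symmetry. apply Eg. }
  assert (Em : (RtoC (2 * PI) * coef F r n)%C = mean g r).
  { unfold coef.
    replace (RtoC (2 * PI) * (/ RtoC (2 * PI) * mean (fun w => F w * Cpow (/ w) n) r))%C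
      with (mean (fun w => F w * Cpow (/ w) n)%C r) by (field; apply RtoC_2PI_nz).
    unfold mean at 2.
    rewrite (Cint_ext _ _ 0 (2 * PI) ltac:(lra) (fun t _ => Eg t)).
    rewrite Cint_minus; [|apply Cex_plus; assumption|apply Cex_scal, X2].
    rewrite Cint_plus by assumption. rewrite Cint_scal by exact X2.
    assert (E1 := mean_conj_mono F n r Hr HF Hn). assert (E2 := mean_inv_pow n r Hr Hn).
    unfold mean in *. rewrite E1, E2. ring. }
  assert (Hrn : 0 < r ^ n) by (apply pow_lt; lra).
  assert (Hre := Cint_Re _ _ _ X0).
  assert (E0 := mean_value_analytic F r ltac:(lra) HF). unfold mean in E0.
  rewrite E0, HF0 in Hre.
  replace (Re (RtoC (2 * PI) * RtoC 0)%C) with 0 in Hre by (simpl; ring).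
  assert (Hb : Cmod (mean g r) <= 2 * PI * (2 * A * / r ^ n)).
  { apply (Cint_bound_R _ (fun t => minus (2 * A * / r ^ n)
             (scal (2 * / r ^ n) (Re (F (circ r t))))));
      [lra|exact Xg| |].
    - intros t _. unfold g. assert (Hc : Cmod (circ r t) = r) by (apply Cmod_circ; lra).
      rewrite Cmod_mult, Cmod_pow, Cmod_inv, Hc, Cmod_R by (apply Hw0, Hc).
      rewrite pow_inv.
      assert (HA' : Re (F (circ r t)) <= A) by (apply HA; unfold in_D; lra).
      rewrite Rabs_left1 by lra.
      unfold minus, plus, opp, scal; simpl. unfold mult; simpl. lra.
    - replace (2 * PI * (2 * A * / r ^ n)) with
        (minus (scal (2 * PI - 0) (2 * A * / r ^ n)) (scal (2 * / r ^ n) 0)).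
      + apply (@is_RInt_minus R_NormedModule);
          [apply (@is_RInt_const R_NormedModule)|apply (@is_RInt_scal R_NormedModule), Hre].
      + unfold minus, plus, opp, scal; simpl. unfold mult; simpl. ring. }
  rewrite <- Em, Cmod_mult, Cmod_R, Rabs_pos_eq in Hb by lra.
  apply Rmult_le_reg_l in Hb; [|exact P].
  apply Rle_trans with (2 * A * / r ^ n * r ^ n); [apply Rmult_le_compat_r; lra|].
  right. field. lra.
Qed.

(** Letting [r] tend to 1 in [coef_Re_bound] bounds every coefficient of positive index by [2 * A];
    the constant one is 0, so a geometric series starting at [|z|] dominates. *)
Lemma Borel_Caratheodory (F : C -> C) (A : R) : analytic F -> F (RtoC 0) = RtoC 0 ->
  (forall z, in_D z -> Re (F z) <= A) ->
  forall z, in_D z -> Cmod (F z) <= 2 * A * (Cmod z / (1 - Cmod z)).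
Proof.
  intros HF HF0 HA z Hz. destruct (analytic_PS F HF) as [Hb Hs].
  set (a := coef F (1 / 2)) in *.
  assert (Ha0 : a 0%nat = RtoC 0) by (rewrite <- HF0; symmetry; apply PS_0, Hs).
  assert (Ha : forall n, Cmod (a (S n)) <= 2 * A).
  { intros n. apply pow_to_1_le with (S n); [apply Cmod_ge_0|]. intros r Hr. unfold a.
    rewrite (coef_indep F (1 / 2) r) by (assumption || lra).
    apply coef_Re_bound; auto. lia. }
  assert (HA0 : 0 <= 2 * A) by (eapply Rle_trans; [apply Cmod_ge_0|apply (Ha 0%nat)]).
  unfold in_D in Hz. assert (P := Cmod_ge_0 z).
  apply (dominated_bound (fun k => a k * Cpow z k)%C
    (fun k => match k with O => 0 | S k => 2 * A * Cmod z * Cmod z ^ k end)).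
  - intros [|k].
    + rewrite Ha0, Cmult_0_l, Cmod_0. lra.
    + rewrite Cmod_mult, Cmod_pow. simpl pow. rewrite Rmult_assoc.
      apply Rmult_le_compat_r; [|apply Ha]. apply Rmult_le_pos; [lra|apply pow_le; lra].
  - intros [|n].
    + simpl. apply Rmult_le_pos; [exact HA0|]. apply Rle_div_r; lra.
    + rewrite rsum_shift, rsum_scal. unfold Rdiv. rewrite Rplus_0_l, <- Rmult_assoc.
      apply Rmult_le_compat_l; [apply Rmult_le_pos; lra|]. apply geom_sum. lra.
  - apply Hs. exact Hz.
Qed.


(** * The monoid *)

(** One fold serves for products in [C] and for sums in [C] and in [R]; with [Cmult] it is
    convertible to [Psi_partial]. *)
Definition pfold {T : Type} (op : T -> T -> T) (e : T) (P : nat -> Prop)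
    (phi : nat -> T) (n : nat) : T :=
  fold_right op e
    (map (fun m => if excluded_middle_informative (P m) then phi m else e) (seq 1 n)).

Section Pfold.

Variable T : Type.
Variable op : T -> T -> T.
Variable e : T.
Hypothesis opA : forall x y z, op x (op y z) = op (op x y) z.
Hypothesis opC : forall x y, op x y = op y x.
Hypothesis op1 : forall x, op e x = x.

Lemma pfold_S (P : nat -> Prop) (phi : nat -> T) (n : nat) :
  pfold op e P phi (S n) = op (pfold op e P phi n)
    (if excluded_middle_informative (P (S n)) then phi (S n) else e).
Proof.
  unfold pfold. rewrite seq_S, map_app, fold_right_app. simpl.
  set (x := if excluded_middle_informative (P (S n)) then phi (S n) else e).
  rewrite (opC x e), op1. generalize (map (fun m => if excluded_middle_informative (P m) then phi m else e) (seq 1 n)).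
  intros l. induction l as [|y l IH]; simpl; [rewrite op1; reflexivity|].
  rewrite IH. apply opA.
Qed.

Lemma pfold_ext (P : nat -> Prop) (phi psi : nat -> T) (n : nat) :
  (forall m, P m -> (1 <= m)%nat -> phi m = psi m) -> pfold op e P phi n = pfold op e P psi n.
Proof.
  intros H. induction n as [|n IH]; [reflexivity|]. rewrite !pfold_S, IH.
  destruct (excluded_middle_informative (P (S n))); [|reflexivity]. rewrite H by (auto; lia).
  reflexivity.
Qed.

Lemma pfold_unit (P : nat -> Prop) (n : nat) : pfold op e P (fun _ => e) n = e.
Proof.
  induction n as [|n IH]; [reflexivity|]. rewrite pfold_S, IH.
  destruct (excluded_middle_informative (P (S n))); apply op1.
Qed.

(** The multiples [N * m'] up to [n] are those with [m' <= n / N], and this quotient increases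
    exactly when [n] reaches a multiple of [N]. [Q] is left general to serve two decompositions:
    removing a generator from the monoid, and separating its elements divisible by a given
    generator. *)
Lemma pfold_split (P Q : nat -> Prop) (N : nat) (phi : nat -> T) (n : nat) :
  (2 <= N)%nat ->
  (forall m, P m <-> Q m \/ exists m', m = (N * m')%nat /\ P m') ->
  (forall m, Q m -> ~ Nat.divide N m) ->
  pfold op e P phi n =
  op (pfold op e Q phi n) (pfold op e P (fun m => phi (N * m)%nat) (n / N)).
Proof.
  intros HN HP HQ. induction n as [|n IH].
  - rewrite Nat.Div0.div_0_l. unfold pfold; simpl. rewrite op1. reflexivity.
  - rewrite !pfold_S, IH.
    destruct (Classical_Prop.classic (Nat.divide N (S n))) as [[m Hm]|Hnd].
    + assert (E1 : (S n / N = m)%nat) by (rewrite Hm; apply Nat.div_mul; lia).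
      destruct m as [|m]; [lia|].
      assert (E2 : (n / N = m)%nat).
      { symmetry. apply Nat.div_unique with (N - 1)%nat; lia. }
      rewrite E1, E2, (pfold_S P (fun m => phi (N * m)%nat)).
      destruct (excluded_middle_informative (Q (S n))) as [q|_].
      { exfalso. apply (HQ _ q). exists (S m). exact Hm. }
      rewrite (opC (pfold op e Q phi n) e), op1, !opA. f_equal.
      destruct (excluded_middle_informative (P (S n))) as [p|p];
      destruct (excluded_middle_informative (P (S m))) as [p'|p']; try reflexivity.
      * f_equal. lia.
      * exfalso. apply HP in p. destruct p as [p|[m' [E p]]].
        -- apply (HQ _ p). exists (S m). exact Hm.
        -- apply p'. replace (S m) with m'; [exact p|]. nia.
      * exfalso. apply p. apply HP. right. exists (S m). split; [lia|exact p'].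
    + assert (E1 : (S n / N = n / N)%nat).
      { assert (D := Nat.div_mod_eq (S n) N).
        assert (B := Nat.mod_upper_bound (S n) N ltac:(lia)).
        assert (Hr : (S n mod N <> 0)%nat)
          by (intros E; apply Hnd; apply Nat.Lcm0.mod_divide; exact E).
        apply Nat.div_unique with (S n mod N - 1)%nat; lia. }
      rewrite E1, <- !opA. f_equal. rewrite opC. f_equal.
      destruct (excluded_middle_informative (P (S n))) as [p|p];
      destruct (excluded_middle_informative (Q (S n))) as [q|q]; try reflexivity.
      * exfalso. apply HP in p. destruct p as [p|[m' [E p]]]; [contradiction|].
        apply Hnd. exists m'. lia.
      * exfalso. apply p, HP. left. exact q.
Qed.

End Pfold.

Definition mprod (N nu : nat -> nat) (s : nat) : nat :=
  fold_right Nat.mul 1%nat (map (fun i => (N i ^ nu i)%nat) (seq 1 s)).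

Lemma mprod_S (N nu : nat -> nat) (s : nat) :
  mprod N nu (S s) = (mprod N nu s * N (S s) ^ nu (S s))%nat.
Proof.
  unfold mprod. rewrite seq_S, map_app, fold_right_app. simpl.
  generalize (map (fun i => (N i ^ nu i)%nat) (seq 1 s)). intros l.
  rewrite Nat.mul_1_r. induction l as [|x l IH]; simpl; [lia|]. rewrite IH. lia.
Qed.

Lemma mprod_ext (N nu nu' : nat -> nat) (s : nat) :
  (forall i, (1 <= i <= s)%nat -> nu i = nu' i) -> mprod N nu s = mprod N nu' s.
Proof.
  intros H. induction s as [|s IH]; [reflexivity|]. rewrite !mprod_S, IH, H; auto; try lia.
  intros i Hi. apply H. lia.
Qed.

Lemma mprod_incr (N nu : nat -> nat) (s i : nat) : (1 <= i <= s)%nat ->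
  mprod N (fun j => if Nat.eqb j i then S (nu j) else nu j) s = (N i * mprod N nu s)%nat.
Proof.
  intros Hi. induction s as [|s IH]; [lia|]. rewrite !mprod_S.
  destruct (Nat.eqb_spec (S s) i) as [E|n].
  - rewrite (mprod_ext N _ nu).
    + rewrite E, Nat.pow_succ_r'. lia.
    + intros j Hj. destruct (Nat.eqb_spec j i); lia.
  - rewrite IH by lia. lia.
Qed.

Lemma gcd_mul_1 (a b k : nat) :
  Nat.gcd a k = 1%nat -> Nat.gcd b k = 1%nat -> Nat.gcd (a * b) k = 1%nat.
Proof.
  intros Ha Hb. set (d := Nat.gcd (a * b) k).
  assert (H1 : Nat.divide d (a * b)) by apply Nat.gcd_divide_l.
  assert (H2 : Nat.divide d k) by apply Nat.gcd_divide_r.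
  apply Nat.gauss in H1.
  - apply Nat.divide_1_r. rewrite <- Hb. apply Nat.gcd_greatest; assumption.
  - apply Nat.divide_1_r. rewrite <- Ha.
    apply Nat.gcd_greatest; [apply Nat.gcd_divide_r|].
    eapply Nat.divide_trans; [apply Nat.gcd_divide_l|exact H2].
Qed.

Lemma mprod_coprime (N nu : nat -> nat) (s k : nat) :
  (forall i, (1 <= i <= s)%nat -> nu i = 0%nat \/ Nat.gcd (N i) k = 1%nat) ->
  Nat.gcd (mprod N nu s) k = 1%nat.
Proof.
  intros H. induction s as [|s IH]; [reflexivity|]. rewrite mprod_S.
  apply gcd_mul_1; [apply IH; intros i Hi; apply H; lia|].
  destruct (H (S s) ltac:(lia)) as [->|Hc]; [reflexivity|].
  induction (nu (S s)) as [|n IHn]; [reflexivity|].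
  rewrite Nat.pow_succ_r'. apply gcd_mul_1; assumption.
Qed.

Lemma coprime_not_divide (N m : nat) : (2 <= N)%nat -> Nat.gcd m N = 1%nat -> ~ Nat.divide N m.
Proof.
  intros HN Hg Hd. assert (H : Nat.divide N 1).
  { rewrite <- Hg. apply Nat.gcd_greatest; [exact Hd|apply Nat.divide_refl]. }
  apply Nat.divide_1_r in H. lia.
Qed.

Definition admissible (s : nat) (N : nat -> nat) : Prop :=
  (forall i, (1 <= i <= s)%nat -> (2 <= N i)%nat) /\
  (forall i j, (1 <= i <= s)%nat -> (1 <= j <= s)%nat -> i <> j -> Nat.gcd (N i) (N j) = 1%nat).

Lemma admissible_S (s : nat) (N : nat -> nat) : admissible (S s) N -> admissible s N.
Proof. intros [H1 H2]. split; intros; [apply H1|apply H2]; try lia; assumption. Qed.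

Lemma in_monoid_mul (s : nat) (N : nat -> nat) (i m : nat) :
  (1 <= i <= s)%nat -> in_monoid s N m -> in_monoid s N (N i * m).
Proof.
  intros Hi [nu ->]. exists (fun j => if Nat.eqb j i then S (nu j) else nu j).
  symmetry. apply mprod_incr, Hi.
Qed.

Lemma in_monoid_1 (s : nat) (N : nat -> nat) : in_monoid s N 1.
Proof.
  exists (fun _ => 0%nat). change (1%nat = mprod N (fun _ => 0%nat) s).
  induction s as [|s IH]; [reflexivity|]. rewrite mprod_S, <- IH. simpl. lia.
Qed.

Lemma in_monoid_gen (s : nat) (N : nat -> nat) (i : nat) :
  (1 <= i <= s)%nat -> in_monoid s N (N i).
Proof.
  intros Hi. rewrite <- Nat.mul_1_r. apply in_monoid_mul; [exact Hi|apply in_monoid_1].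
Qed.

(** The cases are whether the exponent of [N i] is positive or zero; in the latter all generators
    that occur are coprime to [N i]. *)
Lemma in_monoid_cases (s : nat) (N : nat -> nat) (i m : nat) :
  admissible s N -> (1 <= i <= s)%nat -> in_monoid s N m ->
  (exists m', m = (N i * m')%nat /\ in_monoid s N m') \/ Nat.gcd m (N i) = 1%nat.
Proof.
  intros [_ Hc] Hi [nu E]. change (m = mprod N nu s) in E.
  destruct (nu i) as [|k] eqn:Ek.
  - right. rewrite E. apply mprod_coprime. intros j Hj.
    destruct (Nat.eq_dec j i) as [->|n]; [left; exact Ek|right; apply Hc; assumption].
  - left. set (nu' := fun j => if Nat.eqb j i then k else nu j).
    exists (mprod N nu' s). split; [|exists nu'; reflexivity].
    rewrite E, <- (mprod_incr N nu' s i Hi). apply mprod_ext. intros j Hj. unfold nu'.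
    destruct (Nat.eqb_spec j i) as [->|n]; [exact Ek|reflexivity].
Qed.

Lemma in_monoid_S (s : nat) (N : nat -> nat) (m : nat) : admissible (S s) N ->
  in_monoid (S s) N m <->
  in_monoid s N m \/ exists m', m = (N (S s) * m')%nat /\ in_monoid (S s) N m'.
Proof.
  intros Ha. split.
  - intros [nu E]. change (m = mprod N nu (S s)) in E. rewrite mprod_S in E.
    destruct (nu (S s)) as [|k] eqn:Ek.
    + left. exists nu. rewrite E. simpl. rewrite Nat.mul_1_r. reflexivity.
    + right. set (nu' := fun j => if Nat.eqb j (S s) then k else nu j).
      exists (mprod N nu' (S s)). split; [|exists nu'; reflexivity].
      rewrite E, mprod_S. unfold nu' at 2. rewrite Nat.eqb_refl.
      rewrite (mprod_ext N nu' nu).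
      * rewrite Nat.pow_succ_r'. lia.
      * intros j Hj. unfold nu'. destruct (Nat.eqb_spec j (S s)); lia.
  - intros [[nu E]|[m' [E Hm]]].
    (* A product over [s] factors leaves the exponent at [S s] arbitrary, so it is reset to 0. *)
    + exists (fun j => if Nat.eqb j (S s) then 0%nat else nu j).
      change (m = mprod N nu s) in E.
      change (m = mprod N (fun j => if Nat.eqb j (S s) then 0%nat else nu j) (S s)).
      rewrite mprod_S, Nat.eqb_refl, E. simpl. rewrite Nat.mul_1_r. apply mprod_ext.
      intros j Hj. destruct (Nat.eqb_spec j (S s)); lia.
    + rewrite E. apply in_monoid_mul; [lia|exact Hm].
Qed.

Lemma in_monoid_coprime_next (s : nat) (N : nat -> nat) (m : nat) : admissible (S s) N ->
  in_monoid s N m -> ~ Nat.divide (N (S s)) m.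
Proof.
  intros [H2 Hc] [nu E]. change (m = mprod N nu s) in E.
  apply coprime_not_divide; [apply H2; lia|]. rewrite E. apply mprod_coprime.
  intros i Hi. right. apply Hc; lia.
Qed.

Lemma in_monoid_0 (N : nat -> nat) (m : nat) : in_monoid 0 N m <-> m = 1%nat.
Proof.
  split; [intros [nu E]; exact E|]. intros ->. apply in_monoid_1.
Qed.

Lemma mfold_split {T : Type} (op : T -> T -> T) (e : T) (s : nat) (N : nat -> nat)
    (phi : nat -> T) (n : nat) :
  (forall x y z, op x (op y z) = op (op x y) z) -> (forall x y, op x y = op y x) ->
  (forall x, op e x = x) -> admissible (S s) N ->
  pfold op e (in_monoid (S s) N) phi n =
  op (pfold op e (in_monoid s N) phi n)
     (pfold op e (in_monoid (S s) N) (fun m => phi (N (S s) * m)%nat) (n / N (S s))).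
Proof.
  intros A Cm U Ha. apply pfold_split; auto.
  - apply Ha. lia.
  - intros m. apply in_monoid_S, Ha.
  - intros m. apply in_monoid_coprime_next, Ha.
Qed.

(** * Harmonic and power sums over the monoid *)

Definition Rfold := pfold Rplus 0.

Lemma Rfold_S (P : nat -> Prop) (phi : nat -> R) (n : nat) :
  Rfold P phi (S n) = Rfold P phi n +
    (if excluded_middle_informative (P (S n)) then phi (S n) else 0).
Proof. apply pfold_S; intros; ring. Qed.

Lemma Rfold_scal (P : nat -> Prop) (c : R) (phi : nat -> R) (n : nat) :
  Rfold P (fun m => c * phi m) n = c * Rfold P phi n.
Proof.
  induction n as [|n IH]; [unfold Rfold, pfold; simpl; ring|]. rewrite !Rfold_S, IH.
  destruct (excluded_middle_informative (P (S n))); ring.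
Qed.

Lemma Rfold_le (P : nat -> Prop) (phi psi : nat -> R) (n : nat) :
  (forall m, (1 <= m)%nat -> phi m <= psi m) -> Rfold P phi n <= Rfold P psi n.
Proof.
  intros H. induction n as [|n IH]; [unfold Rfold, pfold; simpl; lra|]. rewrite !Rfold_S.
  destruct (excluded_middle_informative (P (S n))); [|lra].
  generalize (H (S n) ltac:(lia)). lra.
Qed.

Lemma Rfold_incr (P : nat -> Prop) (phi : nat -> R) (n m : nat) :
  (forall k, (1 <= k)%nat -> 0 <= phi k) -> (n <= m)%nat -> Rfold P phi n <= Rfold P phi m.
Proof.
  intros H Hnm. induction Hnm as [|m Hnm IH]; [lra|]. rewrite Rfold_S.
  destruct (excluded_middle_informative (P (S m))); [|lra].
  generalize (H (S m) ltac:(lia)). lra.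
Qed.

Lemma Rfold_0 (N : nat -> nat) (phi : nat -> R) (n : nat) :
  0 <= phi 1%nat -> Rfold (in_monoid 0 N) phi n <= phi 1%nat.
Proof.
  intros H.
  assert (E : forall n, Rfold (in_monoid 0 N) phi (S n) = phi 1%nat).
  { clear n. induction n as [|n IH].
    - rewrite Rfold_S. unfold Rfold, pfold; simpl.
      destruct (excluded_middle_informative _) as [p|p]; [ring|].
      exfalso. apply p, in_monoid_1.
    - rewrite Rfold_S, IH. destruct (excluded_middle_informative _) as [p|p]; [|ring].
      apply in_monoid_0 in p. lia. }
  destruct n as [|n]; [unfold Rfold, pfold; simpl; exact H|rewrite E; lra].
Qed.

Lemma Rfold_split (s : nat) (N : nat -> nat) (phi : nat -> R) (n : nat) :
  admissible (S s) N ->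
  Rfold (in_monoid (S s) N) phi n = Rfold (in_monoid s N) phi n +
    Rfold (in_monoid (S s) N) (fun m => phi (N (S s) * m)%nat) (n / N (S s)).
Proof. intros Ha. apply mfold_split; auto; intros; ring. Qed.

(** Splitting off the multiples of the new generator gives [T <= 2 ^ s + T / 2] for the finite
    partial sum [T], so each generator at most doubles the bound. *)
Lemma monoid_harmonic (s : nat) (N : nat -> nat) (n : nat) : admissible s N ->
  Rfold (in_monoid s N) (fun m => / INR m) n <= 2 ^ s.
Proof.
  revert n. induction s as [|s IH]; intros n Ha.
  - simpl. eapply Rle_trans; [apply Rfold_0|]; simpl; lra.
  - specialize (IH n (admissible_S _ _ Ha)).
    assert (HN : (2 <= N (S s))%nat) by (apply Ha; lia).
    assert (Hpos : forall k, (1 <= k)%nat -> 0 <= / INR k).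
    { intros k Hk. left. apply Rinv_0_lt_compat, lt_0_INR. lia. }
    assert (H : Rfold (in_monoid (S s) N) (fun m => / INR (N (S s) * m)) (n / N (S s))
      <= / 2 * Rfold (in_monoid (S s) N) (fun m => / INR m) n).
    { eapply Rle_trans; [|rewrite <- Rfold_scal; apply Rfold_incr with (n := (n / N (S s))%nat)].
      - apply Rfold_le. intros m Hm. rewrite mult_INR, Rinv_mult.
        apply Rmult_le_compat_r; [apply Hpos, Hm|]. apply Rinv_le_contravar; [lra|].
        change 2 with (INR 2). apply le_INR, HN.
      - intros k Hk. apply Rmult_le_pos; [lra|apply Hpos, Hk].
      - apply Nat.Div0.div_le_upper_bound. nia. }
    assert (E := Rfold_split s N (fun m => / INR m) n Ha). simpl pow. lra.
Qed.

(** The summand 1 keeps [Lg] at least 1 on [[0, 1)], so that products with it do not degenerate at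
    0. *)
Definition Lg (x : R) : R := 1 - ln (1 - x).

Lemma ln_1m_le (x : R) : 0 <= x < 1 -> ln (1 - x) <= 0.
Proof.
  intros Hx. rewrite <- ln_1. destruct (Req_dec x 0) as [->|n].
  - right. f_equal. ring.
  - left. apply ln_increasing; lra.
Qed.

Lemma Lg_mono (x y : R) : 0 <= x -> x <= y -> y < 1 -> Lg x <= Lg y.
Proof.
  intros Hx Hxy Hy. unfold Lg. destruct Hxy as [Hxy| ->]; [|lra].
  assert (ln (1 - y) < ln (1 - x)) by (apply ln_increasing; lra). lra.
Qed.

Lemma pow_le_pow (x : R) (n m : nat) : 0 <= x <= 1 -> (n <= m)%nat -> x ^ m <= x ^ n.
Proof.
  intros Hx H. induction H as [|m H IH]; [lra|]. simpl.
  assert (0 <= x ^ m) by (apply pow_le; lra).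
  assert (x * x ^ m <= 1 * x ^ m) by (apply Rmult_le_compat_r; lra). lra.
Qed.

(* [V x = 2 x (1 - ln (1 - x))] is a supersolution of [V x = x + V (x ^ N)], so
   it dominates [sum_k x ^ (N ^ k)]. *)
Lemma Lg_supersolution (x : R) (N : nat) : 0 <= x < 1 -> (2 <= N)%nat ->
  x + 2 * (x ^ N * Lg (x ^ N)) <= 2 * (x * Lg x).
Proof.
  intros Hx HN.
  assert (H2 : x ^ N <= x ^ 2) by (apply pow_le_pow; [lra|exact HN]).
  assert (H0 : 0 <= x ^ N) by (apply pow_le; lra).
  assert (Hxx : 0 <= x ^ 2 < 1) by (simpl; nra).
  assert (HL : Lg (x ^ N) <= Lg (x ^ 2)) by (apply Lg_mono; lra).
  assert (HL1 : 1 <= Lg (x ^ N)).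
  { unfold Lg. generalize (ln_1m_le (x ^ N) ltac:(lra)). lra. }
  assert (Hl := ln_1m_le x Hx).
  assert (HE : Lg (x ^ 2) = Lg x - ln (1 + x)).
  { unfold Lg. replace (1 - x ^ 2) with ((1 - x) * (1 + x)) by ring.
    rewrite ln_mult by lra. ring. }
  assert (Hln : x / (1 + x) <= ln (1 + x)).
  { assert (E := exp_ineq1_le (- ln (1 + x))).
    rewrite exp_Ropp, exp_ln in E by lra.
    replace (x / (1 + x)) with (1 - / (1 + x)) by (field; lra). lra. }
  assert (Hhalf : x / 2 <= x / (1 + x)).
  { apply Rmult_le_compat_l; [lra|]. apply Rinv_le_contravar; lra. }
  assert (M1 : x ^ N * Lg (x ^ N) <= x ^ 2 * Lg (x ^ 2)) by (apply Rmult_le_compat; lra).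
  rewrite HE in M1. set (l := Lg x) in *. assert (Hl1 : 1 <= l) by (unfold l, Lg; lra).
  set (g := ln (1 + x)) in *.
  (* With [g >= x / 2] and [l >= 1] the claim reduces to [x * (1 - x) * (1 + x) <= 2 * x * (1 - x)],
     whose defect is the square in [M4]. This is where the factor 2 is enough. *)
  assert (M2 : x * (x * g) >= x * (x * (x / 2))).
  { apply Rle_ge. apply Rmult_le_compat_l; [lra|]. apply Rmult_le_compat_l; lra. }
  assert (M3 : x * ((1 - x) * (l - 1)) >= 0).
  { apply Rle_ge. apply Rmult_le_pos; [lra|]. apply Rmult_le_pos; lra. }
  assert (M4 : x * ((1 - x) ^ 2) >= 0).
  { apply Rle_ge. apply Rmult_le_pos; [lra|]. apply pow2_ge_0. }
  simpl pow in *. nra.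
Qed.

(** The outer induction is on the generators. The split replaces [n] by [n / N] and [x] by [x ^ N],
    so the inner induction on [n] is strong and keeps [x] general; by monotonicity of [Lg], a power
    [Lg x ^ s] factors out and [Lg_supersolution] closes the recursion. *)
Lemma monoid_power_sum (s : nat) (N : nat -> nat) (n : nat) (x : R) : admissible s N ->
  0 <= x < 1 -> Rfold (in_monoid s N) (fun m => x ^ m) n <= 2 ^ s * (x * Lg x ^ s).
Proof.
  revert n x. induction s as [|s IHs]; intros n x Ha Hx.
  - eapply Rle_trans; [apply Rfold_0|]; simpl; lra.
  - assert (Has := admissible_S _ _ Ha).
    assert (HN : (2 <= N (S s))%nat) by (apply Ha; lia).
    assert (HL : forall y, 0 <= y < 1 -> 1 <= Lg y).
    { intros y Hy. unfold Lg. generalize (ln_1m_le y Hy). lra. }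
    assert (K : Rfold (in_monoid (S s) N) (fun m => x ^ m) n
      <= 2 ^ s * (Lg x ^ s * (2 * (x * Lg x)))).
    { revert x Hx. induction n as [n IHn] using (well_founded_induction Wf_nat.lt_wf). intros x Hx.
      assert (HLx := HL x Hx).
      destruct n as [|n].
      - unfold Rfold, pfold; simpl.
        repeat apply Rmult_le_pos; try lra; try apply pow_le; lra.
      - rewrite Rfold_split by exact Ha.
        assert (H1 := IHs (S n) x Has Hx).
        assert (Hxn : 0 <= x ^ N (S s) < 1).
        { split; [apply pow_le; lra|]. apply pow_lt_1_compat; [lra|lia]. }
        assert (H2 := IHn (S n / N (S s))%nat ltac:(apply Nat.div_lt; lia) (x ^ N (S s)) Hxn).
        rewrite (pfold_ext R Rplus 0) with (psi := fun m => x ^ (N (S s) * m)) in H2;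
          try (intros; ring).
        2:{ intros m _ _. symmetry. apply pow_mult. }
        assert (H3 := Lg_supersolution x (N (S s)) Hx HN).
        assert (Hle : Lg (x ^ N (S s)) ^ s <= Lg x ^ s).
        { apply pow_incr. split; [generalize (HL _ Hxn); lra|].
          apply Lg_mono; try lra. rewrite <- (pow_1 x) at 2. apply pow_le_pow; [lra|lia]. }
        set (y := x ^ N (S s)) in *.
        assert (P1 : 0 < 2 ^ s) by (apply pow_lt; lra).
        assert (P2 : 0 <= Lg x ^ s) by (apply pow_le; lra).
        assert (P3 : 0 <= 2 * (y * Lg y)).
        { generalize (HL _ Hxn). intros. repeat apply Rmult_le_pos; lra. }
        assert (Q1 : Lg y ^ s * (2 * (y * Lg y)) <= Lg x ^ s * (2 * (y * Lg y)))
          by (apply Rmult_le_compat_r; assumption).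
        assert (Q2 : Lg x ^ s * (x + 2 * (y * Lg y)) <= Lg x ^ s * (2 * (x * Lg x)))
          by (apply Rmult_le_compat_l; assumption).
        assert (Q3 : 2 ^ s * (x * Lg x ^ s + Lg y ^ s * (2 * (y * Lg y)))
          <= 2 ^ s * (Lg x ^ s * (2 * (x * Lg x)))) by (apply Rmult_le_compat_l; lra).
        unfold Rfold in *. lra. }
    eapply Rle_trans; [exact K|]. simpl. right. ring.
Qed.


(** * The logarithm of Psi *)

Definition Cfold := pfold Cplus (RtoC 0).

Lemma Cfold_S (P : nat -> Prop) (phi : nat -> C) (n : nat) :
  Cfold P phi (S n) = (Cfold P phi n +
    (if excluded_middle_informative (P (S n)) then phi (S n) else RtoC 0))%C.
Proof. apply pfold_S; intros; ring. Qed.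

(** Shifted by one, since [csum] counts from 0 and the folds from 1. *)
Definition mterm (P : nat -> Prop) (F : C -> C) (k : nat) (z : C) : C :=
  if excluded_middle_informative (P (S k)) then F (Cpow z (S k)) else RtoC 0.

Lemma Cfold_csum (P : nat -> Prop) (F : C -> C) (z : C) (n : nat) :
  Cfold P (fun m => F (Cpow z m)) n = csum (fun k => mterm P F k z) n.
Proof.
  induction n as [|n IH]; [reflexivity|]. rewrite Cfold_S, IH. reflexivity.
Qed.

Lemma Cmod_Cfold_le (P : nat -> Prop) (phi : nat -> C) (b : nat -> R) (n : nat) :
  (forall m, (1 <= m)%nat -> Cmod (phi m) <= b m) -> Cmod (Cfold P phi n) <= Rfold P b n.
Proof.
  intros H. induction n as [|n IH].
  - unfold Cfold, Rfold, pfold; simpl. rewrite Cmod_0. lra.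
  - rewrite Cfold_S, Rfold_S. eapply Rle_trans; [apply Cmod_triangle|].
    destruct (excluded_middle_informative (P (S n))).
    + generalize (H (S n) ltac:(lia)). lra.
    + rewrite Cmod_0. lra.
Qed.

Lemma Re_Cfold_le (P : nat -> Prop) (phi : nat -> C) (b : nat -> R) (n : nat) :
  (forall m, (1 <= m)%nat -> Re (phi m) <= b m) -> Re (Cfold P phi n) <= Rfold P b n.
Proof.
  intros H. induction n as [|n IH].
  - unfold Cfold, Rfold, pfold; simpl. lra.
  - rewrite Cfold_S, Rfold_S.
    change (Re (?a + ?b)%C) with (Re a + Re b).
    destruct (excluded_middle_informative (P (S n))).
    + generalize (H (S n) ltac:(lia)). lra.
    + change (Re (RtoC 0)) with 0. lra.
Qed.

Lemma Cconv_Re_le (s : nat -> C) (l : C) (B : R) :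
  Cconv s l -> (forall n, Re (s n) <= B) -> Re l <= B.
Proof.
  intros H HB. apply Rnot_lt_le. intros Hlt.
  destruct (H (Re l - B) ltac:(lra)) as [n Hn]. specialize (Hn n (le_n n)).
  specialize (HB n). assert (K := re_le_Cmod (s n - l)).
  change (Re (s n - l)) with (Re (s n) - Re l) in K.
  apply Rabs_le_between in K. lra.
Qed.

Lemma in_D_pow (z : C) (m : nat) : in_D z -> (1 <= m)%nat -> in_D (Cpow z m).
Proof.
  unfold in_D. intros Hz Hm. rewrite Cmod_pow.
  apply pow_lt_1_compat; [split; [apply Cmod_ge_0|exact Hz]|lia].
Qed.

Lemma Cmod_pow_le (z : C) (m : nat) : in_D z -> (1 <= m)%nat -> Cmod (Cpow z m) <= Cmod z.
Proof.
  unfold in_D. intros Hz Hm. rewrite Cmod_pow. rewrite <- (pow_1 (Cmod z)) at 2.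
  apply pow_le_pow; [generalize (Cmod_ge_0 z); lra|exact Hm].
Qed.

Definition msum (P : nat -> Prop) (F H : C -> C) : Prop :=
  forall z, in_D z -> Cconv (fun n => Cfold P (fun m => F (Cpow z m)) n) (H z).

(** If [F] is [L]-Lipschitz on the disc of radius [rho], then [F (z ^ (k + 1))] has there the
    constant [L * (k + 1) * rho ^ k], and these are summable over all [k]. Since every term vanishes
    at 0, the same constants dominate the values, and [series_Cder] gives the derivative. *)
Lemma msum_exists (P : nat -> Prop) (F : C -> C) : analytic F -> F (RtoC 0) = RtoC 0 ->
  exists H, msum P F H /\ analytic H.
Proof.
  intros HF HF0.
  assert (Hterm : forall rho L, 0 < rho < 1 -> 0 <= L ->
    (forall w w', Cmod w < rho -> Cmod w' < rho -> Cmod (F w - F w') <= L * Cmod (w - w')) ->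
    forall k w w', Cmod w < rho -> Cmod w' < rho ->
    Cmod (mterm P F k w - mterm P F k w') <= L * (INR (S k) * rho ^ k) * Cmod (w - w')).
  { intros rho L Hr HL0 HL k w w' Hw Hw'. unfold mterm.
    destruct (excluded_middle_informative (P (S k))).
    - assert (forall v, Cmod v < rho -> Cmod (Cpow v (S k)) < rho).
      { intros v Hv. eapply Rle_lt_trans; [apply Cmod_pow_le; [unfold in_D; lra|lia]|exact Hv]. }
      eapply Rle_trans; [apply HL; auto|]. rewrite Rmult_assoc.
      apply Rmult_le_compat_l; [exact HL0|]. apply (pow_lipschitz (S k)); lra.
    - replace (RtoC 0 - RtoC 0)%C with (RtoC 0) by ring. rewrite Cmod_0.
      apply Rmult_le_pos; [|apply Cmod_ge_0]. apply Rmult_le_pos; [exact HL0|].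
      apply Rmult_le_pos; [apply pos_INR|apply pow_le; lra]. }
  assert (Hlip : forall rho, 0 < rho < 1 -> exists L, 0 <= L /\
    forall w w', Cmod w < rho -> Cmod w' < rho -> Cmod (F w - F w') <= L * Cmod (w - w')).
  { intros rho Hr. destruct (analytic_lipschitz F rho HF Hr) as [L HL].
    exists (Rabs L). split; [apply Rabs_pos|]. intros w w' Hw Hw'.
    eapply Rle_trans; [apply HL; assumption|]. apply Rmult_le_compat_r; [apply Cmod_ge_0|].
    apply Rle_abs. }
  assert (Hsum : forall rho L n, 0 < rho < 1 -> 0 <= L ->
    rsum (fun k => L * (INR (S k) * rho ^ k)) n <= L * / ((1 - rho) * (1 - rho))).
  { intros rho L n Hr HL. rewrite rsum_scal. apply Rmult_le_compat_l; [exact HL|].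
    apply geom_deriv_sum. lra. }
  assert (Hmt0 : forall k, mterm P F k (RtoC 0) = RtoC 0).
  { intros k. unfold mterm. rewrite Cpow_S, Cmult_0_l, HF0.
    destruct (excluded_middle_informative (P (S k))); reflexivity. }
  assert (Hex : forall z, exists l, in_D z -> Cconv (csum (fun k => mterm P F k z)) l).
  { intros z. destruct (Classical_Prop.classic (in_D z)) as [Hz|Hz].
    2: exists (RtoC 0); tauto.
    unfold in_D in Hz. assert (Pz := Cmod_ge_0 z). set (rho := (1 + Cmod z) / 2).
    assert (Hr : 0 < rho < 1) by (unfold rho; lra).
    destruct (Hlip rho Hr) as [L [HL0 HL]].
    destruct (dominated_conv (fun k => mterm P F k z) (fun k => L * (INR (S k) * rho ^ k))
      (L * / ((1 - rho) * (1 - rho)))) as [l Hl].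
    - intros k.
      replace (mterm P F k z) with (mterm P F k z - mterm P F k (RtoC 0))%C
        by (rewrite Hmt0; ring).
      eapply Rle_trans; [apply (Hterm rho L Hr HL0 HL); [|rewrite Cmod_0]; unfold rho; lra|].
      replace (z - 0)%C with z by ring.
      rewrite <- (Rmult_1_r (L * (INR (S k) * rho ^ k))) at 2.
      apply Rmult_le_compat_l; [|lra]. apply Rmult_le_pos; [exact HL0|].
      apply Rmult_le_pos; [apply pos_INR|apply pow_le; lra].
    - intros n. apply (Hsum rho L n Hr HL0).
    - exists l. auto. }
  set (H := fun z => proj1_sig (constructive_indefinite_description _ (Hex z))).
  assert (HH : forall z, in_D z -> Cconv (csum (fun k => mterm P F k z)) (H z)).
  { intros z Hz. unfold H. destruct (constructive_indefinite_description _ (Hex z)) as [l Hl].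
    auto. }
  exists H. split.
  { intros z Hz. apply Cconv_ext with (2 := HH z Hz). intros n. symmetry. apply Cfold_csum. }
  apply analytic_Cder. intros z Hz. unfold in_D in Hz. assert (Pz := Cmod_ge_0 z).
  set (rho := (1 + Cmod z) / 2). assert (Hr : 0 < rho < 1) by (unfold rho; lra).
  destruct (Hlip rho Hr) as [L [HL0 HL]].
  destruct (series_Cder (fun k w => mterm P F k w) (fun k => L * (INR (S k) * rho ^ k)) H rho
    (L * / ((1 - rho) * (1 - rho)))) as [_ K].
  - apply (Hterm rho L Hr HL0 HL).
  - intros k. apply Rmult_le_pos; [exact HL0|].
    apply Rmult_le_pos; [apply pos_INR|apply pow_le; lra].
  - intros n. apply Hsum; assumption.
  - intros w Hw. apply HH. unfold in_D. lra.
  - assert (Hd : forall k, exists d, Cder (mterm P F k) z d).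
    { intros k. unfold mterm. destruct (excluded_middle_informative (P (S k))).
      - destruct (proj1 (analytic_Cder F) HF (Cpow z (S k))) as [c Hc].
        { apply in_D_pow; [exact Hz|lia]. }
        eexists. apply (Cder_comp F (fun w => Cpow w (S k))); [exact Hc|apply Cder_pow].
      - eexists. apply Cder_const. }
    destruct (K z (fun k => proj1_sig (constructive_indefinite_description _ (Hd k))))
      as [l [_ Hl]].
    + unfold rho; lra.
    + intros k. destruct (constructive_indefinite_description _ (Hd k)) as [d Hdk]. exact Hdk.
    + exists l. exact Hl.
Qed.

Lemma lim_Cconv (u : nat -> C) (l : C) : Cconv u l ->
  @lim C_CompleteNormedModule (filtermap u eventually) = l.
Proof.
  intros H.
  assert (Hf : filterlim u eventually (@locally C_UniformSpace l)).
  { apply (proj2 (@filterlim_locally nat C_UniformSpace eventually _ u l)).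
    intros e. destruct (H e (cond_pos e)) as [n0 Hn]. exists n0. intros n Hle.
    apply C_NormedModule_mixin_compat1. apply Hn, Hle. }
  assert (Hc : @cauchy C_UniformSpace (filtermap u eventually)).
  { intros e. exists l. apply (proj1 (@filterlim_locally nat C_UniformSpace eventually _ u l) Hf). }
  assert (K := @complete_cauchy C_CompleteNormedModule (filtermap u eventually)
    (filtermap_proper_filter _ _ u eventually _) Hc).
  apply Cconv_unique with u; [|exact H]. intros e He.
  (* Balls of the uniform structure on [C] are products of intervals; such a ball lies in the disc
     whose radius is [sqrt 2] times larger. *)
  assert (Hs2 : 0 < sqrt 2) by (apply sqrt_lt_R0; lra).
  assert (He2 : 0 < e / sqrt 2) by (apply Rdiv_lt_0_compat; assumption).
  destruct (K (mkposreal _ He2)) as [n0 Hn]. exists n0. intros n Hle.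
  specialize (Hn n Hle).
  apply (C_NormedModule_mixin_compat2 _ _ (mkposreal _ He2)) in Hn. simpl in Hn.
  replace (sqrt 2 * (e / sqrt 2)) with e in Hn by (field; lra). exact Hn.
Qed.

Lemma Psi_partial_exp (s : nat) (N : nat -> nat) (alpha F : C -> C) (z : C) (n : nat) :
  in_D z -> (forall w, in_D w -> alpha w = Cexp (F w)) ->
  Psi_partial s N alpha z n = Cexp (Cfold (in_monoid s N) (fun m => F (Cpow z m)) n).
Proof.
  intros Hz Ha.
  change (pfold Cmult (RtoC 1) (in_monoid s N) (fun m => alpha (Cpow z m)) n
    = Cexp (Cfold (in_monoid s N) (fun m => F (Cpow z m)) n)).
  induction n as [|n IH].
  - unfold Cfold, pfold; simpl. symmetry. apply Cexp_0.
  - rewrite pfold_S by (intros; ring). rewrite Cfold_S, Cexp_plus, IH. f_equal.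
    destruct (excluded_middle_informative (in_monoid s N (S n))).
    + apply Ha, in_D_pow; [exact Hz|lia].
    + symmetry. apply Cexp_0.
Qed.

Lemma Psi_exp (s : nat) (N : nat -> nat) (alpha F H : C -> C) :
  (forall w, in_D w -> alpha w = Cexp (F w)) -> msum (in_monoid s N) F H ->
  forall z, in_D z -> Cconv (Psi_partial s N alpha z) (Psi s N alpha z) /\
    Psi s N alpha z = Cexp (H z).
Proof.
  intros Ha HH z Hz.
  assert (K : Cconv (Psi_partial s N alpha z) (Cexp (H z))).
  { apply Cconv_ext with
      (fun n => Cexp (Cfold (in_monoid s N) (fun m => F (Cpow z m)) n)).
    - intros n. symmetry. apply Psi_partial_exp; assumption.
    - apply Cconv_cont; [eapply Cder_Ccont, Cder_Cexp|apply HH, Hz]. }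
  assert (E : Psi s N alpha z = Cexp (H z)) by (apply lim_Cconv, K).
  rewrite E. split; [exact K|reflexivity].
Qed.

Lemma msum_0 (P : nat -> Prop) (F H : C -> C) :
  F (RtoC 0) = RtoC 0 -> msum P F H -> H (RtoC 0) = RtoC 0.
Proof.
  intros HF HH. apply Cconv_unique with (1 := HH _ in_D_0).
  apply Cconv_ext with (2 := Cconv_const (RtoC 0)). intros n.
  induction n as [|n IH]; [reflexivity|]. rewrite Cfold_S, <- IH.
  rewrite Cpow_S, Cmult_0_l, HF. destruct (excluded_middle_informative (P (S n))); ring.
Qed.

Lemma msum_minus (P : nat -> Prop) (F1 F2 H1 H2 : C -> C) :
  msum P F1 H1 -> msum P F2 H2 ->
  msum P (fun z => F1 z - F2 z)%C (fun z => H1 z - H2 z)%C.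
Proof.
  intros K1 K2 z Hz.
  assert (K := Cconv_plus _ _ _ _ (K1 z Hz)
    (Cconv_mult _ _ _ _ (Cconv_const (- (1))%C) (K2 z Hz))).
  replace (H1 z - H2 z)%C with (H1 z + - (1) * H2 z)%C by ring.
  refine (Cconv_ext _ _ _ _ K). intros n. simpl.
  induction n as [|n IH]; [unfold Cfold, pfold; simpl; ring|].
  rewrite !Cfold_S, <- IH. destruct (excluded_middle_informative (P (S n))); ring.
Qed.

(** * Growth of Psi *)

Lemma rpow_nat (x : R) (s : nat) : 0 <= x -> (1 <= s)%nat -> rpow x (INR s) = x ^ s.
Proof.
  intros Hx Hs. unfold rpow. destruct (Req_EM_T x 0) as [->|n].
  - destruct (Req_EM_T (INR s) 0) as [E|_].
    + apply (INR_eq s 0) in E. lia.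
    + symmetry. apply pow_i. lia.
  - apply Rpower_pow. lra.
Qed.

Lemma rpow_0 (x : R) : 0 <= x -> rpow x 0 = 1.
Proof.
  intros Hx. unfold rpow. destruct (Req_EM_T x 0) as [->|n].
  - destruct (Req_EM_T 0 0); [reflexivity|congruence].
  - apply Rpower_O. lra.
Qed.

Lemma pow_1_plus_le (x : R) (s : nat) : 0 <= x -> (1 + x) ^ s <= 2 ^ s * (1 + x ^ s).
Proof.
  intros Hx. assert (0 <= x ^ s) by (apply pow_le; exact Hx).
  assert (0 < 2 ^ s) by (apply pow_lt; lra).
  destruct (Rle_dec x 1) as [h|h].
  - apply Rle_trans with (2 ^ s); [apply pow_incr; lra|].
    rewrite <- (Rmult_1_r (2 ^ s)) at 1. apply Rmult_le_compat_l; lra.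
  - apply Rle_trans with ((2 * x) ^ s); [apply pow_incr; lra|].
    rewrite Rpow_mult_distr. apply Rmult_le_compat_l; lra.
Qed.

(** A constant bound cannot be summed over the terms [F (z ^ m)]; decay at 0 can. Up to radius 1/2
    it comes from [Borel_Caratheodory], where [1 / (1 - |z|) <= 2]; beyond, [A <= 4 * A * |z|]
    already holds. *)
Lemma Re_le_linear (F : C -> C) (A : R) : analytic F -> F (RtoC 0) = RtoC 0 -> 0 <= A ->
  (forall z, in_D z -> Re (F z) <= A) -> forall z, in_D z -> Re (F z) <= 4 * A * Cmod z.
Proof.
  intros HF HF0 HA0 HA z Hz. assert (P := Cmod_ge_0 z).
  destruct (Rle_dec (Cmod z) (1 / 2)) as [h|h].
  - eapply Rle_trans; [apply Rle_abs|]. eapply Rle_trans; [apply re_le_Cmod|].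
    eapply Rle_trans; [apply (Borel_Caratheodory F A HF HF0 HA z Hz)|].
    replace (4 * A * Cmod z) with (2 * A * (2 * Cmod z)) by ring.
    apply Rmult_le_compat_l; [lra|]. apply Rle_div_l; [lra|]. nra.
  - eapply Rle_trans; [apply HA, Hz|]. nra.
Qed.

(* Each factor is at most [exp (4 A |z| ^ m)], so the growth is governed by the
   sum of [|z| ^ m] over the monoid. *)
Lemma Psi_growth (s : nat) (N : nat -> nat) (F H : C -> C) (A : R) : (1 <= s)%nat ->
  admissible s N -> analytic F -> F (RtoC 0) = RtoC 0 -> 0 <= A ->
  (forall z, in_D z -> Re (F z) <= A) -> msum (in_monoid s N) F H -> analytic H ->
  A_ (INR s) (fun z => Cexp (H z)).
Proof.
  intros Hs Ha HF HF0 HA0 HA HH HaH. split.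
  { apply analytic_Cder. intros z Hz.
    destruct (proj1 (analytic_Cder H) HaH z Hz) as [c Hc].
    eexists. apply (Cder_comp Cexp H); [apply Cder_Cexp|exact Hc]. }
  (* One factor [2 ^ s] comes from [monoid_power_sum], the other from
     [(1 + l) ^ s <= 2 ^ s * (1 + l ^ s)]. *)
  set (c := 4 * A * (2 ^ s * 2 ^ s)).
  assert (P2 : 0 < 2 ^ s) by (apply pow_lt; lra).
  assert (Hc : 0 <= c).
  { unfold c. apply Rmult_le_pos; [lra|]. left. apply Rmult_lt_0_compat; assumption. }
  exists (exp c), c. split; [left; apply exp_pos|]. split; [exact Hc|].
  intros z Hz. assert (Pz := Cmod_ge_0 z). assert (Hz' := Hz). unfold in_D in Hz'.
  assert (Hln := ln_1m_le (Cmod z) ltac:(lra)).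
  rewrite Cmod_Cexp, <- exp_plus, Rabs_left1 by lra.
  rewrite rpow_nat by (lra || exact Hs).
  set (l := - ln (1 - Cmod z)). assert (Hl : 0 <= l) by (unfold l; lra).
  assert (K : Re (H z) <= 4 * A * (2 ^ s * (Cmod z * Lg (Cmod z) ^ s))).
  { apply Cconv_Re_le with (1 := HH z Hz). intros n.
    eapply Rle_trans.
    - apply Re_Cfold_le with (b := fun m => 4 * A * Cmod z ^ m). intros m Hm.
      rewrite <- Cmod_pow. apply Re_le_linear; auto. apply in_D_pow; assumption.
    - rewrite Rfold_scal. apply Rmult_le_compat_l; [lra|]. apply monoid_power_sum; auto. }
  assert (K2 : Re (H z) <= c + c * l ^ s).
  { eapply Rle_trans; [exact K|]. unfold c.
    replace (4 * A * (2 ^ s * 2 ^ s) + 4 * A * (2 ^ s * 2 ^ s) * l ^ s)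
      with (4 * A * (2 ^ s * (1 * (2 ^ s * (1 + l ^ s))))) by ring.
    apply Rmult_le_compat_l; [lra|]. apply Rmult_le_compat_l; [lra|].
    assert (HL : Lg (Cmod z) = 1 + l) by (unfold Lg, l; ring). rewrite HL.
    apply Rmult_le_compat; [exact Pz|apply pow_le; lra|lra|apply pow_1_plus_le, Hl]. }
  destruct K2 as [K2| ->]; [left; apply exp_increasing, K2|lra].
Qed.

Lemma A_ext (gam : R) (f g : C -> C) : (forall z, in_D z -> f z = g z) -> A_ gam f -> A_ gam g.
Proof.
  intros E [Hf [a [r [Ha [Hr H]]]]]. split.
  - apply analytic_Cder. intros z Hz. destruct (proj1 (analytic_Cder f) Hf z Hz) as [c Hc].
    exists c. apply Cder_ext_loc with (2 := Hc). unfold in_D in *.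
    exists (1 - Cmod z). split; [lra|]. intros w Hw. apply E. unfold in_D.
    generalize (Cmod_le_add w z). lra.
  - exists a, r. split; [exact Ha|]. split; [exact Hr|]. intros z Hz. rewrite <- E by exact Hz.
    apply H, Hz.
Qed.


(** * Nevanlinna class and atoms *)

(** The logarithms of bounded zero-free functions normalized at 0; the real part may be unbounded
    below. *)
Definition log_bounded (F : C -> C) : Prop :=
  analytic F /\ F (RtoC 0) = RtoC 0 /\ exists A, 0 <= A /\ forall z, in_D z -> Re (F z) <= A.

Lemma bounded_log (g : C -> C) (M : R) : analytic g -> zero_free g -> g (RtoC 0) = RtoC 1 ->
  (forall z, in_D z -> Cmod (g z) <= M) ->
  exists F, log_bounded F /\ forall z, in_D z -> g z = Cexp (F z).
Proof.
  intros Hg Hz H1 HM. destruct (analytic_log g Hg Hz H1) as [F [HF [HF0 E]]].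
  exists F. split; [|exact E]. split; [exact HF|]. split; [exact HF0|].
  assert (HM1 : 1 <= M).
  { rewrite <- Cmod_1, <- H1. apply HM, in_D_0. }
  exists (ln M). split.
  { rewrite <- ln_1. destruct HM1 as [h| <-]; [left; apply ln_increasing; lra|lra]. }
  intros z HzD. specialize (HM z HzD). rewrite E, Cmod_Cexp in HM by exact HzD.
  rewrite <- (ln_exp (Re (F z))).
  destruct HM as [h| ->]; [left; apply ln_increasing; [apply exp_pos|exact h]|lra].
Qed.

Lemma A_0_bounded (f : C -> C) : A_ 0 f -> exists M, forall z, in_D z -> Cmod (f z) <= M.
Proof.
  intros [_ [a [r [Ha [Hr H]]]]]. exists (a * exp (r * 1)). intros z Hz.
  rewrite <- (rpow_0 (Rabs (ln (1 - Cmod z)))) by apply Rabs_pos. apply H, Hz.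
Qed.

Lemma normalized_log (g : C -> C) : A_ 0 g -> zero_free g ->
  exists F, log_bounded F /\ forall z, in_D z -> g z = (g (RtoC 0) * Cexp (F z))%C.
Proof.
  intros Hg Hz. assert (H0 := Hz _ in_D_0). destruct (A_0_bounded g Hg) as [M HM].
  destruct (bounded_log (fun z => / g (RtoC 0) * g z)%C (Cmod (/ g (RtoC 0)) * M))
    as [F [HF E]].
  - apply analytic_Cder. intros z HzD.
    destruct (proj1 (analytic_Cder g) (proj1 Hg) z HzD) as [c Hc].
    eexists. apply Cder_scal, Hc.
  - intros z HzD E. apply (Hz z HzD).
    replace (g z) with (g (RtoC 0) * (/ g (RtoC 0) * g z))%C by (field; exact H0).
    rewrite E. ring.
  - field. exact H0.
  - intros z HzD. rewrite Cmod_mult. apply Rmult_le_compat_l; [apply Cmod_ge_0|auto].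
  - exists F. split; [exact HF|]. intros z HzD. rewrite <- E by exact HzD. field. exact H0.
Qed.

(** Invertibility of [alpha] makes the numerator zero-free as well, and [alpha 0 = 1] makes the two
    normalizing constants [g1 0] and [g2 0] cancel. *)
Lemma N1_log (alpha : C -> C) : N1_ 0 alpha -> exists F1 F2,
  log_bounded F1 /\ log_bounded F2 /\
  forall z, in_D z -> alpha z = Cexp (F1 z - F2 z).
Proof.
  intros [[[g1 [g2 [H1 [H2 [Hz2 E]]]]] [beta [_ Hinv]]] Ha0].
  assert (Hz1 : zero_free g1).
  { intros z Hz E1. specialize (Hinv z Hz). rewrite E, E1 in Hinv by exact Hz.
    replace (RtoC 0 / g2 z * beta z)%C with (RtoC 0) in Hinv by (unfold Cdiv; ring).
    apply RtoC_inj in Hinv. lra. }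
  destruct (normalized_log g1 H1 Hz1) as [F1 [HF1 E1]].
  destruct (normalized_log g2 H2 Hz2) as [F2 [HF2 E2]].
  exists F1, F2. split; [exact HF1|]. split; [exact HF2|]. intros z Hz.
  assert (K1 := Hz1 _ in_D_0). assert (K2 := Hz2 _ in_D_0).
  assert (Ec : g1 (RtoC 0) = g2 (RtoC 0)).
  { rewrite E in Ha0 by apply in_D_0.
    replace (g1 (RtoC 0)) with (g1 (RtoC 0) / g2 (RtoC 0) * g2 (RtoC 0))%C by (field; exact K2).
    rewrite Ha0. ring. }
  rewrite E, E1, E2, Cexp_minus, Ec by exact Hz. field. split; [apply Cexp_nz|exact K2].
Qed.

Lemma log_bounded_le (F : C -> C) : log_bounded F -> exists K, 0 <= K /\
  forall z, in_D z -> Cmod (F z) <= K * (Cmod z / (1 - Cmod z)).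
Proof.
  intros [HF [HF0 [A [HA0 HA]]]]. exists (2 * A). split; [lra|].
  apply Borel_Caratheodory; assumption.
Qed.

(** [Psi] is multiplicative, so the growth bound applies to numerator and denominator apart;
    exchanging them gives the inverse. *)
Lemma Psi_N1 (s : nat) (N : nat -> nat) (alpha F1 F2 : C -> C) : (1 <= s)%nat ->
  admissible s N -> log_bounded F1 -> log_bounded F2 ->
  (forall z, in_D z -> alpha z = Cexp (F1 z - F2 z)) ->
  N1_ (INR s) (Psi s N alpha).
Proof.
  intros Hs Ha [A1 [Z1 [B1 [P1 L1]]]] [A2 [Z2 [B2 [P2 L2]]]] E.
  destruct (msum_exists (in_monoid s N) F1 A1 Z1) as [H1 [M1 AH1]].
  destruct (msum_exists (in_monoid s N) F2 A2 Z2) as [H2 [M2 AH2]].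
  assert (G1 := Psi_growth s N F1 H1 B1 Hs Ha A1 Z1 P1 L1 M1 AH1).
  assert (G2 := Psi_growth s N F2 H2 B2 Hs Ha A2 Z2 P2 L2 M2 AH2).
  assert (HP : forall z, in_D z -> Psi s N alpha z = Cexp (H1 z - H2 z)).
  { intros z Hz. apply (Psi_exp s N alpha _ _ E (msum_minus _ _ _ _ _ M1 M2) z Hz). }
  assert (Z : forall H, zero_free (fun z => Cexp (H z))) by (intros H z _; apply Cexp_nz).
  split; [split|].
  - exists (fun z => Cexp (H1 z)), (fun z => Cexp (H2 z)).
    split; [exact G1|]. split; [exact G2|]. split; [apply Z|].
    intros z Hz. rewrite HP by exact Hz. apply Cexp_minus.
  - exists (fun z => Cexp (H2 z - H1 z)). split.
    + exists (fun z => Cexp (H2 z)), (fun z => Cexp (H1 z)).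
      split; [exact G2|]. split; [exact G1|]. split; [apply Z|].
      intros z Hz. apply Cexp_minus.
    + intros z Hz. rewrite HP, <- Cexp_plus by exact Hz. rewrite <- Cexp_0. f_equal. ring.
  - rewrite HP by apply in_D_0.
    rewrite (msum_0 _ _ _ Z1 M1), (msum_0 _ _ _ Z2 M2), <- Cexp_0. f_equal. ring.
Qed.

(** For [u] the logarithm of [|f|] this says that [f] has no atom in any direction: the factor -1/2
    does not affect vanishing, and [0 <= r] makes [r] the modulus of the point. *)
Definition radial0 (u : C -> R) : Prop :=
  forall eta, Cmod eta = 1 -> forall eps, 0 < eps -> exists d, 0 < d /\
    forall r, 0 <= r -> 1 - d < r -> r < 1 -> Rabs ((1 - r) * u (RtoC r * eta)%C) < eps.

Lemma in_D_radius (r : R) (eta : C) : Cmod eta = 1 -> 0 <= r -> r < 1 -> in_D (RtoC r * eta)%C.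
Proof.
  intros He H0 H1. unfold in_D. rewrite Cmod_mult, Cmod_R, Rabs_pos_eq, He by exact H0. lra.
Qed.

Lemma atomless_radial0 (f F : C -> C) : (forall z, in_D z -> f z = Cexp (F z)) ->
  atomless f <-> radial0 (fun z => Re (F z)).
Proof.
  intros E.
  assert (L : forall eta r, Cmod eta = 1 -> 0 <= r -> r < 1 ->
    ln (Cmod (f (RtoC r * eta)%C)) = Re (F (RtoC r * eta)%C)).
  { intros eta r He H0 H1. rewrite E by (apply in_D_radius; assumption).
    rewrite Cmod_Cexp. apply ln_exp. }
  split.
  - intros H eta He eps Heps. destruct (H eta He) as [l [Hl El]].
    assert (l = 0) by lra. subst l.
    destruct (proj1 (filterlim_locally _ _) Hl (mkposreal eps Heps)) as [d Hd].
    exists d. split; [apply cond_pos|]. intros r H0 Hr H1.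
    assert (B : ball 1 d r).
    { change (Rabs (r - 1) < d). rewrite Rabs_left; lra. }
    specialize (Hd r B H1). change (Rabs ((1 - r) * ln (Cmod (f (RtoC r * eta)%C)) - 0) < eps) in Hd.
    rewrite Rminus_0_r, L in Hd by assumption. exact Hd.
  - intros H eta He. exists 0. split; [|lra].
    apply filterlim_locally. intros eps.
    destruct (H eta He eps (cond_pos eps)) as [d [Hd Hr]].
    (* A left neighbourhood of 1 of length at most 1 contains only nonnegative radii. *)
    assert (Q : 0 < Rmin d 1) by (apply Rmin_pos; lra).
    exists (mkposreal _ Q). intros r B H1. change (Rabs (r - 1) < Rmin d 1) in B.
    assert (Q1 := Rmin_l d 1). assert (Q2 := Rmin_r d 1).
    rewrite Rabs_left in B by lra.
    change (Rabs ((1 - r) * ln (Cmod (f (RtoC r * eta)%C)) - 0) < eps).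
    rewrite Rminus_0_r, L by (assumption || lra). apply Hr; lra.
Qed.

Lemma Bernoulli (r : R) (n : nat) : 0 <= r <= 1 -> 1 - INR n * (1 - r) <= r ^ n.
Proof.
  intros Hr. induction n as [|n IH]; [simpl; lra|]. rewrite S_INR. simpl pow.
  assert (r * (1 - INR n * (1 - r)) <= r * r ^ n) by (apply Rmult_le_compat_l; lra).
  assert (0 <= INR n * ((1 - r) * (1 - r))).
  { apply Rmult_le_pos; [apply pos_INR|]. apply Rmult_le_pos; lra. }
  lra.
Qed.

Lemma pow_radius_near_1 (n : nat) (d : R) : 0 < d ->
  exists d', 0 < d' /\ forall r, 0 <= r -> 1 - d' < r -> r < 1 -> 1 - d < r ^ n.
Proof.
  intros Hd. assert (P := pos_INR n). exists (d / (INR n + 1)).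
  split; [apply Rdiv_lt_0_compat; lra|]. intros r H0 Hr H1.
  assert (B := Bernoulli r n ltac:(lra)).
  assert (K : (1 - r) * (INR n + 1) < d) by (apply Rlt_div_r; lra).
  lra.
Qed.

Lemma Cpow_radius (r : R) (eta : C) (n : nat) :
  Cpow (RtoC r * eta) n = (RtoC (r ^ n) * Cpow eta n)%C.
Proof. rewrite Cpow_mult_l, RtoC_pow. reflexivity. Qed.

Lemma radius_pow_ratio (r : R) (n : nat) : 0 <= r <= 1 -> (2 <= n)%nat ->
  (1 - r) * (1 + r) <= 1 - r ^ n.
Proof.
  intros Hr Hn. assert (K := pow_le_pow r 2 n Hr Hn). simpl pow in K. lra.
Qed.

(* Substituting [z ^ n] shrinks a radial bound by a factor close to [1 / n]. *)
Lemma radial_pow (u : C -> R) (n : nat) (c : R) : (2 <= n)%nat -> 0 < c ->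
  (forall eta, Cmod eta = 1 -> exists d, 0 < d /\
    forall r, 0 <= r -> 1 - d < r -> r < 1 -> Rabs ((1 - r) * u (RtoC r * eta)%C) < c) ->
  forall eta, Cmod eta = 1 -> exists d, 0 < d /\
    forall r, 0 <= r -> 1 - d < r -> r < 1 ->
      Rabs ((1 - r) * u (Cpow (RtoC r * eta) n)) < 2 / 3 * c.
Proof.
  intros Hn Hc H eta He.
  destruct (H (Cpow eta n)) as [d [Hd Hu]]; [rewrite Cmod_pow, He; apply pow1|].
  destruct (pow_radius_near_1 n d Hd) as [d' [Hd' Hr']].
  (* For [r > 1/2] the ratio of [1 - r] to [1 - r ^ n] is at most [1 / (1 + r)], hence at most 2/3.
     The direction changes from [eta] to [eta ^ n], so the hypothesis is needed in every
     direction. *)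
  exists (Rmin d' (1 / 2)). split; [apply Rmin_pos; lra|]. intros r H0 Hr H1.
  assert (Q1 := Rmin_l d' (1 / 2)). assert (Q2 := Rmin_r d' (1 / 2)).
  assert (Hp0 : 0 <= r ^ n) by (apply pow_le, H0).
  assert (Hp1 : r ^ n < 1) by (apply pow_lt_1_compat; [lra|lia]).
  specialize (Hu (r ^ n) Hp0 (Hr' r H0 ltac:(lra) H1) Hp1).
  rewrite Cpow_radius. set (x := u (RtoC (r ^ n) * Cpow eta n)%C) in *.
  assert (K := radius_pow_ratio r n ltac:(lra) Hn).
  rewrite Rabs_mult, Rabs_pos_eq in * by lra.
  assert (Px := Rabs_pos x).
  assert ((1 - r) * (3 / 2) <= 1 - r ^ n) by nra.
  assert ((1 - r) * (3 / 2) * Rabs x <= (1 - r ^ n) * Rabs x) by (apply Rmult_le_compat_r; assumption).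
  lra.
Qed.

Lemma radial0_pow (u : C -> R) (n : nat) : (2 <= n)%nat -> radial0 u ->
  radial0 (fun z => u (Cpow z n)).
Proof.
  intros Hn Hu eta He eps Heps.
  destruct (radial_pow u n eps Hn Heps (fun eta He => Hu eta He eps Heps) eta He)
    as [d [Hd H]].
  exists d. split; [exact Hd|]. intros r H0 Hr H1.
  eapply Rlt_trans; [exact (H r H0 Hr H1)|lra].
Qed.

Lemma radial0_plus (u v w : C -> R) : (forall z, in_D z -> w z = u z + v z) ->
  radial0 u -> radial0 v -> radial0 w.
Proof.
  intros E Hu Hv eta He eps Heps.
  destruct (Hu eta He (eps / 2) ltac:(lra)) as [d1 [Hd1 H1]].
  destruct (Hv eta He (eps / 2) ltac:(lra)) as [d2 [Hd2 H2]].
  exists (Rmin d1 d2). split; [apply Rmin_pos; assumption|]. intros r H0 Hr Hr1.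
  assert (Q1 := Rmin_l d1 d2). assert (Q2 := Rmin_r d1 d2).
  specialize (H1 r H0 ltac:(lra) Hr1). specialize (H2 r H0 ltac:(lra) Hr1).
  rewrite E, Rmult_plus_distr_l by (apply in_D_radius; assumption).
  eapply Rle_lt_trans; [apply Rabs_triang|]. lra.
Qed.

Lemma radial0_opp (u : C -> R) : radial0 u -> radial0 (fun z => - u z).
Proof.
  intros H eta He eps Heps. destruct (H eta He eps Heps) as [d [Hd Hr]].
  exists d. split; [exact Hd|]. intros r H0 H1 H2.
  replace ((1 - r) * - u (RtoC r * eta)%C) with (- ((1 - r) * u (RtoC r * eta)%C)) by ring.
  rewrite Rabs_Ropp. apply Hr; assumption.
Qed.

Lemma msum_split (s : nat) (N : nat -> nat) (F H H' : C -> C) : admissible (S s) N ->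
  msum (in_monoid s N) F H -> msum (in_monoid (S s) N) F H' ->
  forall z, in_D z -> H' z = (H z + H' (Cpow z (N (S s))))%C.
Proof.
  intros Ha HH HH' z Hz. assert (HN : (2 <= N (S s))%nat) by (apply Ha; lia).
  apply Cconv_unique with (1 := HH' z Hz).
  assert (K1 := HH z Hz).
  assert (K2 := HH' (Cpow z (N (S s))) (in_D_pow z (N (S s)) Hz ltac:(lia))).
  apply (Cconv_subseq _ _ (fun n => (n / N (S s))%nat)) in K2.
  - refine (Cconv_ext _ _ _ _ (Cconv_plus _ _ _ _ K1 K2)). intros n. simpl.
    unfold Cfold at 3. rewrite mfold_split by (intros; ring || exact Ha).
    unfold Cfold. f_equal. apply pfold_ext; try (intros; ring).
    intros m _ _. rewrite Cpow_mult_r. reflexivity.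
  - intros n0. exists (N (S s) * n0)%nat. intros n Hn.
    apply Nat.div_le_lower_bound; lia.
Qed.

Lemma msum_trivial (N : nat -> nat) (F H : C -> C) : msum (in_monoid 0 N) F H ->
  forall z, in_D z -> H z = F z.
Proof.
  intros HH z Hz. apply Cconv_unique with (1 := HH z Hz).
  intros e He. exists 1%nat. intros n Hn.
  assert (E : Cfold (in_monoid 0 N) (fun m => F (Cpow z m)) n = F z).
  { destruct n as [|n]; [lia|]. clear Hn. induction n as [|n IH].
    - rewrite Cfold_S. unfold Cfold, pfold; simpl.
      destruct (excluded_middle_informative _) as [p|p].
      + rewrite Cplus_0_l, Cmult_1_r. reflexivity.
      + exfalso. apply p, in_monoid_1.
    - rewrite Cfold_S, IH. destruct (excluded_middle_informative _) as [p|p]; [|ring].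
      apply in_monoid_0 in p. lia. }
  rewrite E. replace (F z - F z)%C with (RtoC 0) by ring. rewrite Cmod_0. exact He.
Qed.

(** [1 - r ^ m] is [1 - r] times a sum of [m] powers of [r], each at least [r ^ m]. *)
Lemma pow_ratio_le (r : R) (m : nat) : 0 <= r < 1 -> (1 <= m)%nat ->
  r ^ m / (1 - r ^ m) <= / INR m * / (1 - r).
Proof.
  intros Hr Hm.
  assert (K : INR m * (1 - r) * r ^ m <= 1 - r ^ m).
  { clear Hm. induction m as [|m IH]; [simpl; lra|]. rewrite S_INR. simpl pow.
    assert (0 <= r ^ m) by (apply pow_le; lra).
    assert (H1 : 0 <= (INR m + 1) * (1 - r) * (r ^ m * (1 - r))).
    { repeat apply Rmult_le_pos; try lra. generalize (pos_INR m). lra. }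
    lra. }
  assert (Hp : r ^ m < 1) by (apply pow_lt_1_compat; [lra|lia]).
  assert (Hm0 : 0 < INR m) by (apply lt_0_INR; lia).
  apply Rle_div_l; [lra|].
  apply Rmult_le_reg_l with (INR m * (1 - r)); [apply Rmult_lt_0_compat; lra|].
  replace (INR m * (1 - r) * (/ INR m * / (1 - r) * (1 - r ^ m))) with (1 - r ^ m)
    by (field; lra). exact K.
Qed.

(** By [pow_ratio_le] the term for [m] is at most [K / (m * (1 - |z|))], and [monoid_harmonic] sums
    the [1 / m]. The order of growth at the circle is thus the same for [H] as for [F]. *)
Lemma msum_bound (s : nat) (N : nat -> nat) (F H : C -> C) (K : R) : admissible s N ->
  0 <= K -> (forall z, in_D z -> Cmod (F z) <= K * (Cmod z / (1 - Cmod z))) ->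
  msum (in_monoid s N) F H ->
  forall z, in_D z -> Cmod (H z) <= K * 2 ^ s * / (1 - Cmod z).
Proof.
  intros Ha HK HF HH z Hz. assert (Hz' := Hz). unfold in_D in Hz'.
  assert (P := Cmod_ge_0 z).
  replace (H z) with (H z - 0)%C by ring. apply Cconv_le with (1 := HH z Hz) (n0 := 0%nat).
  intros n _. replace (Cfold (in_monoid s N) (fun m => F (Cpow z m)) n - 0)%C
    with (Cfold (in_monoid s N) (fun m => F (Cpow z m)) n) by ring.
  eapply Rle_trans.
  - apply Cmod_Cfold_le with (b := fun m => K * / (1 - Cmod z) * / INR m). intros m Hm.
    eapply Rle_trans; [apply HF, in_D_pow; assumption|].
    rewrite Cmod_pow, Rmult_assoc. apply Rmult_le_compat_l; [exact HK|].
    eapply Rle_trans; [apply (pow_ratio_le (Cmod z) m ltac:(lra) Hm)|right; ring].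
  - rewrite Rfold_scal.
    apply Rle_trans with (K * / (1 - Cmod z) * 2 ^ s); [|lra].
    apply Rmult_le_compat_l; [|apply monoid_harmonic, Ha].
    apply Rmult_le_pos; [exact HK|]. left. apply Rinv_0_lt_compat. lra.
Qed.

(* Forwards, [H' z = H z + H' (z ^ N)] and [radial_pow] improve any radial bound
   on [H'] by the factor 3/4; backwards, [H z = H' z - H' (z ^ N)]. *)
Lemma radial0_msum (s : nat) (N : nat -> nat) (F H : C -> C) (K : R) : admissible s N ->
  analytic F -> F (RtoC 0) = RtoC 0 -> 0 <= K ->
  (forall z, in_D z -> Cmod (F z) <= K * (Cmod z / (1 - Cmod z))) ->
  msum (in_monoid s N) F H ->
  radial0 (fun z => Re (F z)) <-> radial0 (fun z => Re (H z)).
Proof.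
  intros Ha HF HF0 HK HB. revert H. induction s as [|s IH]; intros H' HH'.
  - assert (E := msum_trivial N F H' HH').
    split; intros R eta He eps Heps; destruct (R eta He eps Heps) as [d [Hd Hr]];
      exists d; (split; [exact Hd|]); intros r H0 H1 H2; specialize (Hr r H0 H1 H2);
      simpl in *; rewrite E in * by (apply in_D_radius; assumption); exact Hr.
  - assert (Has := admissible_S _ _ Ha). assert (HN : (2 <= N (S s))%nat) by (apply Ha; lia).
    destruct (msum_exists (in_monoid s N) F HF HF0) as [H [HH _]].
    specialize (IH Has H HH). rewrite IH. clear IH.
    assert (E := msum_split s N F H H' Ha HH HH').
    split; intros R.
    (* The case [k = 0] is [msum_bound]; adding 1 makes the constant positive, and the bound is
       uniform in [eta] because each step passes from [eta] to a power of it. *)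
    + assert (Hk : forall k eta, Cmod eta = 1 -> exists d, 0 < d /\
        forall r, 0 <= r -> 1 - d < r -> r < 1 ->
          Rabs ((1 - r) * Re (H' (RtoC r * eta)%C)) < (K * 2 ^ S s + 1) * (3 / 4) ^ k).
      { assert (PK : 0 <= K * 2 ^ S s).
        { apply Rmult_le_pos; [exact HK|apply pow_le; lra]. }
        induction k as [|k IHk]; intros eta He.
        - exists 1. split; [lra|]. intros r H0 _ H1.
          assert (B := msum_bound (S s) N F H' K Ha HK HB HH' _ (in_D_radius r eta He H0 H1)).
          rewrite Cmod_mult, Cmod_R, Rabs_pos_eq, He, Rmult_1_r in B by exact H0.
          rewrite Rabs_mult, Rabs_pos_eq by lra. simpl ((3 / 4) ^ 0).
          apply Rle_lt_trans with (K * 2 ^ S s); [|lra].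
          replace (K * 2 ^ S s) with ((1 - r) * (K * 2 ^ S s * / (1 - r))) by (field; lra).
          apply Rmult_le_compat_l; [lra|]. eapply Rle_trans; [apply re_le_Cmod|exact B].
        - set (c := (K * 2 ^ S s + 1) * (3 / 4) ^ k) in *.
          assert (Pc : 0 < c).
          { unfold c. apply Rmult_lt_0_compat; [lra|apply pow_lt; lra]. }
          destruct (radial_pow (fun z => Re (H' z)) (N (S s)) c HN Pc IHk eta He)
            as [d1 [Hd1 B1]].
          (* 1/12 is the difference between the wanted factor 3/4 and the factor 2/3 of
             [radial_pow]. *)
          destruct (R eta He (c / 12) ltac:(lra)) as [d2 [Hd2 B2]].
          exists (Rmin d1 d2). split; [apply Rmin_pos; assumption|]. intros r H0 Hr H1.
          assert (Q1 := Rmin_l d1 d2). assert (Q2 := Rmin_r d1 d2).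
          specialize (B1 r H0 ltac:(lra) H1). specialize (B2 r H0 ltac:(lra) H1).
          rewrite E by (apply in_D_radius; assumption).
          change (Re (?a + ?b)%C) with (Re a + Re b). rewrite Rmult_plus_distr_l.
          eapply Rle_lt_trans; [apply Rabs_triang|].
          replace ((K * 2 ^ S s + 1) * (3 / 4) ^ S k) with (c * (3 / 4))
            by (unfold c; simpl pow; ring).
          lra. }
      intros eta He eps Heps.
      assert (PK : 0 < K * 2 ^ S s + 1).
      { assert (0 <= K * 2 ^ S s) by (apply Rmult_le_pos; [exact HK|apply pow_le; lra]). lra. }
      destruct (pow_lt_1_zero (3 / 4) ltac:(rewrite Rabs_pos_eq; lra)
        (eps / (K * 2 ^ S s + 1))) as [k Hq]; [apply Rdiv_lt_0_compat; assumption|].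
      specialize (Hq k (le_n k)). rewrite Rabs_pos_eq in Hq by (apply pow_le; lra).
      apply Rlt_div_r in Hq; [|exact PK].
      destruct (Hk k eta He) as [d [Hd B]]. exists d. split; [exact Hd|].
      intros r H0 Hr H1. eapply Rlt_trans; [exact (B r H0 Hr H1)|lra].
    + apply (radial0_plus _ _ _) with (2 := R)
        (3 := radial0_opp _ (radial0_pow _ _ HN R)).
      intros z Hz. simpl. rewrite (E z Hz) at 1. change (Re (?a + ?b)%C) with (Re a + Re b). ring.
Qed.

(** Here the difference [F1 - F2] can be treated at once, since the modulus bounds of
    [log_bounded_le] add up. *)
Lemma Psi_atomless (s : nat) (N : nat -> nat) (alpha F1 F2 : C -> C) :
  admissible s N -> log_bounded F1 -> log_bounded F2 ->
  (forall z, in_D z -> alpha z = Cexp (F1 z - F2 z)) ->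
  atomless alpha <-> atomless (Psi s N alpha).
Proof.
  intros Ha B1 B2 E.
  destruct (log_bounded_le F1 B1) as [K1 [P1 L1]]. destruct (log_bounded_le F2 B2) as [K2 [P2 L2]].
  destruct B1 as [A1 [Z1 _]]. destruct B2 as [A2 [Z2 _]].
  set (F := fun z => (F1 z - F2 z)%C) in *.
  assert (AF : analytic F).
  { apply analytic_Cder. intros z Hz.
    destruct (proj1 (analytic_Cder F1) A1 z Hz) as [c1 Hc1].
    destruct (proj1 (analytic_Cder F2) A2 z Hz) as [c2 Hc2].
    eexists. apply Cder_minus; [exact Hc1|exact Hc2]. }
  assert (ZF : F (RtoC 0) = RtoC 0) by (unfold F; rewrite Z1, Z2; ring).
  destruct (msum_exists (in_monoid s N) F AF ZF) as [H [HH _]].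
  rewrite (atomless_radial0 alpha F E).
  rewrite (atomless_radial0 (Psi s N alpha) H).
  2:{ intros z Hz. apply (Psi_exp s N alpha F H E HH z Hz). }
  apply radial0_msum with (s := s) (N := N) (K := K1 + K2); auto; [lra|].
  intros z Hz. eapply Rle_trans; [apply Cmod_minus_le|].
  generalize (L1 z Hz) (L2 z Hz). lra.
Qed.


(** * The cocycle identity *)

Lemma Cprod_app (l l' : list C) : Cprod (l ++ l') = (Cprod l * Cprod l')%C.
Proof. induction l as [|x l IH]; simpl; [ring|]. unfold Cprod in *; simpl. rewrite IH. ring. Qed.

Lemma Cprod_Permutation (l l' : list C) : Permutation l l' -> Cprod l = Cprod l'.
Proof.
  intros H. unfold Cprod. induction H as [|x l l' H IH|x y l|l l' l'' H IH H' IH']; simpl.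
  - reflexivity.
  - rewrite IH. reflexivity.
  - ring.
  - congruence.
Qed.

Lemma Cprod_map_mult (A : Type) (f g : A -> C) (l : list A) :
  Cprod (map (fun x => f x * g x)%C l) = (Cprod (map f l) * Cprod (map g l))%C.
Proof. unfold Cprod. induction l as [|x l IH]; simpl; [ring|]. rewrite IH. ring. Qed.

Lemma Cprod_map_const (A : Type) (c : C) (l : list A) :
  Cprod (map (fun _ => c) l) = Cpow c (length l).
Proof. unfold Cprod. induction l as [|x l IH]; simpl; [reflexivity|]. rewrite IH. reflexivity. Qed.

Lemma Cprod_map_pow (A : Type) (f : A -> C) (n : nat) (l : list A) :
  Cprod (map (fun x => Cpow (f x) n) l) = Cpow (Cprod (map f l)) n.
Proof.
  unfold Cprod. induction l as [|x l IH]; simpl; [symmetry; apply Cpow_1_l|].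
  rewrite IH, Cpow_mult_l. reflexivity.
Qed.

Lemma Cprod_exchange (A B : Type) (f : A -> B -> C) (l : list A) (l' : list B) :
  Cprod (map (fun x => Cprod (map (f x) l')) l) =
  Cprod (map (fun y => Cprod (map (fun x => f x y) l)) l').
Proof.
  induction l as [|x l IH]; simpl.
  - rewrite Cprod_map_const, Cpow_1_l. reflexivity.
  - rewrite (Cprod_map_mult B (f x) (fun y => Cprod (map (fun x => f x y) l))), <- IH.
    reflexivity.
Qed.

Lemma Cconv_Cprod (A : Type) (u : A -> nat -> C) (v : A -> C) (l : list A) :
  (forall x, In x l -> Cconv (u x) (v x)) ->
  Cconv (fun n => Cprod (map (fun x => u x n) l)) (Cprod (map v l)).
Proof.
  induction l as [|x l IH]; intros H; simpl; [apply Cconv_const|].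
  apply (Cconv_mult (u x) (fun n => Cprod (map (fun x => u x n) l))).
  - apply H. left. reflexivity.
  - apply IH. intros y Hy. apply H. right. exact Hy.
Qed.

Lemma length_unity_roots (n : nat) : length (unity_roots n) = n.
Proof. unfold unity_roots. rewrite length_map, length_seq. reflexivity. Qed.

Lemma unity_root_Cmod (n : nat) (zeta : C) : In zeta (unity_roots n) -> Cmod zeta = 1.
Proof.
  intros H. unfold unity_roots in H. apply in_map_iff in H. destruct H as [k [<- _]].
  set (t := 2 * PI * INR k / INR n). unfold Cmod; simpl.
  replace (_ + _) with (Rsqr (sin t) + Rsqr (cos t)) by (unfold Rsqr; ring).
  rewrite sin2_cos2. apply sqrt_1.
Qed.

(** A Bezout coefficient [a] with [a * m = 1 + b * n] provides the power map inverse to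
    [zeta -> zeta ^ m]; an injective self-map of a finite set is a permutation. *)
Lemma unity_roots_pow_perm (n m : nat) : (1 <= n)%nat -> Nat.gcd m n = 1%nat ->
  Permutation (map (fun zeta => Cpow zeta m) (unity_roots n)) (unity_roots n).
Proof.
  (* The Bezout identity with positive sign requires [m > 0]; for [m = 0] coprimality forces
     [n = 1]. *)
  intros Hn Hg. destruct (Nat.eq_dec m 0) as [->|Hm].
  { simpl in Hg. subst n. replace (unity_roots 1) with (RtoC 1 :: nil); [reflexivity|].
    unfold unity_roots; simpl. f_equal.
    replace (2 * PI * 0 / 1) with 0 by field. rewrite cos_0, sin_0. reflexivity. }
  destruct (Nat.gcd_bezout_pos m n ltac:(lia)) as [a [b Hab]]. rewrite Hg in Hab.
  assert (Hinv : forall zeta, In zeta (unity_roots n) -> Cpow (Cpow zeta m) a = zeta).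
  { intros zeta Hz. apply in_unity_roots in Hz; [|lia].
    rewrite <- Cpow_mult_r, Nat.mul_comm, Hab, Cpow_add_r, Cpow_1_r.
    rewrite Nat.mul_comm, Cpow_mult_r, Hz, Cpow_1_l. ring. }
  apply NoDup_Permutation_bis.
  - apply NoDup_map_NoDup_ForallPairs; [|apply NoDup_unity_roots].
    intros x y Hx Hy E. rewrite <- (Hinv x Hx), <- (Hinv y Hy), E. reflexivity.
  - rewrite length_map. lia.
  - intros x Hx. apply in_map_iff in Hx. destruct Hx as [zeta [<- Hz]].
    apply in_unity_roots in Hz; [|lia]. apply in_unity_roots; [lia|].
    rewrite <- Cpow_mult_r, Nat.mul_comm, Cpow_mult_r, Hz. apply Cpow_1_l.
Qed.

Lemma Cprod_seq_mul (u : nat -> C) (a b : nat) :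
  Cprod (map u (seq 0 (a * b))) =
  Cprod (map (fun k => Cprod (map (fun l => u (k * b + l)%nat) (seq 0 b))) (seq 0 a)).
Proof.
  induction a as [|a IH]; [reflexivity|].
  replace (S a * b)%nat with (a * b + b)%nat by lia.
  rewrite seq_app, map_app, Cprod_app, IH, seq_S, map_app, Cprod_app. f_equal.
  simpl. unfold Cprod at 2. simpl. rewrite Cmult_1_r. f_equal.
  assert (K : forall k c, map u (seq (c + k) b) = map (fun l => u (c + l)%nat) (seq k b)).
  { clear IH. induction b as [|b IHb]; intros k c; [reflexivity|]. simpl. f_equal.
    rewrite <- Nat.add_succ_r. apply IHb. }
  rewrite <- K, Nat.add_0_r. reflexivity.
Qed.

(* Writing an (a b)-th root of unity as a product of an a-th root and of a
   fixed a-th root of a b-th root. *)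
Lemma norm_prod_mul (a b : nat) (f : C -> C) (z : C) : (1 <= a)%nat -> (1 <= b)%nat ->
  (forall n w, In n (a :: b :: nil) -> in_D w -> Cpow (f (Cpow w n)) n = Defs.norm_prod n f w) ->
  in_D z -> Cpow (f (Cpow z (a * b))) (a * b) = Defs.norm_prod (a * b) f z.
Proof.
  intros Ha Hb H Hz.
  assert (Ia : 0 < INR a) by (apply lt_0_INR; lia).
  assert (Ib : 0 < INR b) by (apply lt_0_INR; lia).
  set (cis := fun t : R => (cos t, sin t) : C).
  assert (Hcis : forall s t, (cis s * cis t)%C = cis (s + t)).
  { intros s t. unfold cis. rewrite cos_plus, sin_plus. unfold Cmult; simpl. f_equal; ring. }
  set (root := fun l : nat => cis (2 * PI * INR l / INR (a * b))).
  assert (HD : forall l, in_D (root l * z)%C).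
  { intros l. unfold in_D. rewrite Cmod_mult. unfold root, cis.
    replace (Cmod (cos _, sin _)) with 1; [rewrite Rmult_1_l; exact Hz|].
    set (t := 2 * PI * INR l / INR (a * b)). unfold Cmod; simpl.
    replace (_ + _) with (Rsqr (sin t) + Rsqr (cos t)) by (unfold Rsqr; ring).
    rewrite sin2_cos2. symmetry. apply sqrt_1. }
  rewrite (Cpow_mult_r z a b), (Nat.mul_comm a b), Cpow_mult_r.
  rewrite (H b (Cpow z a)) by (simpl; auto; apply in_D_pow; assumption).
  unfold Defs.norm_prod at 1. rewrite <- Cprod_map_pow. unfold unity_roots at 1. rewrite map_map.
  unfold Defs.norm_prod, unity_roots. rewrite map_map, (Nat.mul_comm b a), Cprod_seq_mul.
  rewrite Cprod_exchange. f_equal. apply map_ext. intros l.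
  (* Having used the identity for [b] at [z ^ a], each rotated point is written as the [a]-th power
     of [root l * z], where the identity for [a] applies. *)
  replace ((cos (2 * PI * INR l / INR b), sin (2 * PI * INR l / INR b)) * Cpow z a)%C
    with (Cpow (root l * z) a).
  - rewrite (H a (root l * z)%C) by (simpl; auto).
    unfold Defs.norm_prod, unity_roots. rewrite map_map. f_equal. apply map_ext. intros k.
    f_equal. rewrite Cmult_assoc. f_equal.
    change (cis (2 * PI * INR k / INR a)%R * root l = cis (2 * PI * INR (k * b + l) / INR (a * b))%R)%C.
    unfold root. rewrite Hcis. f_equal. rewrite plus_INR, !mult_INR. field. lra.
  - rewrite Cpow_mult_l. f_equal. unfold root, cis. rewrite Cpow_cis.
    replace (INR a * (2 * PI * INR l / INR (a * b))) with (2 * PI * INR l / INR b)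
      by (rewrite mult_INR; field; lra). reflexivity.
Qed.

Lemma norm_prod_1 (f : C -> C) (z : C) : Defs.norm_prod 1 f z = f z.
Proof.
  unfold Defs.norm_prod, unity_roots; simpl.
  replace (2 * PI * 0 / 1) with 0 by field. rewrite cos_0, sin_0.
  unfold Cprod; simpl. rewrite Cmult_1_r. f_equal.
  change ((1, 0) : C) with (RtoC 1). ring.
Qed.

Lemma Cprod_pfold (A : Type) (P : nat -> Prop) (phi : A -> nat -> C) (l : list A) (n : nat) :
  Cprod (map (fun x => pfold Cmult (RtoC 1) P (phi x) n) l) =
  pfold Cmult (RtoC 1) P (fun m => Cprod (map (fun x => phi x m) l)) n.
Proof.
  unfold pfold. change (fold_right Cmult (RtoC 1)) with Cprod.
  rewrite Cprod_exchange. f_equal. apply map_ext. intros m.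
  destruct (excluded_middle_informative (P m)); [reflexivity|].
  rewrite Cprod_map_const. apply Cpow_1_l.
Qed.

Lemma pfold_Cpow (P : nat -> Prop) (phi : nat -> C) (k n : nat) :
  pfold Cmult (RtoC 1) P (fun m => Cpow (phi m) k) n = Cpow (pfold Cmult (RtoC 1) P phi n) k.
Proof.
  unfold pfold. change (fold_right Cmult (RtoC 1)) with Cprod. rewrite <- Cprod_map_pow.
  f_equal. apply map_ext. intros m. destruct (excluded_middle_informative (P m)); [reflexivity|].
  symmetry. apply Cpow_1_l.
Qed.

Lemma Cconv_Cpow (u : nat -> C) (l : C) (n : nat) : Cconv u l ->
  Cconv (fun k => Cpow (u k) n) (Cpow l n).
Proof.
  intros H. apply (Cconv_cont (fun w => Cpow w n)); [|exact H]. eapply Cder_Ccont, Cder_pow.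
Qed.

(* Rotating by the roots of unity of order [N i], a factor [alpha (z ^ m)] with
   [m] prime to [N i] runs over a full set of rotations and contributes 1, and
   one with [m = N i * m'] is left unchanged. *)
Lemma Psi_generator (s : nat) (N : nat -> nat) (alpha : C -> C) (i : nat) :
  admissible s N -> (1 <= i <= s)%nat ->
  (forall z, in_D z -> Cconv (Psi_partial s N alpha z) (Psi s N alpha z)) ->
  (forall z, in_D z -> Defs.norm_prod (N i) alpha z = RtoC 1) ->
  forall z, in_D z -> Cpow (Psi s N alpha (Cpow z (N i))) (N i) = Defs.norm_prod (N i) (Psi s N alpha) z.
Proof.
  intros Ha Hi HP HZ z Hz. set (n := N i) in *.
  assert (Hn : (2 <= n)%nat) by (apply Ha, Hi).
  set (S := in_monoid s N).
  (* The form required by [pfold_split], now for an arbitrary generator rather than the last one. *)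
  assert (HS : forall m, S m <-> (S m /\ ~ Nat.divide n m) \/ exists m', m = (n * m')%nat /\ S m').
  { intros m. split.
    - intros Hm. destruct (in_monoid_cases s N i m Ha Hi Hm) as [Hd|Hg]; [right; exact Hd|].
      left. split; [exact Hm|]. apply coprime_not_divide; assumption.
    - intros [[Hm _]|[m' [-> Hm]]]; [exact Hm|]. apply in_monoid_mul; assumption. }
  set (phi := fun m => Cprod (map (fun zeta => alpha (Cpow (zeta * z) m)) (unity_roots n))).
  assert (Hphi1 : forall m, S m -> ~ Nat.divide n m -> (1 <= m)%nat -> phi m = RtoC 1).
  { intros m Hm Hd Hm1. destruct (in_monoid_cases s N i m Ha Hi Hm) as [[m' [E _]]|Hg].
    - exfalso. apply Hd. exists m'. unfold n. lia.
    - rewrite <- (HZ (Cpow z m)) by (apply in_D_pow; assumption). unfold phi, Defs.norm_prod.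
      rewrite <- (Cprod_Permutation _ _ (Permutation_map (fun zeta => alpha (zeta * Cpow z m)%C)
        (unity_roots_pow_perm n m ltac:(lia) Hg))).
      rewrite map_map. f_equal. apply map_ext. intros zeta. rewrite Cpow_mult_l. reflexivity. }
  assert (Hphi2 : forall m, phi (n * m)%nat = Cpow (alpha (Cpow (Cpow z n) m)) n).
  { intros m. unfold phi.
    rewrite <- (length_unity_roots n) at 3.
    rewrite <- Cprod_map_const. f_equal. apply map_ext_in. intros zeta Hzeta.
    apply in_unity_roots in Hzeta; [|lia].
    rewrite Cpow_mult_l, (Cpow_mult_r zeta n m), Hzeta, Cpow_1_l, Cmult_1_l, Cpow_mult_r.
    reflexivity. }
  (* Both sides are limits of one sequence: the finite product over rotations up to [k] equals the
     [n]-th power of the partial product at [z ^ n] up to [k / n]. *)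
  apply Cconv_unique with (fun k => Cprod (map (fun zeta => Psi_partial s N alpha (zeta * z) k)
    (unity_roots n))).
  2:{ unfold Defs.norm_prod. apply (Cconv_Cprod C (fun zeta k => Psi_partial s N alpha (zeta * z) k)).
      intros zeta Hzeta. apply HP. unfold in_D.
      rewrite Cmod_mult, (unity_root_Cmod n zeta Hzeta), Rmult_1_l. exact Hz. }
  assert (K := HP (Cpow z n) (in_D_pow z n Hz ltac:(lia))).
  apply (Cconv_subseq _ _ (fun k => (k / n)%nat)) in K.
  2:{ intros n0. exists (n * n0)%nat. intros k Hk. apply Nat.div_le_lower_bound; lia. }
  apply (Cconv_Cpow _ _ n) in K. refine (Cconv_ext _ _ _ _ K). intros k. simpl.
  change (Cpow (pfold Cmult (RtoC 1) S (fun m => alpha (Cpow (Cpow z n) m)) (k / n)) n =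
    Cprod (map (fun zeta => pfold Cmult (RtoC 1) S (fun m => alpha (Cpow (zeta * z) m)) k)
      (unity_roots n))).
  rewrite (Cprod_pfold C S (fun zeta m => alpha (Cpow (zeta * z) m))). fold phi.
  rewrite (pfold_split C Cmult (RtoC 1)) with (phi := phi) (Q := fun m => S m /\ ~ Nat.divide n m) (N := n);
    try (intros; ring); try assumption.
  2:{ intros m [_ Hd]. exact Hd. }
  rewrite (pfold_ext C Cmult (RtoC 1)) with (P := fun m => S m /\ ~ Nat.divide n m)
    (psi := fun _ => RtoC 1); try (intros; ring).
  2:{ intros m [Hm Hd] Hm1. apply Hphi1; assumption. }
  rewrite pfold_unit by (intros; ring). rewrite Cmult_1_l, <- pfold_Cpow.
  apply pfold_ext; try (intros; ring). intros m _ _. symmetry. apply Hphi2.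
Qed.

Lemma cocycle_of_generators (s : nat) (N : nat -> nat) (f : C -> C) : admissible s N ->
  (forall i, (1 <= i <= s)%nat -> forall z, in_D z ->
     Cpow (f (Cpow z (N i))) (N i) = Defs.norm_prod (N i) f z) ->
  forall n, in_monoid s N n -> forall z, in_D z -> Cpow (f (Cpow z n)) n = Defs.norm_prod n f z.
Proof.
  intros [H2 _] Hgen n [nu E]. change (n = mprod N nu s) in E. subst n.
  (* Positivity is carried along because [norm_prod_mul] divides by both orders. *)
  set (G := fun n => (1 <= n)%nat /\ forall z, in_D z -> Cpow (f (Cpow z n)) n = Defs.norm_prod n f z).
  assert (G1 : G 1%nat).
  { split; [lia|]. intros z Hz. rewrite norm_prod_1, !Cpow_1_r. reflexivity. }
  assert (Gm : forall a b, G a -> G b -> G (a * b)%nat).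
  { intros a b [Pa Ga] [Pb Gb]. split; [nia|]. intros z Hz. apply norm_prod_mul; auto.
    intros n w [<-|[<-|[]]] Hw; auto. }
  enough (K : forall t, (t <= s)%nat -> G (mprod N nu t)) by (apply (K s), le_n).
  induction t as [|t IH]; intros Ht; [exact G1|]. rewrite mprod_S.
  apply Gm; [apply IH; lia|].
  assert (GN : G (N (S t))).
  { split; [specialize (H2 (S t)); lia|]. apply Hgen. lia. }
  induction (nu (S t)) as [|k IHk]; [exact G1|]. rewrite Nat.pow_succ_r'. apply Gm; assumption.
Qed.

Theorem theorem49 (s : nat) (N : nat -> nat)
  (hs : (1 <= s)%nat)
  (hN : forall i : nat, (1 <= i <= s)%nat -> (2 <= N i)%nat)
  (hcop : forall i j : nat, (1 <= i <= s)%nat -> (1 <= j <= s)%nat -> i <> j ->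
            Nat.gcd (N i) (N j) = 1%nat) :
  (* (a) *)
  ((forall alpha : C -> C,
      units analytic alpha -> Hinfty alpha -> alpha (RtoC 0) = RtoC 1 ->
      A1_ (INR s) (Psi s N alpha)) /\
   (forall alpha : C -> C, N1_ 0%R alpha ->
      N1_ (INR s) (Psi s N alpha) /\
      (atomless alpha <-> atomless (Psi s N alpha)))) /\
  (* (b) *)
  ((forall alpha : C -> C, Z_ s N alpha -> H0_ s N (INR s) (Psi s N alpha)) /\
   (forall alpha : C -> C, Z_ s N alpha ->
      (atomless alpha <-> atomless (Psi s N alpha)))).
Proof.
  assert (Ha : admissible s N) by (split; assumption).
  assert (HN : forall alpha, N1_ 0 alpha -> N1_ (INR s) (Psi s N alpha) /\
    (atomless alpha <-> atomless (Psi s N alpha))).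
  { intros alpha Hal. destruct (N1_log alpha Hal) as [F1 [F2 [B1 [B2 E]]]]. split.
    - apply Psi_N1 with F1 F2; assumption.
    - apply Psi_atomless with F1 F2; assumption. }
  split; split.
  - intros alpha [_ [beta [_ Hinv]]] [Han [M HM]] H1.
    assert (Hz : zero_free alpha).
    { intros z Hz E. specialize (Hinv z Hz). rewrite E, Cmult_0_l in Hinv.
      apply RtoC_inj in Hinv. lra. }
    destruct (bounded_log alpha M Han Hz H1 HM) as [F [[HF [HF0 [A [HA0 HA]]]] E]].
    destruct (msum_exists (in_monoid s N) F HF HF0) as [H [HH AH]].
    assert (EP : forall z, in_D z -> Psi s N alpha z = Cexp (H z))
      by (intros z HzD; apply (Psi_exp s N alpha F H E HH z HzD)).
    split; [|split].
    + apply A_ext with (fun z => Cexp (H z)); [intros z HzD; symmetry; auto|].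
      apply Psi_growth with N F A; assumption.
    + rewrite EP, (msum_0 _ _ _ HF0 HH) by apply in_D_0. apply Cexp_0.
    + intros z HzD. rewrite EP by exact HzD. apply Cexp_nz.
  - exact HN.
  - intros alpha [Hal HZ]. split; [apply HN, Hal|].
    (* The logarithms are needed again to show that the partial products converge at every point of
       the disc. *)
    destruct (N1_log alpha Hal) as [F1 [F2 [B1 [B2 E]]]].
    destruct B1 as [A1 [Z1 _]]. destruct B2 as [A2 [Z2 _]].
    destruct (msum_exists (in_monoid s N) F1 A1 Z1) as [H1 [M1 _]].
    destruct (msum_exists (in_monoid s N) F2 A2 Z2) as [H2 [M2 _]].
    apply cocycle_of_generators; [exact Ha|]. intros i Hi. apply Psi_generator; auto.
    + intros z Hz. apply (Psi_exp s N alpha _ _ E (msum_minus _ _ _ _ _ M1 M2) z Hz).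
    + apply HZ; [apply in_monoid_gen, Hi|]. specialize (hN i Hi). lia.
  - intros alpha [Hal _]. apply HN, Hal.
Qed.
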